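(* Let $\beta\ge0$, $b\in2^{F^0}$, and let $u:\Omega\times[0,\infty)\times F\to\mathbb R$ be the (random field) solution to the SPDE $du=\dot u\,dt$, $d\dot u=-2\beta\dot u\,dt+\Delta_bu\,dt+dW$, $u(0)=\dot u(0)=0$. Let $\delta=1-\frac{d_s}{2}$. Then there exists a version $\tilde u$ of $u$ which satisfies the following: (1) For each $T>0$, $\tilde u$ is almost surely essentially $(\frac12\wedge\delta)$-H\''older continuous on $[0,T]\times F$ with respect to $R_\infty$. (2) For each $t\in[0,\infty)$, $\tilde u(t,\cdot)$ is almost surely essentially $\frac12$-H\''older continuous on $F$ with respect to $R$. (3) For each $x\in F$ and each $T>0$, $\tilde u(\cdot,x)$ is almost surely essentially $\delta$-H\''older continuous on $[0,T]$ with respect to the Euclidean metric. Moreover, the collection of random variables $\tilde u=(\tilde u(t,x))_{(t,x)\in[0,\infty)\times F}$ is such that $(\tilde u(t,\cdot))_{t\in[0,\infty)}$ is an $\mathcal H$-valued process, and moreover $(\tilde u(t,\cdot))_{t\in[0,\infty)}$ is an $\mathcal H$-continuous version of the $\mathcal H$-valued solution $u(t)=\int_0^tV_\beta(-\Delta_b,t-s)\,dW(s)$ of the SPDE.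
   Context: Fractal setting. Let $M\ge2$, $I=\{1,\dots,M\}$, and let $F$ be a connected compact metric space with injective strict contractions $\psi_i:F\to F$ ($i\in I$), $F=\bigcup_i\psi_i(F)$. Put $\mathbb W_n=I^n$, $\mathbb W_*=\bigcup_{n\ge0}\mathbb W_n$, $\mathbb W=I^{\mathbb N}$, $\psi_w=\psi_{w_1}\circ\cdots\circ\psi_{w_n}$ and $F_w=\psi_w(F)$ for $w=w_1\cdots w_n\in\mathbb W_n$ (identity for the empty word). Let $\pi:\mathbb W\to F$ be the continuous surjection with $\{\pi(w)\}=\bigcap_n F_{w_1\cdots w_n}$. With $\sigma$ the left shift on $\mathbb W$ and $C=\pi^{-1}(\bigcup_{i\ne j}F_i\cap F_j)$, assume the post-critical set $P=\bigcup_{n\ge1}\sigma^n(C)$ is finite (so $(F,(\psi_i))$ is a p.c.f. self-similar set). Let $F^0=\pi(P)$, $F^n=\bigcup_{w\in\mathbb W_n}\psi_w(F^0)$. Let $(A_0,\mathbf r)$ be a regular irreducible harmonic structure: $A_0=(a_{xy})_{x,y\in F^0}$ is a real symmetric irreducible matrix with $a_{xy}\ge0$ for $x\ne y$ and zero row sums, $\mathbf r=(r_1,\dots,r_M)$ with $r_i\in(0,1)$, and, writing $\mathcal E_0(f,f)=\frac12\sum_{x,y\in F^0}a_{xy}(f(x)-f(y))^2$, $r_w=\prod_i r_{w_i}$ and $\mathcal E_n(f,f)=\sum_{w\in\mathbb W_n}r_w^{-1}\mathcal E_0(f\circ\psi_w|_{F^0},f\circ\psi_w|_{F^0})$ for $f:F^n\to\mathbb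 R$, one has $\mathcal E_0(f,f)=\min\{\mathcal E_1(g,g):g:F^1\to\mathbb R,\ g|_{F^0}=f\}$ for all $f:F^0\to\mathbb R$. Let $\mathcal D=\{f\in C(F):\sup_n\mathcal E_n(f|_{F^n},f|_{F^n})<\infty\}$, $\mathcal E(f,f)=\lim_n\mathcal E_n(f|_{F^n},f|_{F^n})$ (extended to a bilinear form by polarisation). The resistance metric is $R(x,y)=(\inf\{\mathcal E(f,f):f\in\mathcal D,f(x)=0,f(y)=1\})^{-1}$ for $x\ne y$, $R(x,x)=0$; it generates the topology of $F$. Let $d_H$ be the unique real with $\sum_i r_i^{d_H}=1$, $d_s=\frac{2d_H}{d_H+1}$ (one has $d_H\ge1$, $d_s\in[1,2)$), and $\mu$ the Borel probability measure on $F$ with $\mu(F_w)=r_w^{d_H}$ for all $w\in\mathbb W_*$. Let $\mathcal H=L^2(F,\mu)$ with inner product $\langle\cdot,\cdot\rangle_\mu$. For $b\subseteq F^0$ (i.e. $b\in2^{F^0}$) let $\mathcal D_b=\{f\in\mathcal D:f|_{F^0\setminus b}=0\}$; $(\mathcal E,\mathcal D_b)$ is a Dirichlet form on $\mathcal H$ and $\Delta_b$ is its generator, the nonpositive self-adjoint operator with: $f\in\mathcal D(\Delta_b)$, $\Delta_bf=h$ iff $f\in\mathcal D_b$ and $\mathcal E(f,g)=-\langle h,g\rangle_\mu$ for all $g\in\mathcal D_b$. There is an orthonormal basis $(\phi^b_k)_{k\ge1}$ of $\mathcal H$ with $-\Delta_b\phi^b_k=\lambda^b_k\phi^b_k$,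 $0\le\lambda^b_1\le\lambda^b_2\le\cdots$; each $\phi^b_k\in\mathcal D_b$ is a continuous function. Noise and solution. $W$ is a cylindrical Wiener process on $\mathcal H$ on a probability space $(\Omega,\mathcal F,\mathbb P)$: $\mathbb E[\langle f,W(s)\rangle_\mu\langle W(t),g\rangle_\mu]=(s\wedge t)\langle f,g\rangle_\mu$; thus $(\langle\phi^b_k,W\rangle_\mu)_{k\ge1}$ are independent standard real Brownian motions. For $\lambda,\beta\ge0$, $V_\beta(\lambda,\cdot):[0,\infty)\to\mathbb R$ is the unique solution of $v''+2\beta v'+\lambda v=0$, $v(0)=0$, $v'(0)=1$. Put $Y^{b,\beta}_k(t)=\int_0^tV_\beta(\lambda^b_k,t-s)\langle\phi^b_k,dW(s)\rangle_\mu$. The unique global $\mathcal H$-valued solution of the SPDE is the centred Gaussian process $u(t)=\int_0^tV_\beta(-\Delta_b,t-s)\,dW(s)=\sum_{k\ge1}Y^{b,\beta}_k(t)\phi^b_k$ (series in $L^2(\Omega;\mathcal H)$). The random field solution is $u(t,x)=\sum_{k\ge1}Y^{b,\beta}_k(t)\phi^b_k(x)$, $(t,x)\in[0,\infty)\times F$, a series converging in $L^2(\Omega)$ to a centred Gaussian random variable. A version of $u$ is a family $\tilde u$ with $\tilde u(t,x)=u(t,x)$ a.s. for each $(t,x)$; similarly for $\mathcal H$-valued processes, for each $t$. Metrics and H\''older continuity. $R_\infty((s,x),(t,y))=|s-t|\vee R(x,y)$ on $\mathbb R\times F$. A function $f:(M_1,d_1)\to(M_2,d_2)$ between metric spaces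 is essentially $\delta$-H\''older continuous ($\delta\in(0,1]$) if for each $\gamma\in(0,\delta)$ there is $C_\gamma>0$ with $d_2(f(x),f(y))\le C_\gamma d_1(x,y)^\gamma$ for all $x,y\in M_1$. *)

(* Defs.v *)
From HB Require Import structures.
From mathcomp Require Import all_boot all_order all_algebra.
From mathcomp Require Import all_classical all_reals all_analysis.

Set Implicit Arguments.
Unset Strict Implicit.
Unset Printing Implicit Defensive.

Import Order.TTheory GRing.Theory Num.Theory.
Import numFieldNormedType.Exports.

Local Open Scope classical_set_scope.
Local Open Scope ring_scope.

(* The base point only serves to form Borel measurable spaces, which the
   library requires to be nonempty. *)
#[short(type="pMetricType")]
HB.structure Definition PMetric (K : numDomainType) :=
  {T of Metric K T & Pointed T}.

Definition borel {R : realType} (F : pMetricType R) :=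
  g_sigma_algebraType (@open F).

Section SelfSimilarSet.
Context {R : realType} {F : pMetricType R} {M : nat}.
Variable psi : 'I_M -> F -> F.

(* psi_(w1...wn) = psi_w1 \o ... \o psi_wn *)
Definition psiw (w : seq 'I_M) (x : F) : F := foldr psi x w.

Definition cell (w : seq 'I_M) : set F := range (psiw w).

(* Under [pcf_self_similar] the intersection is a singleton. *)
Definition coding (w : nat -> 'I_M) : F := get (\bigcap_n cell (mkseq w n)).

Definition critical_set : set (nat -> 'I_M) :=
  coding @^-1` [set x | exists i j, [/\ i != j, cell [:: i] x & cell [:: j] x]].

Definition post_critical_set : set (nat -> 'I_M) :=
  [set v | exists n w, [/\ (0 < n)%N, critical_set w & v = fun k => w (n + k)%N]].

Definition F0 : set F := coding @` post_critical_set.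

Record pcf_self_similar : Prop := PcfSelfSimilar {
  pcf_card : (2 <= M)%N;
  pcf_compact : compact [set: F];
  pcf_connected : connected [set: F];
  pcf_injective : forall i, injective (psi i);
  pcf_contraction : forall i, exists2 c : R, 0 < c < 1 &
    forall x y, mdist (psi i x) (psi i y) <= c * mdist x y;
  pcf_cover : [set: F] = \bigcup_i range (psi i);
  pcf_finite : finite_set post_critical_set }.

(* A matrix indexed by F0 is represented by a : F -> F -> R, a function on the
   n-th approximating set F^n by a function on F; only the entries, resp. the
   values, on these sets matter. *)
Variables (a : F -> F -> R) (r : 'I_M -> R).

Definition rw (w : seq 'I_M) : R := \prod_(i <- w) r i.

Definition energy0 (f : F -> R) : R :=
  2^-1 * \sum_(x \in F0) \sum_(y \in F0) a x y * (f x - f y) ^+ 2.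

Definition energyn (n : nat) (f : F -> R) : R :=
  \sum_(w : n.-tuple 'I_M) (rw w)^-1 * energy0 (f \o psiw w).

(* No permutation of F0 makes the matrix block triangular. *)
Definition irreducible_on_F0 : Prop :=
  forall S : set F, S `<=` F0 -> S !=set0 -> S != F0 ->
    exists x y, [/\ S x, (F0 `\` S) y & a x y != 0].

Record regular_harmonic_structure : Prop := RegularHarmonicStructure {
  harm_sym : forall x y, F0 x -> F0 y -> a x y = a y x;
  harm_irreducible : irreducible_on_F0;
  harm_ge0 : forall x y, F0 x -> F0 y -> x != y -> 0 <= a x y;
  harm_row : forall x, F0 x -> \sum_(y \in F0) a x y = 0;
  harm_regular : forall i, 0 < r i < 1;
  harm_min_attained : forall f : F -> R, exists2 g : F -> R,
    {in F0, g =1 f} & energyn 1 g = energy0 f;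
  harm_min_le : forall f g : F -> R,
    {in F0, g =1 f} -> energy0 f <= energyn 1 g }.

Definition form_domain : set (F -> R) :=
  [set f | continuous f /\ has_ubound (range (fun n => energyn n f))].

Definition energy_diag (f : F -> R) : R := limn (fun n => energyn n f).

Definition energy (f g : F -> R) : R :=
  4^-1 * (energy_diag (f \+ g) - energy_diag (f \- g)).

Definition resistance (x y : F) : R :=
  if x == y then 0 else
  (inf [set energy f f | f in
     [set f | [/\ form_domain f, f x = 0 & f y = 1]]])^-1.

Definition Rinfty (p q : R * F) : R :=
  Num.max `|p.1 - q.1| (resistance p.2 q.2).

Definition form_domain_bc (b : set F) : set (F -> R) :=
  [set f | form_domain f /\ forall x, (F0 `\` b) x -> f x = 0].

Definition self_similar_measure (dH : R) (mu : probability (borel F) R) : Prop :=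
  forall w : seq 'I_M, mu (cell w) = (rw w `^ dH)%:E.

End SelfSimilarSet.

Definition hausdorff_exponent {R : realType} {M : nat} (r : 'I_M -> R) (dH : R) :=
  \sum_i r i `^ dH = 1.

Definition spectral_dimension {R : realType} (dH : R) : R := 2 * dH / (dH + 1).

(* Elements of L^2(mu) are handled through square-integrable representatives,
   i.e. members of the library's [Lfun mu 2]. *)
Section L2.
Context {d} {T : measurableType d} {R : realType}.
Variable mu : {measure set T -> \bar R}.

Definition L2 : set (T -> R) := [set f | f \in Lfun mu 2%:E].

Definition L2inner (f g : T -> R) : R := \int[mu]_x (f x * g x).

Definition L2dist (f g : T -> R) : \bar R := 'N[mu]_2%:E[EFin \o (f \- g)].

Definition L2_open (O : set (T -> R)) : Prop :=
  forall f, L2 f -> O f -> exists2 e : R, 0 < e &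
    forall g, L2 g -> (L2dist g f < e%:E)%E -> O g.

Definition L2_orthonormal_basis (phi : nat -> T -> R) : Prop :=
  [/\ forall k, L2 (phi k),
      forall k l, L2inner (phi k) (phi l) = (k == l)%:R &
      forall f, L2 f ->
        (fun n => L2dist f (fun x => \sum_(k < n) L2inner f (phi k) * phi k x))
          @ \oo --> 0%E].

(* A Borel measurable map from Omega to the Hilbert space L^2(mu). *)
Definition L2_random_variable {d'} {Omega : measurableType d'}
    (X : Omega -> T -> R) : Prop :=
  (forall w, L2 (X w)) /\ (forall O, L2_open O -> measurable (X @^-1` O)).

End L2.

Section Generator.
Context {R : realType} {F : pMetricType R} {M : nat}.
Variables (psi : 'I_M -> F -> F) (a : F -> F -> R) (r : 'I_M -> R).
Variables (mu : probability (borel F) R) (b : set F).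

(* f is in the domain of Delta_b and Delta_b f = h *)
Definition is_laplacian (f h : F -> R) : Prop :=
  [/\ form_domain_bc psi a r b f, L2 mu h &
      forall g, form_domain_bc psi a r b g ->
        energy psi a r f g = - L2inner mu h g].

Definition laplacian_eigenbasis (lam : nat -> R) (phi : nat -> F -> R) : Prop :=
  [/\ L2_orthonormal_basis mu phi,
      0 <= lam 0%N,
      {homo lam : k l / (k <= l)%N >-> k <= l} &
      forall k, is_laplacian (phi k) (fun x => - (lam k * phi k x))].

End Generator.

Section Noise.
Context {d} {Omega : measurableType d} {R : realType}.
Variable P : probability Omega R.

(* The centred normal law of variance 0 is the Dirac mass at 0. *)
Definition centred_gaussian (X : Omega -> R) : Prop :=
  measurable_fun setT X /\
  exists2 s : R, 0 <= s & forall A : set R, measurable A ->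
    P (X @^-1` A) = if s == 0 then \d_(0 : R) A else normal_prob 0 s A.

(* W t f stands for the pairing of f and W(t), for f in L^2(mu), 0 <= t. *)
Record cylindrical_wiener {d'} {T : measurableType d'}
    (mu : {measure set T -> \bar R}) (W : R -> (T -> R) -> Omega -> R) : Prop :=
  CylindricalWiener {
  wiener_gaussian : forall n (c t : 'I_n -> R) (f : 'I_n -> T -> R),
    (forall i, 0 <= t i) -> (forall i, L2 mu (f i)) ->
    centred_gaussian (fun w => \sum_i c i * W (t i) (f i) w);
  wiener_covariance : forall s t f g,
    0 <= s -> 0 <= t -> L2 mu f -> L2 mu g ->
    ('E_P[(W s f \* W t g)%R] = (Num.min s t * L2inner mu f g)%:E)%E;
  wiener_paths : forall f, L2 mu f ->
    {ae P, forall w, {within [set t : R | 0 <= t], continuous (fun t => W t f w)}} }.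

Definition L2_limit (X : nat -> Omega -> R) (Y : Omega -> R) : Prop :=
  (fun n => 'E_P[(fun w => (Y w - X n w) ^+ 2)%R]%E) @ \oo --> 0%E.

(* (c, u, v) encodes the elementary integrand c * 1_]u, v]. *)
Definition step_integrand (p : seq (R * R * R)) (s : R) : R :=
  \sum_(q <- p) q.1.1 * \1_(`]q.1.2, q.2]) s.

Definition step_integral (B : R -> Omega -> R) (p : seq (R * R * R))
    (w : Omega) : R :=
  \sum_(q <- p) q.1.1 * (B q.2 w - B q.1.2 w).

(* X is the integral of the deterministic function h over [0, t] against the
   Brownian motion B: the L^2(P)-limit of the integrals of step functions that
   converge to h in L^2([0, t]). *)
Definition is_wiener_integral (B : R -> Omega -> R) (h : R -> R) (t : R)
    (X : Omega -> R) : Prop :=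
  measurable_fun setT X /\
  exists p : nat -> seq (R * R * R),
    [/\ forall n q, q \in p n -> 0 <= q.1.2 <= q.2 /\ q.2 <= t,
        (fun n => \int[lebesgue_measure]_(s in `[0%R, t])
           ((h s - step_integrand (p n) s) ^+ 2)%R%:E)%E @ \oo --> 0%E &
        L2_limit (fun n => step_integral B (p n)) X].

End Noise.

(* v'' + 2 beta v' + lam v = 0 on [0, +oo[, v(0) = 0, v'(0) = 1 *)
Definition damped_oscillator {R : realType} (beta lam : R) (v : R -> R) : Prop :=
  exists v' : R -> R,
    [/\ {within [set t : R | 0 <= t], continuous v},
        {within [set t : R | 0 <= t], continuous v'},
        v 0 = 0 /\ v' 0 = 1,
        forall t : R, 0 < t -> is_derive t (1 : R) v (v' t) &
        forall t : R, 0 < t ->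
          is_derive t (1 : R) v' (- (2 * beta * v' t) - lam * v t)].

Section Solution.
Context {d} {Omega : measurableType d} {R : realType} {F : pMetricType R}.
Variables (P : probability Omega R) (mu : probability (borel F) R).
Variables (W : R -> (F -> R) -> Omega -> R).
Variables (lam : nat -> R) (phi : nat -> F -> R) (V : R -> R -> R).

Definition stochastic_convolution (Y : nat -> R -> Omega -> R) : Prop :=
  forall k t, 0 <= t ->
    is_wiener_integral P (fun s => W s (phi k)) (fun s => V (lam k) (t - s)) t
      (Y k t).

Definition partial_sum (Y : nat -> R -> Omega -> R) (t : R) (n : nat)
    (w : Omega) (x : F) : R := \sum_(k < n) Y k t w * phi k x.

Definition random_field_solution (Y : nat -> R -> Omega -> R)
    (u : R -> F -> Omega -> R) : Prop :=
  forall t x, 0 <= t ->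
    measurable_fun setT (u t x) /\
    L2_limit P (fun n w => partial_sum Y t n w x) (u t x).

(* The series of Y_k(t) phi_k converges to U t in L^2(Omega; L^2(mu)). *)
Definition L2_valued_solution (Y : nat -> R -> Omega -> R)
    (U : R -> Omega -> F -> R) : Prop :=
  forall t, 0 <= t ->
    L2_random_variable mu (U t) /\
    (fun n => \int[P]_w
       (L2dist mu (U t w) (partial_sum Y t n w) `^ 2))%E @ \oo --> 0%E.

Definition random_field_version (u ut : R -> F -> Omega -> R) : Prop :=
  forall t x, 0 <= t ->
    measurable_fun setT (ut t x) /\ {ae P, forall w, ut t x w = u t x w}.

Definition L2_valued_process (X : R -> Omega -> F -> R) : Prop :=
  forall t, 0 <= t -> L2_random_variable mu (X t).

Definition L2_continuous_paths (X : R -> Omega -> F -> R) : Prop :=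
  {ae P, forall w, forall t, 0 <= t -> forall e : R, 0 < e ->
     exists2 h : R, 0 < h & forall s, 0 <= s -> `|s - t| < h ->
       (L2dist mu (X s w) (X t w) < e%:E)%E}.

Definition L2_valued_version (U X : R -> Omega -> F -> R) : Prop :=
  forall t, 0 <= t -> {ae P, forall w, {ae mu, forall x, X t w x = U t w x}}.

End Solution.

Definition ess_holder {R : realType} {T1 T2 : Type} (A : set T1)
    (d1 : T1 -> T1 -> R) (d2 : T2 -> T2 -> R) (delta : R) (f : T1 -> T2) : Prop :=
  forall gamma, 0 < gamma < delta ->
    exists2 C : R, 0 < C &
      forall x y, A x -> A y -> d2 (f x) (f y) <= C * d1 x y `^ gamma.

Definition eucl {R : realType} (x y : R) : R := `|x - y|.

(* Main.v *)
(* The increments of u are L^2-limits of Gaussian combinations of Wiener increments, so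
   their tails are controlled by bounds on their variances.  The squared oscillator kernels
   are O(1 / (A + lam_k)), so by Bessel's inequality these variances are controlled by the
   norms of point evaluations for the form E + A <., .>: the definition of the
   resistance metric gives E[(u(t,x) - u(t,y))^2] = O(R(x,y)), and comparing f(x) with the
   mean of f over a cell of resistance diameter h^(2 delta) gives
   E[(u(t,x) - u(s,x))^2] = O(|t - s|^(2 delta)).
   A chaining argument along nets of cells and dyadic times, whose cardinality grows
   geometrically, shows that almost surely the values of u on the nets extend to a Hoelder
   continuous field.  This limit is jointly measurable in (omega, x), hence a process with
   values in L^2(mu), and it agrees with the L^2-valued solution because both are limits in
   measure of the partial sums of the eigenfunction expansion. *)
Require Import Defs.
From HB Require Import structures.
From mathcomp Require Import all_boot all_order all_algebra.
From mathcomp Require Import all_classical all_reals all_analysis.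
From mathcomp Require Import measurable_realfun ring lra zify.

Set Implicit Arguments.
Unset Strict Implicit.
Unset Printing Implicit Defensive.

Import Order.TTheory GRing.Theory Num.Theory.
Import numFieldNormedType.Exports.

Local Open Scope classical_set_scope.
Local Open Scope ring_scope.

(** * Tail bounds and convergence in probability *)

Lemma sqr_le_of_lt_norm (R : realDomainType) (l x : R) : 0 <= l -> l < `|x| -> l ^+ 2 <= x ^+ 2.
Proof.
move=> l0 lx; rewrite -[X in _ <= X]real_normK ?num_real// lerXn2r ?nnegrE//.
exact: ltW.
Qed.

Lemma measurable_gt_norm (R0 : realType) d0 (T : measurableType d0) (X : T ->
  R0) (l : R0) : measurable_fun setT X ->
  measurable [set w | l < `|X w|].
Proof.
move=> mX; have := @measurable_fun_ltr _ _ R0 setT (cst l) (fun w => `|X w|).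
move=> /(_ (measurable_cst _)) H.
have := H (measurableT_comp (@normr_measurable R0 setT) mX) measurableT [set true] I.
by rewrite setTI; congr measurable; apply/seteqP; split => x /=.
Qed.

Section ProbabilityTails.
Context {d} {Omega : measurableType d} {R : realType}.
Variable P : probability Omega R.
Implicit Types (X Y : Omega -> R).

Lemma second_moment_tail X (l : R) : measurable_fun setT X -> 0 < l ->
  ((l ^+ 2)%:E * P [set w | (l < `|X w|)%R] <= 'E_P[(fun w => X w ^+ 2)%R])%E.
Proof.
move=> mX l0; have mA := measurable_gt_norm l mX; rewrite unlock.
have -> : ((l ^+ 2)%:E * P [set w | (l < `|X w|)%R] =
  \int[P]_w (l ^+ 2 * \1_[set w | (l < `|X w|)%R] w)%:E)%E.
  under eq_integral do rewrite EFinM.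
  rewrite ge0_integralZl_EFin ?sqr_ge0//; last first.
    exact/measurable_EFinP/measurable_indic.
  by rewrite integral_indic// setIT.
apply: ge0_le_integral => //.
- by move=> w _; rewrite lee_fin mulr_ge0 ?sqr_ge0.
- by apply/measurable_EFinP/measurable_funM => //; exact: measurable_indic.
- by apply/measurable_EFinP/measurable_funX.
- move=> w _; rewrite lee_fin indicE; case: (boolP (w \in _)) => [|_].
    by rewrite inE /= mulr1 => h; rewrite sqr_le_of_lt_norm// ltW.
  by rewrite mulr0 sqr_ge0.
Qed.

Lemma second_moment_tail_le X (l v : R) : measurable_fun setT X -> 0 < l ->
  ('E_P[(fun w => X w ^+ 2)%R] <= v%:E)%E ->
  (P [set w | (l < `|X w|)%R] <= (v / l ^+ 2)%:E)%E.
Proof.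
move=> mX l0 Xv; rewrite EFinM muleC lee_pdivlMl ?exprn_gt0//.
exact: le_trans (second_moment_tail mX l0) Xv.
Qed.

Lemma borel_cantelli_geometric (E : nat -> set Omega) (C q : R) :
  (forall n, measurable (E n)) -> 0 <= q < 1 ->
  (forall n, (P (E n) <= (C * q ^+ n)%:E)%E) ->
  {ae P, forall w, exists N, forall n, (N <= n)%N -> ~ E n w}.
Proof.
move=> mE /andP[q0 q1] PE.
have C0 : 0 <= C.
  by have := le_trans (measure_ge0 P _) (PE 0%N); rewrite expr0 mulr1 lee_fin.
have lim0 : P (lim_sup_set E) = 0.
  apply: lim_sup_set_cvg0 => //.
  apply: (@le_lt_trans _ _ (C / (1 - q))%:E); last exact: ltry.
  apply: lime_le; first exact: is_cvg_nneseries.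
  apply: nearW => n.
  apply: (@le_trans _ _ (\sum_(0 <= i < n) (C * q ^+ i)%:E)%E).
    by apply: lee_sum => i _; exact: PE.
  rewrite sumEFin lee_fin -mulr_sumr.
  have q1' : q != 1 by rewrite lt_eqF.
  have /(congr1 (fun f => f n)) := geometric_seriesE (1 : R) q1'.
  rewrite /series /geometric /=; under eq_bigr do rewrite mul1r.
  rewrite mul1r => ->; rewrite ler_wpM2l// ler_pdivrMr ?subr_gt0// mulVf ?gt_eqF ?subr_gt0//.
  by rewrite gerBl exprn_ge0.
exists (lim_sup_set E); split => //.
  by apply: bigcapT_measurable => n; exact: bigcup_measurable.
move=> w /= hw n _ /=; apply: contrapT => hn; apply: hw; exists n => m nm Em.
by apply: hn; exists m.
Qed.

End ProbabilityTails.

Section GaussianTail.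
Context {R : realType}.

Lemma exprn_le_fact_expR (n : nat) (x : R) : 0 <= x -> x ^+ n <= n`!%:R * expR x.
Proof.
move=> x0; case: n => [|n]; first by rewrite expr0 fact0 mul1r (le_trans _ (expR_ge1Dx _)) ?lerDl.
rewrite -ler_pdivrMl ?ltr0n ?fact_gt0// mulrC.
by apply: le_trans (expR_ge1Dxn n x0); rewrite lerDr.
Qed.

Lemma normal_peak_double (s : R) : 0 < s -> normal_peak (2 * s) = normal_peak s / 2.
Proof.
move=> s0; rewrite /normal_peak exprMn -mulrA -mulrnAr sqrtrM ?sqr_ge0// sqrtr_sqr.
by rewrite ger0_norm// invfM mulrC.
Qed.

Definition gauss_const (m : nat) : R := m`!%:R * 4 ^+ m * 2.

Lemma normal_pdf_tail (m : nat) (s l x : R) : 0 < s -> 0 < l -> l < `|x| ->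
  normal_pdf 0 s x <= gauss_const m * (s ^+ 2 / l ^+ 2) ^+ m * normal_pdf 0 (2 * s) x.
Proof.
move=> s0 l0 lx; rewrite !normal_pdfE ?gt_eqF ?mulr_gt0// normal_peak_double//.
set p := normal_peak s; have p0 : 0 < p by rewrite normal_peak_gt0// gt_eqF.
rewrite /normal_fun !subr0.
set y := x ^+ 2 / (4 * s ^+ 2).
have x0 : 0 < x ^+ 2 by rewrite exprn_even_gt0//= -normr_gt0 (lt_trans l0).
have y0 : 0 < y by rewrite /y divr_gt0// mulr_gt0// exprn_gt0.
have -> : - x ^+ 2 / (s ^+ 2 *+ 2) = - y + - y.
  by rewrite /y; field; rewrite gt_eqF.
rewrite expRD.
have h1 : expR (- y) <= expR (- x ^+ 2 / ((2 * s) ^+ 2 *+ 2)).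
  rewrite ler_expR mulNr lerN2 /y ler_pM2l//.
  rewrite lef_pV2 ?posrE ?mulrn_wgt0 ?mulr_gt0 ?exprn_gt0 ?mulr_gt0//.
  by have := exprn_gt0 2 s0; nra.
have h2 : expR (- y) <= m`!%:R * 4 ^+ m * (s ^+ 2 / l ^+ 2) ^+ m.
  rewrite expRN -mulrA -exprMn.
  have := exprn_le_fact_expR m (ltW y0); set F := m`!%:R => hF.
  have hz : 4 * (s ^+ 2 / l ^+ 2) >= y^-1.
    rewrite /y invf_div mulrA ler_pM2l ?mulr_gt0 ?exprn_gt0// lef_pV2 ?posrE ?(exprn_gt0 _ l0)//.
    by rewrite sqr_le_of_lt_norm// ltW.
  apply: (@le_trans _ _ (F * y^-1 ^+ m)).
    rewrite exprVn ler_pdivlMr ?exprn_gt0// mulrC ler_pdivrMr ?expR_gt0//.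
  by rewrite ler_wpM2l ?ler0n// lerXn2r ?nnegrE ?invr_ge0 ?(ltW y0) ?(le_trans _ hz) ?invr_ge0
    ?(ltW y0).
rewrite /gauss_const.
set e := expR (- y) in h1 h2 *; set e' := expR _ in h1 *.
have e0 : 0 < e by exact: expR_gt0.
set c := _ * _ ^+ m in h2 *.
have -> : m`!%:R * 4 ^+ m * 2 * (s ^+ 2 / l ^+ 2) ^+ m * (p / 2 * e') = p * (c * e').
  by rewrite /c; field.
by rewrite ler_pM2l// ler_pM// ltW.
Qed.

Lemma normal_prob_tail (m : nat) (s l : R) : 0 < s -> 0 < l ->
  (normal_prob 0 s [set x | (l < `|x|)%R] <= (gauss_const m * (s ^+ 2 / l ^+ 2) ^+ m)%:E)%E.
Proof.
move=> s0 l0; rewrite /normal_prob.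
set k := gauss_const m * _.
have k0 : 0 <= k.
  by rewrite /k mulr_ge0 ?exprn_ge0 ?divr_ge0 ?sqr_ge0 ?mulr_ge0 ?ler0n ?exprn_ge0.
have mA : measurable [set x : R | (l < `|x|)%R] by apply: (@measurable_gt_norm R _ _ (fun x : R
  => x)); exact: measurable_id.
apply: (@le_trans _ _ (\int[lebesgue_measure]_(x in [set x | (l < `|x|)%R]) (k%:E * (normal_pdf
  0 (2 * s) x)%:E))%E).
  apply: ge0_le_integral => //=.
  - by move=> x _; rewrite lee_fin normal_pdf_ge0.
  - apply/measurable_EFinP; apply: measurable_funTS; exact: measurable_normal_pdf.
  - apply: emeasurable_funM => //; apply/measurable_EFinP; apply: measurable_funTS;
    exact: measurable_normal_pdf.
  - by move=> x lx; rewrite -EFinM lee_fin normal_pdf_tail.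
rewrite ge0_integralZl_EFin//; last 2 first.
- by move=> x _; rewrite lee_fin normal_pdf_ge0.
- apply/measurable_EFinP; apply: measurable_funTS; exact: measurable_normal_pdf.
rewrite -[X in (_ <= X)%E]mule1 lee_wpmul2l// -(integral_normal_pdf 0 (2 * s)).
apply: ge0_subset_integral => //.
- apply/measurable_EFinP; exact: measurable_normal_pdf.
- by move=> x _; rewrite lee_fin normal_pdf_ge0.
Qed.

Lemma normal_prob_small (s : R) : 0 < s ->
  (normal_prob 0 s [set` `[(- (s / 2))%R, (s / 2)%R]] <= (2^-1)%:E)%E.
Proof.
move=> s0; rewrite /normal_prob.
apply: (@le_trans _ _ (\int[lebesgue_measure]_(x in [set` `[(- (s / 2))%R,
  (s / 2)%R]]) (normal_peak s)%:E)%E).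
  apply: ge0_le_integral => //=.
  - by move=> x _; rewrite lee_fin normal_pdf_ge0.
  - apply/measurable_EFinP; apply: measurable_funTS; exact: measurable_normal_pdf.
  - by move=> x lx; rewrite lee_fin normal_pdf_ub// gt_eqF.
rewrite integral_cst//= lebesgue_measure_itv/= lte_fin.
have -> : - (s / 2) < s / 2 by lra.
rewrite -EFinB -EFinM lee_fin opprK -splitr /normal_peak -mulrnAr sqrtrM ?sqr_ge0//.
rewrite sqrtr_sqr (ger0_norm (ltW s0)) invfM mulrAC mulVf ?gt_eqF// mul1r.
have pi2 : 0 < pi *+ 2 :> R by rewrite mulrn_wgt0// pi_gt0.
rewrite lef_pV2 ?posrE ?sqrtr_gt0//.
rewrite -(@ler_pXn2r _ 2) ?nnegrE ?sqrtr_ge0// sqr_sqrtr ?(ltW pi2)//.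
by have := pi_ge2 R; lra.
Qed.

End GaussianTail.

Section CentredGaussian.
Context {d} {Omega : measurableType d} {R : realType}.
Variable P : probability Omega R.

Lemma gauss_const_ge0 m : 0 <= gauss_const m :> R.
Proof. by rewrite /gauss_const !mulr_ge0 ?ler0n ?exprn_ge0. Qed.

Lemma centred_gaussian_tail (X : Omega -> R) (m : nat) (v l : R) :
  centred_gaussian P X -> 0 < l -> ('E_P[(fun w => X w ^+ 2)%R] <= v%:E)%E ->
  (P [set w | (l < `|X w|)%R] <= (gauss_const m * (8 * v / l ^+ 2) ^+ m)%:E)%E.
Proof.
move=> [mX [s s0 Xs]] l0 Xv.
have v0 : 0 <= v.
  rewrite -lee_fin; apply: le_trans Xv; rewrite unlock integral_ge0// => w _.
  by rewrite lee_fin sqr_ge0.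
have mA k : measurable [set x : R | (k < `|x|)%R].
  by apply: (@measurable_gt_norm R _ _ (fun x : R => x)); exact: measurable_id.
have := Xs _ (mA l); rewrite /preimage/= => ->.
have [_|sn0] := eqVneq s 0.
  have -> : \d_(0 : R) [set x : R | l < `|x|] = 0%E :> \bar R.
    by rewrite diracE memNset//= normr0 ltNge (ltW l0).
  rewrite lee_fin.
  by rewrite mulr_ge0 ?gauss_const_ge0// exprn_ge0// divr_ge0 ?sqr_ge0// mulr_ge0.
have {s0}sn0' : 0 < s by rewrite lt_def sn0.
apply: le_trans (normal_prob_tail m sn0' l0) _.
rewrite lee_fin ler_wpM2l ?gauss_const_ge0// lerXn2r ?nnegrE//;
  do ?[by rewrite divr_ge0 ?sqr_ge0// mulr_ge0].
rewrite ler_pM2r ?invr_gt0 ?exprn_gt0//.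
have s2 : 0 < s / 2 by rewrite divr_gt0.
have := second_moment_tail_le mX s2 Xv.
have := Xs _ (mA (s / 2)); rewrite /preimage/= (negbTE sn0) => ->.
have -> : [set x : R | s / 2 < `|x|] = ~` [set` `[(- (s / 2))%R, (s / 2)%R]].
  apply/seteqP; split => x /=; rewrite in_itv/= ltNge ler_norml.
    by move/negP.
  by move=> /negP.
have mI : measurable [set` `[(- (s / 2))%R, (s / 2)%R]] by [].
have e1 : (normal_prob 0 s (~` [set` `[(- (s / 2))%R, (s / 2)%R]]) =
  1 - normal_prob 0 s [set` `[(- (s / 2))%R,
    (s / 2)%R]])%E := probability_setC (normal_prob 0 s) mI.
have pf : normal_prob 0 s [set` `[(- (s / 2))%R, (s / 2)%R]] \is a fin_num.
  exact: (fin_num_measure (normal_prob 0 s)).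
rewrite e1; have := normal_prob_small sn0'.
rewrite -(fineK pf) -EFinB !lee_fin => hq h.
have : 2^-1 <= v / (s / 2) ^+ 2 by lra.
by rewrite ler_pdivlMr ?exprn_gt0//; lra.
Qed.

End CentredGaussian.

Section ConvergenceInProbability.
Context {d} {Omega : measurableType d} {R : realType}.
Variable P : probability Omega R.

Definition cvg_in_prob (X : nat -> Omega -> R) (Y : Omega -> R) : Prop :=
  [/\ forall n, measurable_fun setT (X n), measurable_fun setT Y &
  forall e h : R, 0 < e -> 0 < h -> exists N, forall n, (N <= n)%N ->
    (P [set w | (e < `|Y w - X n w|)%R] <= h%:E)%E].

Lemma cvge0_near_le (f : nat -> \bar R) (h : R) : f @ \oo --> 0%E -> 0 < h ->
  exists N, forall n, (N <= n)%N -> (f n <= h%:E)%E.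
Proof.
move=> f0 h0; have := f0 _ (open_nbhs_nbhs (conj (@open_ereal_lt_ereal R h%:E) _)).
rewrite /= lte_fin => /(_ h0) [N _ HN]; exists N => n Nn; apply: ltW.
exact: HN.
Qed.

Lemma L2_limit_in_prob X Y : (forall n, measurable_fun setT (X n)) ->
  measurable_fun setT Y -> L2_limit P X Y -> cvg_in_prob X Y.
Proof.
move=> mX mY XY; split=> // e h e0 h0.
have h1 : 0 < h * e ^+ 2 by rewrite mulr_gt0// exprn_gt0.
have [N HN] := cvge0_near_le XY h1; exists N => n Nn.
have mYX : measurable_fun setT (fun w => Y w - X n w) by exact: measurable_funB.
have := second_moment_tail_le mYX e0 (HN n Nn).
by rewrite mulfK// gt_eqF// exprn_gt0.
Qed.

Lemma prob_norm_sum_gt (X Y : Omega -> R) (e1 e2 : R) :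
  measurable_fun setT X -> measurable_fun setT Y ->
  (P [set w | (e1 + e2 < `|X w + Y w|)%R] <=
   P [set w | (e1 < `|X w|)%R] + P [set w | (e2 < `|Y w|)%R])%E.
Proof.
move=> mX mY.
have m1 := measurable_gt_norm e1 mX; have m2 := measurable_gt_norm e2 mY.
have m3 := measurable_gt_norm (e1 + e2) (measurable_funD mX mY).
apply: le_trans (measureU2 _ m1 m2).
apply: le_measure; rewrite ?inE//; first exact: measurableU.
move=> w /= h; case: (ltP e1 `|X w|) => h1; [by left|right].
by rewrite ltNge; apply/negP => h2; move: h; rewrite ltNge (le_trans (ler_normD _ _))// lerD.
Qed.

Lemma cvg_in_probD X X' Y Y' : cvg_in_prob X Y -> cvg_in_prob X' Y' ->
  cvg_in_prob (fun n w => X n w + X' n w) (fun w => Y w + Y' w).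
Proof.
move=> [mX mY XY] [mX' mY' XY']; split.
- by move=> n; exact: measurable_funD.
- exact: measurable_funD.
- move=> e h e0 h0; have e2 : 0 < e / 2 by rewrite divr_gt0.
  have h2 : 0 < h / 2 by rewrite divr_gt0.
  have [N HN] := XY _ _ e2 h2; have [N' HN'] := XY' _ _ e2 h2.
  exists (maxn N N') => n; rewrite geq_max => /andP[Nn N'n].
  rewrite [h in leRHS]splitr EFinD; apply: le_trans (leeD (HN n Nn) (HN' n N'n)).
  under eq_set do rewrite opprD addrACA [e in X in is_true X]splitr.
  by apply: prob_norm_sum_gt; exact: measurable_funB.
Qed.

Lemma cvg_in_probZ (c : R) X Y : cvg_in_prob X Y ->
  cvg_in_prob (fun n w => c * X n w) (fun w => c * Y w).
Proof.
move=> [mX mY XY]; split.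
- by move=> n; exact: measurable_funM.
- exact: measurable_funM.
- move=> e h e0 h0; have c1 : 0 < `|c| + 1 by rewrite ltr_wpDl.
  have [N HN] := XY _ _ (divr_gt0 e0 c1) h0; exists N => n Nn.
  apply: le_trans (HN n Nn).
  have mYX : measurable_fun setT (fun w => Y w - X n w) by exact: measurable_funB.
  have mcYX : measurable_fun setT (fun w => c * Y w - c * X n w).
    by apply: measurable_funB; exact: measurable_funM.
  apply: le_measure; rewrite ?inE; try exact: measurable_gt_norm.
  move=> w /=; rewrite -mulrBr normrM ltr_pdivrMr// => h1; apply: lt_le_trans h1 _.
  by rewrite mulrC ler_wpM2l// lerDl.
Qed.

Lemma cvg_in_prob_cst0 : cvg_in_prob (fun _ _ => 0) (fun _ => 0).
Proof.
split => // e h e0 h0; exists 0%N => n _.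
under eq_set do rewrite subrr normr0 ltNge (ltW e0)/=.
by rewrite set_false measure0 lee_fin ltW.
Qed.

Lemma cvg_in_prob_sum (I : Type) (s : seq I) (X : I -> nat -> Omega -> R) Y :
  (forall i, cvg_in_prob (X i) (Y i)) ->
  cvg_in_prob (fun n w => \sum_(i <- s) X i n w) (fun w => \sum_(i <- s) Y i w).
Proof.
move=> XY; elim: s => [|i s IH].
  under eq_fun do under eq_fun do rewrite big_nil.
  under [X in cvg_in_prob _ X]eq_fun do rewrite big_nil.
  exact: cvg_in_prob_cst0.
under eq_fun do under eq_fun do rewrite big_cons.
under [X in cvg_in_prob _ X]eq_fun do rewrite big_cons.
exact: cvg_in_probD.
Qed.

Lemma tail_cvg_in_prob X Y (l p : R) : cvg_in_prob X Y -> 0 < l ->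
  (forall e, 0 < e -> exists N, forall n, (N <= n)%N ->
     (P [set w | (l < `|X n w|)%R] <= (p + e)%:E)%E) ->
  (P [set w | (2 * l < `|Y w|)%R] <= p%:E)%E.
Proof.
move=> [mX mY XY] l0 tX; apply/lee_addgt0Pr => e e0.
have e2 : 0 < e / 2 by rewrite divr_gt0.
have [N HN] := XY _ _ l0 e2; have [N' HN'] := tX _ e2.
set n := maxn N N'.
have := leeD (HN' n (leq_maxr _ _)) (HN n (leq_maxl _ _)).
rewrite -!EFinD -addrA -splitr; apply: le_trans.
have mYX : measurable_fun setT (fun w => Y w - X n w) by exact: measurable_funB.
have := prob_norm_sum_gt l l (mX n) mYX; rewrite -mulr2n mulr_natl.
by under eq_set do rewrite addrC subrK.
Qed.

End ConvergenceInProbability.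

(** * Chaining *)

Lemma dyadic_scale (R : realType) (n0 : nat) (t : R) : 0 < t -> t <= 2^-1 ^+ n0 ->
  exists n, [/\ (n0 <= n)%N, 2^-1 ^+ n.+1 < t & t <= 2^-1 ^+ n].
Proof.
move=> t0 tn0.
have ex : exists n, 2^-1 ^+ n.+1 < t.
  have h1 : `|2^-1 : R| < 1 by rewrite ger0_norm ?invr_ge0// invf_lt1// ltr1n.
  have /cvgrPdist_lt /(_ t t0) [m _ Hm] := cvg_expr h1.
  exists m; have := Hm m.+1 (leqnSn m).
  by rewrite sub0r normrN ger0_norm// exprn_ge0// invr_ge0.
case: (ex_minnP ex) => n nt nmin; exists n; split => //.
  rewrite -ltnS ltnNge; apply/negP => h.
  have := lt_le_trans nt tn0; rewrite ltNge; move/negP; apply.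
  by apply: ler_wiXn2l => //; rewrite ?invr_ge0// invf_le1// ler1n.
case: n nt nmin => [|n] nt nmin.
  apply: le_trans tn0 _; by rewrite expr0 exprn_ile1//; lra.
by rewrite leNgt; apply/negP => /nmin; rewrite ltnn.
Qed.

Lemma half_powR_lt1 (R : realType) (g : R) : 0 < g -> 0 < 2^-1 `^ g < 1.
Proof.
move=> g0; rewrite powR_gt0 ?invr_gt0//=.
rewrite lt_neqAle powR_eq1; apply/andP; split.
  rewrite (gt_eqF g0) orbF negb_or -leNgt invr_ge0 ler0n andbT invr_eq1.
  by apply/eqP; lra.
rewrite -[leRHS](powRr0 2^-1); apply: ger_powR; last exact: ltW.
by apply/andP; split; lra.
Qed.

Lemma half_powRX (R : realType) (g : R) n : (2^-1 ^+ n) `^ g = (2^-1 `^ g) ^+ n :> R.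
Proof. by rewrite -powR_mulrn ?invr_ge0// powRAC powR_mulrn ?powR_ge0. Qed.

Section ChainingDeterministic.
Context {R : realType} {S : Type}.
Variables (D : set S) (dist : S -> S -> R) (N : nat -> nat) (net : nat -> nat -> S).
Variable proj : nat -> S -> S.

Record nets : Prop := Nets {
  nets_ge0 : forall p q, 0 <= dist p q;
  nets_sym : forall p q, dist p q = dist q p;
  nets_quasi : forall p q t, dist p t <= 2 * (dist p q + dist q t);
  nets_in : forall n i, (i < N n)%N -> D (net n i);
  nets_proj : forall n p, D p -> exists2 i, (i < N n)%N & proj n p = net n i;
  nets_close : forall n p, D p -> dist p (proj n p) <= 2^-1 ^+ n }.

Hypothesis hnets : nets.

(* Indices below [N n] run through the net of level n, the others through that of level n.+1. *)
Definition net2 (n i : nat) : S :=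
  if (i < N n)%N then net n i else net n.+1 (i - N n)%N.

Definition close_bound (x : S -> R) (n : nat) (e : R) : Prop :=
  forall i j, (i < N n + N n.+1)%N -> (j < N n + N n.+1)%N ->
    dist (net2 n i) (net2 n j) <= 10 * 2^-1 ^+ n ->
    `|x (net2 n i) - x (net2 n j)| <= e.

Lemma net2_in n i : (i < N n + N n.+1)%N -> D (net2 n i).
Proof.
move=> h; rewrite /net2; case: ltnP => h'; first exact: nets_in.
by apply: nets_in => //; rewrite ltn_subLR.
Qed.

Lemma proj_net2 n p : D p -> exists2 i, (i < N n + N n.+1)%N & proj n p = net2 n i.
Proof.
move=> Dp; have [i iN ->] := nets_proj hnets n Dp; exists i; first by rewrite ltn_addr.
by rewrite /net2 iN.
Qed.

Lemma projS_net2 n p : D p -> exists2 i, (i < N n + N n.+1)%N & proj n.+1 p = net2 n i.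
Proof.
move=> Dp; have [i iN ->] := nets_proj hnets n.+1 Dp; exists (N n + i)%N;
  first by rewrite ltn_add2l.
by rewrite /net2 ltnNge leq_addr/= addKn.
Qed.

Variables (x : S -> R) (rho : R) (n0 : nat).
Hypothesis rho01 : 0 < rho < 1.
Hypothesis hx : forall n, (n0 <= n)%N -> close_bound x n (rho ^+ n).

Let a p n := x (proj n p).

Lemma chain_step p n : D p -> (n0 <= n)%N -> `|a p n - a p n.+1| <= rho ^+ n.
Proof.
move=> Dp nn0; have [i iN ei] := proj_net2 n Dp; have [j jN ej] := projS_net2 n Dp.
rewrite /a ei ej; apply: hx => //; rewrite -ei -ej.
apply: le_trans (nets_quasi hnets _ p _) _.
rewrite (nets_sym hnets (proj n p)).
have := nets_close hnets n Dp; have := nets_close hnets n.+1 Dp.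
have : 0 <= 2^-1 ^+ n :> R by rewrite exprn_ge0// invr_ge0.
by rewrite exprS; lra.
Qed.

Lemma chain_le p n m : D p -> (n0 <= n)%N -> (n <= m)%N ->
  `|a p n - a p m| <= rho ^+ n / (1 - rho) .
Proof.
have [r0 r1] := andP rho01; have r1' : 0 < 1 - rho by rewrite subr_gt0.
move=> Dp nn0 nm; rewrite -(subnKC nm).
suff : `|a p n - a p (n + (m - n))%N| <= rho ^+ n * ((1 - rho ^+ (m - n)) / (1 - rho)).
  move/le_trans; apply; rewrite ler_pM2l ?exprn_gt0// -[leRHS]mul1r ler_pM2r ?invr_gt0//.
  by rewrite gerBl exprn_ge0// ltW.
elim: (m - n)%N => [|k IH]; first by rewrite addn0 subrr normr0 expr0 subrr mul0r mulr0.
rewrite -(subrKA (a p (n + k)%N)) (le_trans (ler_normD _ _))//.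
have nk : (n0 <= n + k)%N by rewrite (leq_trans nn0)// leq_addr.
have := lerD IH (chain_step Dp nk); rewrite addnS => /le_trans; apply.
rewrite [rho ^+ (n + k)]exprD -mulrDr ler_pM2l ?exprn_gt0// -{2}[rho ^+ k](mulfK (lt0r_neq0
  r1')) -mulrDl ler_pM2r ?invr_gt0//.
by rewrite exprS; lra.
Qed.

Lemma chain_cvg p : D p -> cvgn (a p).
Proof.
have [r0 r1] := andP rho01; have r1' : 0 < 1 - rho by rewrite subr_gt0.
move=> Dp; apply: cauchy_cvg; apply: cauchy_exP => e e0.
have h1 : `|rho| < 1 by rewrite ger0_norm// ltW.
have e1 : 0 < e * (1 - rho) by rewrite mulr_gt0.
have /cvgrPdist_lt /(_ _ e1) [m _ Hm] := cvg_expr h1.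
pose n := maxn n0 m; exists (a p n); exists n => // k /= nk.
rewrite /ball/=; apply: le_lt_trans (chain_le Dp (leq_maxl _ _) nk) _.
rewrite ltr_pdivrMr//; have := Hm n (leq_maxr _ _).
by rewrite sub0r normrN ger0_norm// exprn_ge0// ltW.
Qed.

Definition chain_lim (x0 : S -> R) (p : S) : R := limn (fun n => x0 (proj n p)).

Lemma chain_lim_le p n : D p -> (n0 <= n)%N ->
  `|a p n - chain_lim x p| <= rho ^+ n / (1 - rho).
Proof.
move=> Dp nn0; have c := chain_cvg Dp.
have c1 : (fun m => `|a p n - a p m|) @ \oo --> `|a p n - chain_lim x p|.
  by apply: cvg_norm; apply: cvgB; [exact: cvg_cst|exact: c].
rewrite -(cvg_lim _ c1)//; apply: limr_le; first by apply/cvg_ex; eexists; exact: c1.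
by exists n => // m /= nm; exact: chain_le.
Qed.

Lemma chain_lim_scale p q n : D p -> D q -> (n0 <= n)%N -> dist p q <= 2^-1 ^+ n ->
  `|chain_lim x p - chain_lim x q| <= (1 + 2 / (1 - rho)) * rho ^+ n.
Proof.
move=> Dp Dq nn0 pq.
have hp := chain_lim_le Dp nn0; have hq := chain_lim_le Dq nn0.
have hpq : `|a p n - a q n| <= rho ^+ n.
  have [i iN ei] := proj_net2 n Dp; have [j jN ej] := proj_net2 n Dq.
  rewrite /a ei ej; apply: hx => //; rewrite -ei -ej.
  apply: le_trans (nets_quasi hnets _ p _) _.
  have := nets_quasi hnets p q (proj n q).
  rewrite (nets_sym hnets (proj n p)).
  by have := nets_close hnets n Dp; have := nets_close hnets n Dq; lra.
have -> : chain_lim x p - chain_lim x q =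
   (a p n - a q n) - (a p n - chain_lim x p) + (a q n - chain_lim x q) by ring.
rewrite (le_trans (ler_normD _ _))// (le_trans (lerD (ler_normB _ _) (lexx _)))//.
by rewrite mulrDl mul1r mulrAC; lra.
Qed.

End ChainingDeterministic.

Section ChainingHolder.
Context {R : realType} {S : Type}.
Variables (D : set S) (dist : S -> S -> R) (N : nat -> nat) (net : nat -> nat -> S).
Variable proj : nat -> S -> S.
Hypothesis hnets : nets D dist N net proj.

Lemma chain_holder (x : S -> R) (g : R) (n0 : nat) : 0 < g ->
  (forall n, (n0 <= n)%N -> close_bound dist N net x n ((2^-1 `^ g) ^+ n)) ->
  exists2 C : R, 0 < C & forall p q, D p -> D q ->
    `|chain_lim proj x p - chain_lim proj x q| <= C * dist p q `^ g.
Proof.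
move=> g0 hx; have rho01 := half_powR_lt1 g0; set rho := 2^-1 `^ g in hx rho01 *.
have [r0 r1] := andP rho01; have r1' : 0 < 1 - rho by rewrite subr_gt0.
pose B := 1 + 2 / (1 - rho).
have B0 : 0 < B by rewrite ltr_pwDl// divr_ge0// ltW.
pose Mx := \sum_(i < N n0) \sum_(j < N n0) `|x (net n0 i) - x (net n0 j)|.
have Mx0 : 0 <= Mx by apply: sumr_ge0 => i _; apply: sumr_ge0.
pose C2 := (2 * (rho ^+ n0 / (1 - rho)) + Mx) / rho ^+ n0.
have C20 : 0 <= C2.
  rewrite divr_ge0 ?exprn_ge0 ?(ltW r0)// addr_ge0// mulr_ge0// divr_ge0// ?exprn_ge0// ltW//.
exists (B / rho + C2); first by rewrite ltr_pwDl// divr_gt0.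
move=> p q Dp Dq.
have [small|big] := leP (dist p q) (2^-1 ^+ n0).
  have [d0|dn0] := eqVneq (dist p q) 0.
    rewrite d0 powR0 ?gt_eqF// mulr0.
    have c1 : (fun n => B * rho ^+ n) @ \oo --> (0 : R).
      rewrite -(mulr0 B); apply: cvgM; first exact: cvg_cst.
      by apply: cvg_expr; rewrite ger0_norm// ltW.
    rewrite -(cvg_lim _ c1)//; apply: limr_ge; first by apply/cvg_ex; exists 0.
    exists n0 => // n /= nn0; apply: (chain_lim_scale hnets rho01 hx) => //.
    by rewrite d0 exprn_ge0// invr_ge0.
  have dpos : 0 < dist p q by rewrite lt_def dn0 (nets_ge0 hnets).
  have [n [nn0 n1 n2]] := dyadic_scale dpos small.
  apply: (le_trans (chain_lim_scale hnets rho01 hx Dp Dq nn0 n2)).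
  have h : rho ^+ n.+1 <= dist p q `^ g.
    by rewrite -half_powRX; apply: ge0_ler_powR;
      rewrite ?nnegrE ?(ltW g0) ?(ltW dpos) ?(ltW n1)// exprn_ge0// invr_ge0.
  apply: (@le_trans _ _ (B / rho * dist p q `^ g)); last first.
    by rewrite ler_wpM2r ?powR_ge0// lerDl.
  by rewrite -mulrA ler_pM2l// ler_pdivlMl// -exprS.
apply: (@le_trans _ _ (C2 * dist p q `^ g)); last first.
  by rewrite ler_wpM2r ?powR_ge0// lerDr divr_ge0// ltW.
have h : rho ^+ n0 <= dist p q `^ g.
  by rewrite -half_powRX; apply: ge0_ler_powR;
    rewrite ?nnegrE ?(ltW g0) ?(ltW big) ?(nets_ge0 hnets)// exprn_ge0// invr_ge0.
apply: (@le_trans _ _ (C2 * rho ^+ n0)); last by rewrite ler_wpM2l.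
rewrite /C2 divfK ?gt_eqF ?exprn_gt0//.
have hp := chain_lim_le hnets rho01 hx Dp (leqnn _);
  have hq := chain_lim_le hnets rho01 hx Dq (leqnn _).
have hpq : `|x (proj n0 p) - x (proj n0 q)| <= Mx.
  have [i iN ->] := nets_proj hnets n0 Dp; have [j jN ->] := nets_proj hnets n0 Dq.
  rewrite /Mx (bigD1 (Ordinal iN))//= (bigD1 (Ordinal jN))//= -addrA lerDl addr_ge0//.
    exact: sumr_ge0.
  by apply: sumr_ge0 => k _; apply: sumr_ge0.
have -> : chain_lim proj x p - chain_lim proj x q = (x (proj n0 p) - x (proj n0 q)) -
   (x (proj n0 p) - chain_lim proj x p) + (x (proj n0 q) - chain_lim proj x q) by ring.
rewrite (le_trans (ler_normD _ _))// (le_trans (lerD (ler_normB _ _) (lexx _)))//.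
lra.
Qed.

End ChainingHolder.

Section ChainingProbability.
Context {d} {Omega : measurableType d} {R : realType} {S : Type}.
Variables (P : probability Omega R) (D : set S) (dist : S -> S -> R).
Variables (N : nat -> nat) (net : nat -> nat -> S) (proj : nat -> S -> S).
Variables (X : S -> Omega -> R) (eta C K : R).
Hypothesis hnets : nets D dist N net proj.
Hypothesis eta0 : 0 < eta.
Hypothesis K0 : 0 <= K.
Hypothesis hN : forall n, (N n)%:R <= C * K ^+ n.
Hypothesis mX : forall p, D p -> measurable_fun setT (X p).
Hypothesis tailX : forall m, exists2 c : R, 0 <= c &
  forall p q l, D p -> D q -> 0 < l ->
  (P [set w | (l < `|X p w - X q w|)%R] <= (c * ((dist p q `^ eta / l) ^+ 2) ^+ m)%:E)%E.

Let mXX p q : D p -> D q -> measurable_fun setT (fun w => X p w - X q w).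
Proof. by move=> Dp Dq; apply: measurable_funB; exact: mX. Qed.

Let bad (g : R) (n i j : nat) : set Omega :=
  if (dist (net2 N net n i) (net2 N net n j) <= 10 * 2^-1 ^+ n) then
    [set w | (2^-1 `^ g) ^+ n < `|X (net2 N net n i) w - X (net2 N net n j) w|]
  else set0.

Let N2 n := (N n + N n.+1)%N.

Let bads (g : R) n := \big[setU/set0]_(i < N2 n) \big[setU/set0]_(j < N2 n) bad g n i j.

Let measurable_bad g n i j : (i < N2 n)%N -> (j < N2 n)%N -> measurable (bad g n i j).
Proof.
move=> iN jN; rewrite /bad; case: ifP => // _.
apply: measurable_gt_norm; apply: mXX; exact: (net2_in hnets).
Qed.

Let measurable_bads g n : measurable (bads g n).
Proof.
apply: bigsetU_measurable => i _; apply: bigsetU_measurable => j _.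
exact: measurable_bad.
Qed.

Let prob_bads g n (e : R) : (forall i j, (i < N2 n)%N -> (j < N2 n)%N ->
  (P (bad g n i j) <= e%:E)%E) ->
  (P (bads g n) <= (((N2 n)%:R ^+ 2) * e)%:E)%E.
Proof.
move=> h; rewrite /bads.
apply: (le_trans (@le_mu_bigsetU _ _ _ P (fun i => \big[setU/set0]_(j < N2 n) bad g n i j) _ _)).
  by move=> i iN; apply: bigsetU_measurable => j _; exact: measurable_bad.
have h1 (i : 'I_(N2 n)) : (P (\big[setU/set0]_(j < N2 n) bad g n i j) <= ((N2 n)%:R * e)%:E)%E.
  apply: (le_trans (@le_mu_bigsetU _ _ _ P (fun j => bad g n i j) _ _)).
    by move=> j jN; exact: measurable_bad.
  apply: (@le_trans _ _ (\sum_(j < N2 n) e%:E)%E); first by apply: lee_sum => j _; exact: h.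
  by rewrite sumEFin lee_fin sumr_const card_ord mulr_natl.
apply: (@le_trans _ _ (\sum_(i < N2 n) ((N2 n)%:R * e)%:E)%E); first by apply: lee_sum => i _;
  exact: h1.
by rewrite sumEFin lee_fin sumr_const card_ord -[X in X <= _]mulr_natl mulrA expr2.
Qed.

Lemma chaining_close (g : R) : g < eta ->
  {ae P, forall w, exists n0, forall n, (n0 <= n)%N ->
     close_bound dist N net (X^~ w) n ((2^-1 `^ g) ^+ n)}.
Proof.
move=> geta.
have C0 : 0 <= C by have := hN 0; rewrite expr0 mulr1; apply: le_trans.
pose q0 := 2^-1 `^ (eta - g) : R.
have [q00 q01] := andP (@half_powR_lt1 R (eta - g) ltac:(by rewrite subr_gt0)).
have [m hm] : exists m, K ^+ 2 * (q0 ^+ 2) ^+ m <= 2^-1.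
  have c1 : (fun m => K ^+ 2 * (q0 ^+ 2) ^+ m) @ \oo --> (0 : R).
    rewrite -(mulr0 (K ^+ 2)); apply: cvgM; first exact: cvg_cst.
    apply: cvg_expr; rewrite ger0_norm ?sqr_ge0// expr2.
    by rewrite mulr_ilt1// ltW.
  have h2 : (0 : R) < 2^-1 by rewrite invr_gt0.
  move/cvgrPdist_lt : c1 => /(_ _ h2) [m _ Hm]; exists m; apply: ltW.
  have := Hm m (leqnn m); rewrite sub0r normrN; apply: le_lt_trans; exact: ler_norm.
have [c c0 hc] := tailX m.
pose A := (C * (1 + K)) ^+ 2 * (c * ((10 `^ eta) ^+ 2) ^+ m).
have : {ae P, forall w, exists n0, forall n, (n0 <= n)%N -> ~ bads g n w}.
  apply: (@borel_cantelli_geometric _ _ _ P _ A 2^-1).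
  - by move=> n; exact: measurable_bads.
  - by apply/andP; split; lra.
  - move=> n.
    set u := c * ((((10 * 2^-1 ^+ n) `^ eta) / ((2^-1 `^ g) ^+ n)) ^+ 2) ^+ m.
    have u0 : 0 <= u by rewrite mulr_ge0// exprn_ge0// sqr_ge0.
    apply: (le_trans (prob_bads (e := u) _)).
      move=> i j iN jN; rewrite /bad; case: ifPn => [dij|_]; last by rewrite measure0.
      have l0 : 0 < (2^-1 `^ g) ^+ n :> R by rewrite exprn_gt0// powR_gt0// invr_gt0.
      apply: (le_trans (hc _ _ _ (net2_in hnets iN) (net2_in hnets jN) l0)).
      rewrite lee_fin ler_wpM2l//.
      have h1 : 0 <= dist (net2 N net n i) (net2 N net n j) `^ eta / (2^-1 `^ g) ^+ n.
        by rewrite divr_ge0 ?powR_ge0// ltW.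
      have h2 : dist (net2 N net n i) (net2 N net n j) `^ eta / (2^-1 `^ g) ^+ n
         <= (10 * 2^-1 ^+ n) `^ eta / (2^-1 `^ g) ^+ n.
        rewrite ler_pM2r ?invr_gt0//; apply: ge0_ler_powR;
          rewrite ?nnegrE ?(ltW eta0) ?(nets_ge0 hnets) ?mulr_ge0 ?exprn_ge0 ?invr_ge0//.
      by rewrite lerXn2r ?nnegrE ?sqr_ge0// lerXn2r ?nnegrE// (le_trans h1 h2).
    rewrite lee_fin.
    have hN2 : (N2 n)%:R <= C * (1 + K) * K ^+ n.
      rewrite /N2 natrD mulrDr mulr1 mulrDl lerD//.
      by have := hN n.+1; rewrite exprS mulrA.
    have eu : u = c * ((10 `^ eta) ^+ 2) ^+ m * ((q0 ^+ 2) ^+ m) ^+ n.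
      rewrite /u powRM ?exprn_ge0 ?invr_ge0// half_powRX -mulrA -exprVn -exprMn.
      rewrite -powRN -powRD; last by apply/implyP => _; rewrite invr_eq0.
      have h3 (y z : R) : ((y * z ^+ n) ^+ 2) ^+ m = (y ^+ 2) ^+ m * ((z ^+ 2) ^+ m) ^+ n.
        rewrite -[LHS]exprM exprMn -!exprM; congr (_ * _ ^+ _).

        by rewrite mulnCA [(n * m)%N]mulnC.
      by rewrite -/q0 h3 mulrA.
    apply: (@le_trans _ _ ((C * (1 + K) * K ^+ n) ^+ 2 * u)).
      by rewrite ler_wpM2r// lerXn2r ?nnegrE// mulr_ge0 ?mulr_ge0 ?addr_ge0 ?exprn_ge0.
    rewrite eu /A exprMn.
    set a1 := (C * (1 + K)) ^+ 2; set a2 := c * _.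
    have -> : a1 * (K ^+ n) ^+ 2 * (a2 * ((q0 ^+ 2) ^+ m) ^+ n) =
      a1 * a2 * (K ^+ 2 * (q0 ^+ 2) ^+ m) ^+ n.
      have -> : (K ^+ n) ^+ 2 = (K ^+ 2) ^+ n by rewrite -!exprM mulnC.
      by rewrite [in RHS]exprMn; ring.
    rewrite ler_wpM2l//; first by rewrite mulr_ge0 ?sqr_ge0// mulr_ge0// exprn_ge0// sqr_ge0.
    by rewrite lerXn2r ?nnegrE ?invr_ge0// mulr_ge0 ?sqr_ge0// exprn_ge0// sqr_ge0.
apply: filterS => w [n0 hn0]; exists n0 => n nn0 i j iN jN dij.
rewrite leNgt; apply/negP => hlt; apply: (hn0 n nn0).
rewrite /bads -(bigcup_mkord (N2 n) (fun i => \big[setU/set0]_(j < N2 n) bad g n i j)).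
exists i => //; rewrite -(bigcup_mkord (N2 n) (bad g n i)); exists j => //.
by rewrite /bad dij.
Qed.

Lemma chaining_holder :
  {ae P, forall w, (forall p, D p -> cvgn (fun n => X (proj n p) w)) /\
    forall g, 0 < g < eta -> exists2 A : R, 0 < A & forall p q, D p -> D q ->
    `|chain_lim proj (X^~ w) p - chain_lim proj (X^~ w) q| <= A * dist p q `^ g}.
Proof.
pose gk (k : nat) := eta * (1 - k.+2%:R^-1).
have hk k : gk k < eta.
  by rewrite /gk gtr_pMr// ltrBlDr ltrDl invr_gt0.
have hk0 k : 0 < gk k by rewrite mulr_gt0// subr_gt0 invf_lt1// ltr1n.
have := ae_foralln (fun k => chaining_close (hk k)).
apply: filterS => w Hw; split.
  move=> p Dp; have [n0 hn0] := Hw 0%N.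
  have := (@chain_cvg _ _ _ _ _ _ _ hnets (X^~ w) _ _ (half_powR_lt1 (hk0 0%N)) hn0 _ Dp); exact.
move=> g /andP[g0 geta].
have [k hgk] : exists k, g <= gk k.
  have e0 : 0 < 1 - g / eta by rewrite subr_gt0 ltr_pdivrMr// mul1r.
  pose k := Num.truncn ((1 - g / eta)^-1); exists k.
  have : (1 - g / eta)^-1 < k.+2%:R.
    by apply: lt_trans (truncnS_gt _) _; rewrite ltr_nat.
  rewrite /gk -ltf_pV2 ?posrE ?invr_gt0// invrK => h.
  have : g / eta <= 1 - k.+2%:R^-1 by rewrite lerBrDr addrC -lerBrDr ltW.
  by rewrite ler_pdivrMr// mulrC.
have [n0 hn0] := Hw k.
apply: (chain_holder hnets g0 (n0 := n0)) => n nn0 i j iN jN dij.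
apply: le_trans (hn0 n nn0 i j iN jN dij) _.
rewrite lerXn2r ?nnegrE ?powR_ge0//; apply: ger_powR => //.
by apply/andP; split; lra.
Qed.

Lemma chaining_modification p : D p ->
  {ae P, forall w, (fun n => X (proj n p) w) @ \oo --> X p w}.
Proof.
move=> Dp.
have Dproj n : D (proj n p).
  by have [i iN ->] := nets_proj hnets n Dp; exact: (nets_in hnets).
pose e n := (2^-1 `^ (eta / 2)) ^+ n : R.
have [q0 q1] := andP (@half_powR_lt1 R (eta / 2) ltac:(by rewrite divr_gt0)).
have [c c0 hc] := tailX 1.
have [q00 q01] := andP (@half_powR_lt1 R eta eta0).
have : {ae P, forall w, exists n0, forall n, (n0 <= n)%N ->
    ~ [set w | e n < `|X p w - X (proj n p) w|] w}.
  apply: (@borel_cantelli_geometric _ _ _ P _ c (2^-1 `^ eta)).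
  - by move=> n; apply: measurable_gt_norm; exact: mXX.
  - by rewrite q01 ltW.
  - move=> n; have en0 : 0 < e n by rewrite exprn_gt0.
    apply: (le_trans (hc _ _ _ Dp (Dproj n) en0)).
    rewrite lee_fin expr1 ler_wpM2l//.
    apply: (@le_trans _ _ ((((2^-1 `^ eta) ^+ n) / e n) ^+ 2)).
      rewrite lerXn2r ?nnegrE ?divr_ge0 ?powR_ge0 ?exprn_ge0 ?(ltW q00) ?(ltW en0)//.
      rewrite ler_pM2r ?invr_gt0// -half_powRX; apply: ge0_ler_powR;
        rewrite ?nnegrE ?(ltW eta0) ?(nets_ge0 hnets) ?exprn_ge0 ?invr_ge0//.
      exact: (nets_close hnets).
    have -> : 2^-1 `^ eta = (2^-1 `^ (eta / 2)) ^+ 2 :> R.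
      by rewrite -powR_mulrn ?powR_ge0// -powRrM divfK.
    rewrite -exprM mulnC exprM -/(e n) expr2 mulfK ?gt_eqF//.
apply: filterS => w [n0 hn0]; apply/cvgrPdist_le => /= t t0.
have h1 : `|2^-1 `^ (eta / 2) : R| < 1 by rewrite ger0_norm// ltW.
have /cvgrPdist_lt /(_ t t0) [m _ Hm] := cvg_expr h1.
exists (maxn m n0) => // n /=; rewrite geq_max => /andP[mn nn0].
have := Hm n mn; rewrite sub0r normrN ger0_norm ?exprn_ge0 ?(ltW q0)// => /ltW; apply: le_trans.
by rewrite leNgt; apply/negP; exact: hn0.
Qed.

End ChainingProbability.

(** * Energy estimates on cells *)

Lemma uniform_lt1 (R : realFieldType) (n : nat) (c : 'I_n -> R) :
  (forall i, c i < 1) -> exists2 q : R, 0 < q < 1 & forall i, c i <= q.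
Proof.
move=> c1; exists (\big[Num.max/2^-1]_i c i); last by move=> i; exact: le_bigmax_cond.
apply/andP; split.
  by apply: lt_le_trans (bigmax_ge_id _ _ _ _); rewrite invr_gt0.
by apply/bigmax_ltP; split => //; rewrite invf_lt1// ltr1n.
Qed.

Section Geometry.
Context {R : realType} {F : pMetricType R} {M : nat}.
Variable psi : 'I_M -> F -> F.
Hypothesis hpsi : pcf_self_similar psi.

Lemma mdist_continuous (z : F) : continuous (mdist z : F -> R).
Proof.
move=> x; apply/cvgrPdist_lt => e e0.
near=> y; have : ball x e y by near: y; exact: nbhsx_ballx.
rewrite ballEmdist/= => h; apply: le_lt_trans h.
rewrite ler_norml; apply/andP; split.
  have := metric_triangle z x y; lra.
by have := metric_triangle z y x; rewrite (metric_sym y x); lra.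
Unshelve. all: by end_near. Qed.

Lemma diameter_bound : exists2 B : R, 0 <= B & forall x y : F, mdist x y <= B.
Proof.
have [c _ hc] := @compact_EVT_max F R (mdist (point : F)) setT
  (ex_intro _ point I) (pcf_compact hpsi) (continuous_subspaceT (@mdist_continuous point)).
exists (2 * mdist (point : F) c); first by rewrite mulr_ge0// mdist_ge0.
move=> x y; apply: le_trans (metric_triangle x point y) _.
rewrite (metric_sym x).
by have := hc x (in_setT _); have := hc y (in_setT _); lra.
Qed.

Lemma contraction_uniform : exists2 c : R, 0 < c < 1 &
  forall i x y, mdist (psi i x) (psi i y) <= c * mdist x y.
Proof.
have /choice[c hc] : forall i, exists c : R, 0 < c < 1 /\
    forall x y, mdist (psi i x) (psi i y) <= c * mdist x y.
  by move=> i; have [c ? ?] := pcf_contraction hpsi i; exists c.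
have [q q01 hq] := @uniform_lt1 _ _ c (fun i => proj2 (andP (hc i).1)).
exists q => // i x y; apply: le_trans ((hc i).2 x y) _.
by rewrite ler_wpM2r ?mdist_ge0.
Qed.

Lemma cell_diameter : exists c B : R, [/\ 0 < c, c < 1, 0 <= B &
  forall w x y, mdist (psiw psi w x) (psiw psi w y) <= c ^+ size w * B].
Proof.
have [B B0 hB] := diameter_bound; have [c /andP[c0 c1] hc] := contraction_uniform.
exists c, B; split => // w x y; elim: w => [|i w IH] /=; first by rewrite expr0 mul1r.
by apply: le_trans (hc _ _ _) _; rewrite exprS -mulrA ler_pM2l.
Qed.

Lemma geometric_small (c B : R) : 0 < c -> c < 1 -> forall e : R, 0 < e ->
  exists N, forall n, (N <= n)%N -> c ^+ n * B < e.
Proof.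
move=> c0 c1 e e0.
have h1 : `|c| < 1 by rewrite ger0_norm// ltW.
have c2 : (fun n => c ^+ n * B) @ \oo --> (0 : R).
  by rewrite -(mul0r B); apply: cvgM; [exact: cvg_expr|exact: cvg_cst].
move/cvgrPdist_lt : c2 => /(_ e e0) [N _ HN]; exists N => n /HN.
rewrite sub0r normrN; apply: le_lt_trans; exact: ler_norm.
Qed.

Lemma psi_continuous i : continuous (psi i).
Proof.
move=> x; have [c /andP[c0 _] hc] := contraction_uniform.
apply/cvg_ballP => e e0; near=> y.
have : ball x (e / c) y by near: y; apply: nbhsx_ballx; rewrite divr_gt0.
rewrite !ballEmdist/= ltr_pdivlMr// mulrC; apply: le_lt_trans; exact: hc.
Unshelve. all: by end_near. Qed.

Lemma psiw_continuous w : continuous (psiw psi w).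
Proof.
elim: w => [|i w IH] x; first exact: cvg_id.
have := continuous_comp (IH x) (@psi_continuous i _); exact.
Qed.

Lemma cell_closed w : closed (cell psi w).
Proof.
apply: compact_closed; first exact: metric_hausdorff.
apply: continuous_compact; last exact: pcf_compact hpsi.
by apply: continuous_subspaceT; exact: psiw_continuous.
Qed.

Lemma psiw_cat w1 w2 x : psiw psi (w1 ++ w2) x = psiw psi w1 (psiw psi w2 x).
Proof. by rewrite /psiw foldr_cat. Qed.

Lemma psiw_rcons w i x : psiw psi (rcons w i) x = psiw psi w (psi i x).
Proof. by rewrite -cats1 psiw_cat. Qed.

Lemma coding_unique (v : nat -> 'I_M) z :
  (forall n, cell psi (mkseq v n) z) -> coding psi v = z.
Proof.
move=> hz; rewrite /coding.
have hg : (\bigcap_n cell psi (mkseq v n)) (get (\bigcap_n cell psi (mkseq v n))).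
  by apply: (@getPex _ (\bigcap_n cell psi (mkseq v n))); exists z => n _; exact: hz.
set g := get _ in hg *.
have [c [B [c0 c1 B0 hc]]] := cell_diameter.
apply: mdist_positivity; apply/eqP; rewrite eq_le mdist_ge0 andbT.
apply/ler_addgt0Pl => e e0; rewrite addr0.
have [N HN] := @geometric_small c B c0 c1 e e0.
have [x _ <-] := hg N I; have [y _ <-] := hz N.
apply: le_trans (hc _ _ _) _; rewrite size_mkseq; apply: ltW; exact: HN.
Qed.

Lemma decompose : exists (J : F -> 'I_M) (nx : F -> F), forall y, psi (J y) (nx y) = y.
Proof.
have /choice[p hp] : forall y, exists p : 'I_M * F, psi p.1 p.2 = y.
  move=> y; have : [set: F] y by [].
  by rewrite (pcf_cover hpsi) => -[i _ [z _ <-]]; exists (i, z).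
by exists (fun y => (p y).1), (fun y => (p y).2).
Qed.

Section Address.
Variables (J : F -> 'I_M) (nx : F -> F).
Hypothesis hJ : forall y, psi (J y) (nx y) = y.

Definition address (y : F) (n : nat) : 'I_M := J (iter n nx y).

Lemma address_nx y n : address (nx y) n = address y n.+1.
Proof. by rewrite /address -iterSr. Qed.

Lemma psiw_address y n : psiw psi (mkseq (address y) n) (iter n nx y) = y.
Proof.
elim: n => [//|n IH].
by rewrite mkseqS psiw_rcons /= /address hJ.
Qed.

Lemma coding_address y : coding psi (address y) = y.
Proof. by apply: coding_unique => n; exists (iter n nx y) => //; exact: psiw_address. Qed.

Lemma cell_intersection_F0 i j y z : i != j -> psi i y = psi j z ->
  F0 psi y /\ exists k, exists2 q, F0 psi q & psi k q = y.
Proof.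
move=> ij yz.
pose v n := if n is n'.+1 then address y n' else i.
have cv : coding psi v = psi i y.
  apply: coding_unique => -[|n]; first by exists (psi i y).
  have -> : mkseq v n.+1 = i :: mkseq (address y) n.
    by rewrite /mkseq/= -[1%N]addn0 iotaDl -map_comp.
  by exists (iter n nx y) => //=; rewrite psiw_address.
have crit : critical_set psi v.
  rewrite /critical_set/= cv; exists i, j; split => //; first by exists y.
  by exists z.
have h1 : post_critical_set psi (address y) by exists 1%N, v; split.
have h2 : post_critical_set psi (address (nx y)).
  exists 2%N, v; split => //; apply/funext => k; rewrite address_nx.
  by rewrite add2n.
split; first by exists (address y) => //; exact: coding_address.
exists (J y), (nx y) => //; exists (address (nx y)) => //; exact: coding_address.
Qed.

End Address.

Lemma cell_intersect (S : {set 'I_M}) i0 j0 : i0 \in S -> j0 \notin S ->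
  exists i j y z, [/\ i \in S, j \notin S & psi i y = psi j z].
Proof.
move=> i0S j0S; apply: contrapT => hno.
pose B := \bigcup_(i in [set` S]) range (psi i).
pose C := \bigcup_(i in [set` ~: S]) range (psi i).
have clU (T : {set 'I_M}) : closed (\bigcup_(i in [set` T]) range (psi i)).
  by apply: closed_bigcup => // i _; exact: (@cell_closed [:: i]).
have BC : B = ~` C.
  apply/seteqP; split => x.
    move=> [i /= iS [y _ yx]] [j /=]; rewrite inE => jS [z _ zx].
    by apply: hno; exists i, j, y, z; split => //; rewrite yx zx.
  move=> nC; have : [set: F] x by [].
  rewrite (pcf_cover hpsi) => -[i _ ix].
  have [iS|iS] := boolP (i \in S); first by exists i.
  by exfalso; apply: nC; exists i => //=; rewrite inE.
have BT : B = setT.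
  apply: (pcf_connected hpsi).
  - by exists (psi i0 point); exists i0 => //; exists point.
  - exists B; rewrite ?setTI// BC; apply: closed_openC; exact: clU.
  - by exists B; rewrite ?setTI//; exact: clU.
have : B (psi j0 point) by rewrite BT.
rewrite BC; apply; exists j0 => /=; first by rewrite inE.
by exists point.
Qed.

Lemma F0_finite : finite_set (F0 psi).
Proof. exact: finite_image (pcf_finite hpsi). Qed.

End Geometry.

Section Energy.
Context {R : realType} {F : pMetricType R} {M : nat}.
Variables (psi : 'I_M -> F -> F) (a : F -> F -> R) (r : 'I_M -> R).
Hypothesis hpsi : pcf_self_similar psi.
Hypothesis har : regular_harmonic_structure psi a r.

Notation E0 := (energy0 psi a).
Notation En := (energyn psi a r).

Let s : seq F := finmap.enum_fset (fset_set (F0 psi)).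

Let in_s x : (x \in s) <-> F0 psi x.
Proof.
have -> : (x \in s) = (x \in F0 psi) by rewrite -(in_fset_set (F0_finite hpsi)).
by rewrite inE.
Qed.

Lemma energy0E f : E0 f = 2^-1 * \sum_(x <- s) \sum_(y <- s) a x y * (f x - f y) ^+ 2.
Proof.
rewrite /energy0; have Ff := F0_finite hpsi.
rewrite fsbig_finite//; congr (_ * _); apply: eq_bigr => x _.
by rewrite fsbig_finite.
Qed.

Lemma energy0_term_ge0 f x y : F0 psi x -> F0 psi y -> 0 <= a x y * (f x - f y) ^+ 2.
Proof.
move=> Fx Fy; have [->|xy] := eqVneq x y; first by rewrite subrr expr0n mulr0.
by rewrite mulr_ge0 ?sqr_ge0// (harm_ge0 har).
Qed.

Lemma energy0_ge0 f : 0 <= E0 f.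
Proof.
rewrite energy0E mulr_ge0// ?invr_ge0// big_seq sumr_ge0// => x /in_s Fx.
by rewrite big_seq sumr_ge0// => y /in_s Fy; exact: energy0_term_ge0.
Qed.

Lemma energy0_ge_term f x y : F0 psi x -> F0 psi y ->
  a x y * (f x - f y) ^+ 2 <= 2 * E0 f.
Proof.
move=> Fx Fy; rewrite energy0E [leRHS]mulrA divff// mul1r.
have xs : x \in s by apply/in_s.
have ys : y \in s by apply/in_s.
rewrite (big_rem x)//= (big_rem y)//= -addrA lerDl addr_ge0//.
  by rewrite big_seq sumr_ge0// => z /mem_rem /in_s Fz; exact: energy0_term_ge0.
rewrite big_seq sumr_ge0// => z /mem_rem /in_s Fz.
by rewrite big_seq sumr_ge0// => t /in_s Ft; exact: energy0_term_ge0.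
Qed.

Lemma F0_oscillation : exists2 C : R, 0 <= C &
  forall f x y, F0 psi x -> F0 psi y -> (f x - f y) ^+ 2 <= C * E0 f.
Proof.
have H x y : F0 psi x -> F0 psi y -> exists C : R, 0 <= C /\
    forall f, (f x - f y) ^+ 2 <= C * E0 f.
  move=> Fx.
  pose S := [set y | F0 psi y /\ exists C : R, 0 <= C /\ forall f, (f x - f y) ^+ 2 <= C * E0 f].
  have SF : S `<=` F0 psi by move=> z [].
  suff -> : F0 psi = S by move=> [].
  apply/esym; apply: contrapT => SnF.
  have Sx : S x by split => //; exists 0; split => // f; rewrite subrr expr0n mul0r.
  have := harm_irreducible har SF (ex_intro _ x Sx).
  case; first exact/eqP.
  move=> p [q [[Fp [C [C0 hC]]] [Fq nSq] apq]]; apply: nSq; split => //.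
  have [<-|pq] := eqVneq p q; first by exists C.
  have apq0 : 0 < a p q by rewrite lt_def apq (harm_ge0 har).
  exists (2 * C + 4 / a p q); split => [|f].
    by rewrite addr_ge0 ?mulr_ge0// invr_ge0 ltW.
  have h1 := hC f; have := energy0_ge_term f Fp Fq.
  rewrite mulrC -ler_pdivlMr// => h2.
  have -> : (2 * C + 4 / a p q) * E0 f = 2 * (C * E0 f) + 2 * (2 * E0 f / a p q) by ring.
  have : 0 <= ((f x - f p) - (f p - f q)) ^+ 2 by exact: sqr_ge0.
  by nra.
have /choice[c hc] : forall xy : F * F, exists C : R, 0 <= C /\ (F0 psi xy.1 -> F0 psi xy.2 ->
    forall f, (f xy.1 - f xy.2) ^+ 2 <= C * E0 f).
  move=> [x y] /=; case: (pselect (F0 psi x /\ F0 psi y)) => [[Fx Fy]|nF].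
    by have [C [C0 hC]] := H x y Fx Fy; exists C.
  by exists 0; split => // Fx Fy; exfalso; apply: nF.
exists (\sum_(x <- s) \sum_(y <- s) c (x, y)).
  by apply: sumr_ge0 => x _; apply: sumr_ge0 => y _; exact: (hc _).1.
move=> f x y Fx Fy; apply: le_trans ((hc (x, y)).2 Fx Fy f) _.
rewrite ler_wpM2r ?energy0_ge0//.
have xs : x \in s by apply/in_s.
have ys : y \in s by apply/in_s.
rewrite (big_rem x)//= (big_rem y)//= -addrA lerDl addr_ge0//.
  by apply: sumr_ge0 => z _; exact: (hc _).1.
by apply: sumr_ge0 => z _; apply: sumr_ge0 => t _; exact: (hc _).1.
Qed.

Lemma r_gt0 i : 0 < r i. Proof. by have /andP[] := harm_regular har i. Qed.
Lemma r_lt1 i : r i < 1. Proof. by have /andP[] := harm_regular har i. Qed.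

Lemma rw_cons i w : rw r (i :: w) = r i * rw r w.
Proof. by rewrite /rw big_cons. Qed.

Lemma rw_gt0 w : 0 < rw r w.
Proof. by rewrite /rw; apply: prodr_gt0 => i _; exact: r_gt0. Qed.

Lemma energyn0 f : En 0 f = E0 f.
Proof.
rewrite /energyn (big_pred1 [tuple]); last by move=> w /=; rewrite [w]tuple0; apply/esym/eqP.
by rewrite /rw big_nil invr1 mul1r.
Qed.

Lemma big_tuple_cons n (G : seq 'I_M -> R) :
  \sum_(w : n.+1.-tuple 'I_M) G w = \sum_i \sum_(w : n.-tuple 'I_M) G (i :: w).
Proof.
rewrite pair_bigA /= (reindex (fun p : 'I_M * n.-tuple 'I_M => [tuple of p.1 :: p.2]))//=.
exists (fun w : n.+1.-tuple 'I_M => (thead w, [tuple of behead w])).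
  by move=> [i w] _ /=; congr (_, _); apply: val_inj.
by move=> w _; rewrite [RHS]tuple_eta; apply: val_inj.
Qed.

Lemma energynS n f : En n.+1 f = \sum_i (r i)^-1 * En n (f \o psi i).
Proof.
rewrite /energyn (big_tuple_cons n (fun w => (rw r w)^-1 * E0 (f \o psiw psi w))).
apply: eq_bigr => i _; rewrite mulr_sumr; apply: eq_bigr => w _.
by rewrite rw_cons invfM mulrA.
Qed.

Lemma energyn_ge0 n f : 0 <= En n f.
Proof.
by apply: sumr_ge0 => w _; rewrite mulr_ge0 ?energy0_ge0// invr_ge0 ltW// rw_gt0.
Qed.

Lemma energyn_le_succ n f : En n f <= En n.+1 f.
Proof.
elim: n f => [|n IH] f; first by rewrite energyn0; apply: (harm_min_le har).
rewrite energynS [leRHS]energynS; apply: ler_sum => i _.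
by rewrite ler_pM2l ?invr_gt0 ?r_gt0.
Qed.

Lemma energyn_nondecreasing f : nondecreasing_seq (En ^~ f).
Proof. by apply/nondecreasing_seqP => n; exact: energyn_le_succ. Qed.

Lemma energyn_psi n i f : En n (f \o psi i) <= r i * En n.+1 f.
Proof.
rewrite -ler_pdivrMl ?r_gt0// energynS (bigD1 i)//= lerDl sumr_ge0// => j _.
by rewrite mulr_ge0 ?energyn_ge0// invr_ge0 ltW// r_gt0.
Qed.

Lemma energyn_psiw n w f : En n (f \o psiw psi w) <= rw r w * En (size w + n) f.
Proof.
elim: w f => [|i w IH] f; first by rewrite /rw big_nil mul1r.
have := IH (f \o psi i); rewrite -[_ \o psiw psi w]/(f \o psiw psi (i :: w)).
move/le_trans; apply; rewrite rw_cons -mulrA mulrCA ler_pM2l ?rw_gt0//.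
exact: energyn_psi.
Qed.

Lemma level1_oscillation : exists2 C : R, 0 <= C & forall f i j p q,
  F0 psi p -> F0 psi q -> (f (psi i p) - f (psi j q)) ^+ 2 <= C * En 1 f.
Proof.
have [C C0 hC] := F0_oscillation.
have same f i p q : F0 psi p -> F0 psi q -> (f (psi i p) - f (psi i q)) ^+ 2 <= C * En 1 f.
  move=> Fp Fq; apply: le_trans (hC (f \o psi i) p q Fp Fq) _.
  rewrite ler_wpM2l// -energyn0; apply: le_trans (energyn_psi _ _ _) _.
  by rewrite ler_piMl ?energyn_ge0// ltW// r_lt1.
have [J [nx hJ]] := decompose hpsi.
have H i j : exists2 D : R, 0 <= D & forall f p q,
  F0 psi p -> F0 psi q -> (f (psi i p) - f (psi j q)) ^+ 2 <= D * En 1 f.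
  pose S := [set j | `[< exists2 D : R, 0 <= D & forall f p q,
    F0 psi p -> F0 psi q -> (f (psi i p) - f (psi j q)) ^+ 2 <= D * En 1 f >]]%SET.
  have [|nj] := boolP (j \in S); first by rewrite inE => /asboolP.
  have iS : i \in S by rewrite inE; apply/asboolP; exists C => // f p q; exact: same.
  have [k [l [y [z [kS lS yz]]]]] := cell_intersect hpsi iS nj.
  have kl : k != l by apply: contraNneq lS => <-.
  exfalso; move/negP : lS; apply; rewrite inE; apply/asboolP.
  have [Fy _] := cell_intersection_F0 hpsi hJ kl yz.
  have lk : l != k by rewrite eq_sym.
  have [Fz _] := cell_intersection_F0 hpsi hJ lk (esym yz).
  move: kS; rewrite inE => /asboolP[D D0 hD].
  exists (2 * D + 2 * C); first by rewrite addr_ge0// mulr_ge0.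
  move=> f p q Fp Fq.
  have h1 := hD f p y Fp Fy; have := same f l z q Fz Fq; rewrite -yz => h2.
  have -> : (2 * D + 2 * C) * En 1 f = 2 * (D * En 1 f) + 2 * (C * En 1 f) by ring.
  have : 0 <= ((f (psi i p) - f (psi k y)) - (f (psi k y) - f (psi l q))) ^+ 2 by exact: sqr_ge0.
  by nra.
have /choice[c hc] : forall ij : 'I_M * 'I_M, exists D : R, 0 <= D /\ forall f p q,
  F0 psi p -> F0 psi q -> (f (psi ij.1 p) - f (psi ij.2 q)) ^+ 2 <= D * En 1 f.
  by move=> [i j]; have [D D0 hD] := H i j; exists D.
exists (\sum_i \sum_j c (i, j)).
  by apply: sumr_ge0 => i _; apply: sumr_ge0 => j _; exact: (hc _).1.
move=> f i j p q Fp Fq; apply: le_trans ((hc (i, j)).2 f p q Fp Fq) _.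
rewrite ler_wpM2r ?energyn_ge0// (bigD1 i)//= (bigD1 j)//= -addrA lerDl addr_ge0//.
  by apply: sumr_ge0 => k _; exact: (hc _).1.
by apply: sumr_ge0 => k _; apply: sumr_ge0 => l _; exact: (hc _).1.
Qed.

Lemma boundary_point : exists p0 k q, [/\ F0 psi p0, F0 psi q & psi k q = p0].
Proof.
have [J [nx hJ]] := decompose hpsi.
have M2 := pcf_card hpsi.
pose i0 : 'I_M := Ordinal (ltnW M2); pose i1 : 'I_M := Ordinal M2.
have h0 : i0 \in [set i0]%SET by rewrite inE.
have h1 : i1 \notin [set i0]%SET by rewrite inE.
have [k [l [y [z [kS lS yz]]]]] := cell_intersect hpsi h0 h1.
have kl : k != l by apply: contraNneq lS => <-.
have [Fy [j [q Fq jq]]] := cell_intersection_F0 hpsi hJ kl yz.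
by exists y, j, q.
Qed.

(* Chaining along the points psi_(w1...wn) p0, where p0 lies in F^0 and in
   psi_k(F^0) for some k: consecutive points belong to the image under psi_(w1...wn)
   of the level-1 graph, so f varies between them by at most
   sqrt (C1 K rw(w1...wn)). *)
Lemma global_oscillation : exists2 C : R, 0 <= C &
  forall (f : F -> R) K, continuous f -> (forall n, En n f <= K) ->
  forall x y, (f x - f y) ^+ 2 <= C * K.
Proof.
have [C1 C10 hC1] := level1_oscillation.
have [p0 [k0 [q0 [Fp0 Fq0 kq0]]]] := boundary_point.
have [J [nx hJ]] := decompose hpsi.
have [rm /andP[rm0 rm1] hrm] := uniform_lt1 r_lt1.
have [c [B [c0 c1 B0 hc]]] := cell_diameter hpsi.
pose q := Num.sqrt rm.
have q0' : 0 < q by rewrite sqrtr_gt0.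
have q1 : q < 1 by rewrite -sqrtr1 ltr_sqrt.
have q1' : 0 < 1 - q by rewrite subr_gt0.
exists (4 * C1 / (1 - q) ^+ 2); first by rewrite divr_ge0 ?sqr_ge0// mulr_ge0.
move=> f K fc hK.
have K0 : 0 <= K by apply: le_trans (hK 0%N); exact: energyn_ge0.
pose A := Num.sqrt (C1 * K).
have A0 : 0 <= A by exact: sqrtr_ge0.
have rwle w : rw r w <= rm ^+ size w.
  elim: w => [|i w IH]; first by rewrite /rw big_nil.
  by rewrite rw_cons exprS ler_pM ?(ltW (r_gt0 _)) ?(ltW (rw_gt0 _)).
have main x : `|f p0 - f x| <= A / (1 - q).
  pose w n := mkseq (address J nx x) n.
  pose z n := psiw psi (w n) p0.
  have step n : `|f (z n) - f (z n.+1)| <= A * q ^+ n.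
    rewrite -(@ler_pXn2r _ 2) ?nnegrE ?mulr_ge0 ?exprn_ge0 ?(ltW q0')//.
    rewrite real_normK ?num_real// exprMn /A sqr_sqrtr ?mulr_ge0//.
    rewrite -exprM mulnC exprM /q sqr_sqrtr ?(ltW rm0)//.
    have := hC1 (f \o psiw psi (w n)) k0 (address J nx x n) q0 p0 Fq0 Fp0.
    rewrite /= kq0 -/(z n) -psiw_rcons -mkseqS -/(w n.+1) -/(z n.+1) => /le_trans; apply.
    rewrite -mulrA ler_wpM2l//; apply: le_trans (energyn_psiw _ _ _) _.
    rewrite mulrC ler_pM ?energyn_ge0 ?(ltW (rw_gt0 _))//.
    by rewrite (le_trans (rwle _))// size_mkseq.
  have tel n : `|f p0 - f (z n)| <= A * ((1 - q ^+ n) / (1 - q)).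
    elim: n => [|n IH]; first by rewrite subrr normr0 expr0 subrr mul0r mulr0.
    rewrite -(subrKA (f (z n))) (le_trans (ler_normD _ _))//.
    have := lerD IH (step n) => /le_trans; apply.
    rewrite -mulrDr ler_wpM2l// -{2}[q ^+ n](mulfK (lt0r_neq0 q1')) -mulrDl ler_pM2r ?invr_gt0//.
    by rewrite exprS; lra.
  have zx : z @ \oo --> x.
    apply/cvg_ballP => e e0; have [N HN] := geometric_small B c0 c1 e0.
    exists N => // n /= Nn; rewrite ballEmdist/= -{1}(psiw_address hJ x n).
    by apply: le_lt_trans (hc _ _ _) _; rewrite size_mkseq; exact: HN.
  have fz : (fun n => `|f p0 - f (z n)|) @ \oo --> `|f p0 - f x|.
    apply: cvg_norm; apply: cvgB; first exact: cvg_cst.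
    exact: (cvg_comp _ _ zx (fc x)).
  rewrite -(cvg_lim _ fz)//; apply: limr_le; first by apply/cvg_ex; eexists; exact: fz.
  apply: nearW => n; apply: le_trans (tel n) _; rewrite ler_wpM2l//.
  by rewrite -[leRHS]mul1r ler_pM2r ?invr_gt0// gerBl exprn_ge0// ltW.
move=> x y.
have h : `|f x - f y| <= 2 * (A / (1 - q)).
  have -> : f x - f y = (f p0 - f y) - (f p0 - f x) by ring.
  by rewrite (le_trans (ler_normB _ _))//; have := main x; have := main y; lra.
rewrite -real_normK ?num_real//.
have -> : 4 * C1 / (1 - q) ^+ 2 * K = (2 * (A / (1 - q))) ^+ 2.
  by rewrite !exprMn exprVn /A sqr_sqrtr ?mulr_ge0//; ring.
by rewrite lerXn2r ?nnegrE// mulr_ge0// divr_ge0// ltW.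
Qed.

Lemma form_domain_cvg f : form_domain psi a r f ->
  continuous f /\ (En ^~ f) @ \oo --> energy_diag psi a r f.
Proof.
move=> [fc fb]; split => //; apply: nondecreasing_is_cvgn => //.
exact: energyn_nondecreasing.
Qed.

Lemma energyn_le_diag f n : form_domain psi a r f -> En n f <= energy_diag psi a r f.
Proof.
move=> [fc fb]; apply: nondecreasing_cvgn_le; first exact: energyn_nondecreasing.
by apply: nondecreasing_is_cvgn => //; exact: energyn_nondecreasing.
Qed.

Lemma cell_oscillation : exists2 C : R, 0 < C & forall f w x y,
  form_domain psi a r f -> (f (psiw psi w x) - f (psiw psi w y)) ^+ 2 <=
    C * rw r w * energy_diag psi a r f.
Proof.
have [C C0 hC] := global_oscillation; exists (C + 1); first by rewrite ltr_wpDl.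
move=> f w x y fD.
have fc : continuous (f \o psiw psi w).
  move=> z; have := continuous_comp (@psiw_continuous _ _ _ _ hpsi w z) (fD.1 _); exact.
apply: le_trans (hC _ (rw r w * energy_diag psi a r f) fc _ x y) _.
  move=> n; apply: le_trans (energyn_psiw _ _ _) _.
  by rewrite ler_pM2l ?rw_gt0//; exact: energyn_le_diag.
rewrite mulrA ler_wpM2r//; first by rewrite (le_trans _ (energyn_le_diag 0 fD))// energyn_ge0.
by rewrite ler_pM2r ?rw_gt0// lerDl.
Qed.

End Energy.

(** * Resistance, square-integrable functions and Bessel bounds *)

Section FormDomain.
Context {R : realType} {F : pMetricType R} {M : nat}.
Variables (psi : 'I_M -> F -> F) (a : F -> F -> R) (r : 'I_M -> R).
Hypothesis hpsi : pcf_self_similar psi.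
Hypothesis har : regular_harmonic_structure psi a r.

Notation En := (energyn psi a r).
Notation Dom := (form_domain psi a r).
Notation Ediag := (energy_diag psi a r).

Let s : seq F := finmap.enum_fset (fset_set (F0 psi)).

Definition energyn_bil (n : nat) (f g : F -> R) : R :=
  \sum_(w : n.-tuple 'I_M) (rw r w)^-1 * (2^-1 * \sum_(x <- s) \sum_(y <- s)
    a x y * ((f (psiw psi w x) - f (psiw psi w y)) * (g (psiw psi w x) - g (psiw psi w y)))).

Lemma energyn_bilE n f : energyn_bil n f f = En n f.
Proof. by apply: eq_bigr => w _; rewrite (energy0E a hpsi). Qed.

Lemma energyn_bilC n f g : energyn_bil n f g = energyn_bil n g f.
Proof.
apply: eq_bigr => w _; congr (_ * (_ * _)); apply: eq_bigr => x _; apply: eq_bigr => y _.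
by rewrite [in RHS]mulrC mulrC; congr (_ * _); rewrite mulrC.
Qed.

Lemma energyn_bil_linear n c f h g :
  energyn_bil n (fun x => c * f x + h x) g = c * energyn_bil n f g + energyn_bil n h g.
Proof.
rewrite /energyn_bil mulr_sumr -big_split; apply: eq_bigr => w _ /=.
rewrite [c * _]mulrCA -mulrDr; congr (_ * _); rewrite [c * _]mulrCA -mulrDr; congr (_ * _).
rewrite mulr_sumr -big_split; apply: eq_bigr => x _ /=.
by rewrite mulr_sumr -big_split; apply: eq_bigr => y _ /=; ring.
Qed.

Lemma energyn_bil_linear_r n c f h g :
  energyn_bil n g (fun x => c * f x + h x) = c * energyn_bil n g f + energyn_bil n g h.
Proof. by rewrite energyn_bilC energyn_bil_linear !(energyn_bilC n g). Qed.

Lemma energynD n f g : En n (f \+ g) = En n f + 2 * energyn_bil n f g + En n g.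
Proof.
rewrite -!energyn_bilE.
have -> : f \+ g = (fun x => 1 * f x + g x) by apply/funext => x; rewrite mul1r.
by rewrite energyn_bil_linear !energyn_bil_linear_r (energyn_bilC n g f); ring.
Qed.

Lemma energynB n f g : En n (f \- g) = En n f - 2 * energyn_bil n f g + En n g.
Proof.
rewrite -!energyn_bilE.
have -> : f \- g = (fun x => -1 * g x + f x) by apply/funext => x /=; ring.
by rewrite energyn_bil_linear !energyn_bil_linear_r (energyn_bilC n g f); ring.
Qed.

Lemma energynZ n c f : En n (fun x => c * f x) = c ^+ 2 * En n f.
Proof.
have h g : energyn_bil n (fun x => c * f x) g = c * energyn_bil n f g.
  have -> : (fun x => c * f x) = (fun x => (c - 1) * f x + f x) by apply/funext => x; ring.
  by rewrite energyn_bil_linear; ring.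
by rewrite -!energyn_bilE h energyn_bilC h; ring.
Qed.

Lemma form_domainP f K : continuous f -> (forall n, En n f <= K) -> Dom f.
Proof. by move=> fc hK; split => //; exists K => _ [n _ <-]. Qed.

Lemma form_domainZ c f : Dom f -> Dom (fun x => c * f x).
Proof.
move=> Df; apply: (@form_domainP _ (c ^+ 2 * Ediag f)).
  by move=> x; apply: cvgM; [exact: cvg_cst|exact: Df.1].
by move=> n; rewrite energynZ ler_wpM2l ?sqr_ge0// (energyn_le_diag har).
Qed.

Lemma form_domainD f g : Dom f -> Dom g -> Dom (f \+ g).
Proof.
move=> Df Dg; apply: (@form_domainP _ (2 * Ediag f + 2 * Ediag g)).
  by move=> x; apply: cvgD; [exact: Df.1|exact: Dg.1].
move=> n; have := energyn_ge0 hpsi har n (f \- g).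
have := energyn_le_diag har n Df; have := energyn_le_diag har n Dg.
by rewrite energynB energynD; lra.
Qed.

Lemma form_domainN f : Dom f -> Dom (\- f).
Proof.
move=> Df; have -> : \- f = (fun x => -1 * f x) by apply/funext => x /=; ring.
exact: form_domainZ.
Qed.

Lemma form_domainB f g : Dom f -> Dom g -> Dom (f \- g).
Proof. by move=> Df Dg; apply: form_domainD => //; exact: form_domainN. Qed.

Lemma energyn_cst n c : En n (fun _ => c) = 0.
Proof.
rewrite -energyn_bilE /energyn_bil big1// => w _.
rewrite big1 ?mulr0// => x _; rewrite big1// => y _.
by rewrite subrr !mul0r mulr0.
Qed.

Lemma form_domain_cst c : Dom (fun _ => c).
Proof.
by apply: (@form_domainP _ 0) => [|n]; [exact: cst_continuous|rewrite energyn_cst].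
Qed.

Lemma energyn_cvg f : Dom f -> (En ^~ f) @ \oo --> Ediag f.
Proof. by move=> /(form_domain_cvg har)[]. Qed.

Lemma energy_cvg f g : Dom f -> Dom g ->
  (fun n => energyn_bil n f g) @ \oo --> energy psi a r f g.
Proof.
move=> Df Dg; have h1 := energyn_cvg (form_domainD Df Dg).
have h2 := energyn_cvg (form_domainB Df Dg).
have -> : (fun n => energyn_bil n f g) =
    (fun n => 4^-1 * (En n (f \+ g) - En n (f \- g))).
  by apply/funext => n; rewrite energynB energynD; field.
by apply: cvgM; [exact: cvg_cst|exact: cvgB].
Qed.

Lemma energy_diagE f : Dom f -> energy psi a r f f = Ediag f.
Proof.
move=> Df; have h := energy_cvg Df Df.
have h2 := energyn_cvg Df.
have e : (fun n => energyn_bil n f f) = (En ^~ f) by apply/funext => n; exact: energyn_bilE.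
by rewrite e in h; exact: cvg_unique h h2.
Qed.

Lemma energy_linear c f h g : Dom f -> Dom h -> Dom g ->
  energy psi a r (fun x => c * f x + h x) g = c * energy psi a r f g + energy psi a r h g.
Proof.
move=> Df Dh Dg.
have h1 := energy_cvg (form_domainD (form_domainZ c Df) Dh) Dg.
have h2 : (fun n => energyn_bil n (fun x => c * f x + h x) g) @ \oo -->
    c * energy psi a r f g + energy psi a r h g.
  have -> : (fun n => energyn_bil n (fun x => c * f x + h x) g) =
    (fun n => c * energyn_bil n f g + energyn_bil n h g).
    by apply/funext => n; exact: energyn_bil_linear.
  by apply: cvgD; [apply: cvgM; [exact: cvg_cst|exact: energy_cvg]|exact: energy_cvg].
exact: cvg_unique h1 h2.
Qed.

Lemma energy_diag_ge0 f : Dom f -> 0 <= Ediag f.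
Proof.
by move=> Df; rewrite (le_trans _ (energyn_le_diag har 0 Df))// (energyn_ge0 hpsi har).
Qed.

Lemma energy_diagZ c f : Dom f -> Ediag (fun x => c * f x) = c ^+ 2 * Ediag f.
Proof.
move=> Df; have h1 := energyn_cvg (form_domainZ c Df).
have h2 : (En ^~ (fun x => c * f x)) @ \oo --> c ^+ 2 * Ediag f.
  have -> : (En ^~ (fun x => c * f x)) = (fun n => c ^+ 2 * En n f).
    by apply/funext => n; exact: energynZ.
  by apply: cvgM; [exact: cvg_cst|exact: energyn_cvg].
exact: cvg_unique h1 h2.
Qed.

Lemma energy_diag_sub_cst c f : Dom f -> Ediag (fun x => f x - c) = Ediag f.
Proof.
move=> Df; rewrite /energy_diag; congr (limn _); apply/funext => n.
apply: eq_bigr => w _; congr (_ * _); rewrite !(energy0E a hpsi); congr (_ * _).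
apply: eq_bigr => x _; apply: eq_bigr => y _; congr (_ * _ ^+ 2) => /=; ring.
Qed.

Notation Rst := (resistance psi a r).

Lemma resistance_xx x : Rst x x = 0.
Proof. by rewrite /resistance eqxx. Qed.

Let rset x y := [set energy psi a r f f | f in [set f | [/\ Dom f, f x = 0 & f y = 1]]].

Lemma resistance_ge0 x y : 0 <= Rst x y.
Proof.
rewrite /resistance; case: ifP => // _; rewrite invr_ge0 -/(rset x y).
have [[z Az]|/set0P/negP/negPn/eqP e] := pselect (rset x y !=set0).
  apply: lb_le_inf; first by exists z.
  by move=> _ [g [Dg _ _] <-]; rewrite energy_diagE// energy_diag_ge0.
by rewrite e inf0.
Qed.

Lemma resistance_bound f x y : Dom f -> (f x - f y) ^+ 2 <= Rst x y * Ediag f.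
Proof.
move=> Df; have [->|fxy] := eqVneq (f x) (f y).
  by rewrite subrr expr0n mulr_ge0 ?energy_diag_ge0 ?resistance_ge0.
rewrite /resistance; case: ifPn => [/eqP xy|xy]; first by rewrite xy eqxx in fxy.
have d0 : f y - f x != 0 by rewrite subr_eq0 eq_sym.
pose g z := (f y - f x)^-1 * (f z - f x).
have Dfx : Dom (fun z => f z - f x) by apply: form_domainB => //; exact: form_domain_cst.
have Dg : Dom g by exact: form_domainZ.
have Eg : Ediag g = Ediag f / (f y - f x) ^+ 2.
  by rewrite energy_diagZ// energy_diag_sub_cst// exprVn mulrC.
have [C C0 hC] := cell_oscillation hpsi har.
have lbA : lbound (rset x y) C^-1.
  move=> _ [h [Dh hx hy] <-]; rewrite energy_diagE//.
  have := hC h [::] x y Dh; rewrite /= hx hy /rw big_nil mulr1 sub0r sqrrN expr1n.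
  by rewrite mulrC -ler_pdivrMr// div1r.
have Ag : rset x y (Ediag g).
  by exists g; rewrite ?energy_diagE//; split; rewrite // /g ?subrr ?mulr0// mulVf.
have i1 : C^-1 <= inf (rset x y) by apply: lb_le_inf => //; exists (Ediag g).
have i2 : inf (rset x y) <= Ediag g by apply: ge_inf => //; exists C^-1.
have i0 : 0 < inf (rset x y) by apply: lt_le_trans i1; rewrite invr_gt0.
rewrite mulrC ler_pdivlMr// -[(f x - f y) ^+ 2]sqrrN opprB.
move: i2; rewrite Eg ler_pdivlMr; first by rewrite mulrC.
by rewrite exprn_even_gt0.
Qed.

Lemma resistance_le x y K : 0 <= K ->
  (forall f, Dom f -> (f x - f y) ^+ 2 <= K * Ediag f) -> Rst x y <= K.
Proof.
move=> K0 hK; rewrite /resistance; case: ifPn => // xy.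
have [ne|/set0P/negP/negPn/eqP e] := pselect (rset x y !=set0); last first.
  by rewrite -/(rset x y) e inf0 invr0.
have [k0|kn0] := eqVneq K 0.
  case: ne => _ [f [Df fx fy] _]; have := hK f Df.
  by rewrite k0 fx fy mul0r sub0r sqrrN expr1n ler10.
have kpos : 0 < K by rewrite lt_def kn0.
have i1 : K^-1 <= inf (rset x y).
  apply: lb_le_inf => // _ [f [Df fx fy] <-]; rewrite energy_diagE//.
  by have := hK f Df; rewrite fx fy sub0r sqrrN expr1n mulrC -ler_pdivrMr// div1r.
rewrite -[leRHS]invrK lef_pV2 ?posrE ?invr_gt0//.
by apply: lt_le_trans i1; rewrite invr_gt0.
Qed.

Lemma resistance_sym x y : Rst x y = Rst y x.
Proof.
suff h p q : Rst p q <= Rst q p by apply/eqP; rewrite eq_le !h.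
apply: resistance_le; first exact: resistance_ge0.
by move=> f Df; rewrite -sqrrN opprB; exact: resistance_bound.
Qed.

(* Weaker than the triangle inequality for the resistance metric, but immediate from
   [resistance_bound] and enough for chaining. *)
Lemma resistance_quasi x y z : Rst x z <= 2 * (Rst x y + Rst y z).
Proof.
apply: resistance_le; first by rewrite mulr_ge0// addr_ge0// resistance_ge0.
move=> f Df; have h1 := resistance_bound x y Df; have h2 := resistance_bound y z Df.
have : 0 <= ((f x - f y) - (f y - f z)) ^+ 2 by exact: sqr_ge0.
by nra.
Qed.

Lemma resistance_cell : exists2 C : R, 0 < C & forall w x y,
  Rst (psiw psi w x) (psiw psi w y) <= C * rw r w.
Proof.
have [C C0 hC] := cell_oscillation hpsi har; exists C => // w x y.
apply: resistance_le; first by rewrite mulr_ge0// ltW// (rw_gt0 har).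
by move=> f; exact: hC.
Qed.

End FormDomain.

Section L2Space.
Context {d} {T : measurableType d} {R : realType}.
Variable mu : probability T R.

Lemma Lnorm2_sqr (f : T -> R) :
  ('N[mu]_2%:E[EFin \o f] `^ 2 = \int[mu]_x (f x ^+ 2)%:E)%E.
Proof.
rewrite powR_Lnorm//; apply: eq_integral => x _ /=.
by rewrite powR_mulrn// real_normK ?num_real.
Qed.

Lemma L2P (f : T -> R) :
  L2 mu f <-> measurable_fun setT f /\ (\int[mu]_x (f x ^+ 2)%:E < +oo)%E.
Proof.
split.
  move=> hf; have mf : measurable_fun setT f by move: (sub_Lfun_mfun hf); rewrite inE.
  split=> //; rewrite -Lnorm2_sqr; apply: poweR_lty.
  by have := sub_Lfun_finLfun hf; rewrite inE.
move=> [mf if2]; rewrite /L2/= inE; apply/andP; split; first by rewrite inE.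
rewrite inE /= /finite_norm unlock; apply: poweR_lty; rewrite -/(Lnorm _ _ _).
apply: le_lt_trans if2; apply: ge0_le_integral => //=.
- under eq_fun do rewrite powR_mulrn//.
  by apply/measurable_EFinP/measurable_funX; exact: measurableT_comp.
- by apply/measurable_EFinP/measurable_funX.
- by move=> x _; rewrite powR_mulrn// real_normK ?num_real.
Qed.

Lemma L2_linear c f g : L2 mu f -> L2 mu g -> L2 mu (fun x => c * f x + g x).
Proof.
have p1 : (1 <= 2%:E :> \bar R)%E by rewrite lee_fin ler1n.
have [_ h] := Lfun_submod_closed mu p1.
by move=> hf hg; exact: (h c f g hf hg).
Qed.

Lemma L2_cst c : L2 mu (fun _ => c).
Proof. exact: Lfun_cst. Qed.

Lemma L2Z c f : L2 mu f -> L2 mu (fun x => c * f x).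
Proof.
move=> hf; have -> : (fun x => c * f x) = (fun x => c * f x + 0).
  by apply/funext => x; rewrite addr0.
by apply: L2_linear => //; exact: L2_cst.
Qed.

Lemma L2D f g : L2 mu f -> L2 mu g -> L2 mu (fun x => f x + g x).
Proof.
move=> hf hg; have -> : (fun x => f x + g x) = (fun x => 1 * f x + g x).
  by apply/funext => x; rewrite mul1r.
exact: L2_linear.
Qed.

Lemma L2_bounded (f : T -> R) B : measurable_fun setT f -> (forall x, `|f x| <= B) -> L2 mu f.
Proof.
move=> mf fB; apply/L2P; split => //.
apply: (@le_lt_trans _ _ (\int[mu]_x (B ^+ 2)%:E)%E).
  apply: ge0_le_integral => //.
  - by move=> x _; rewrite lee_fin sqr_ge0.
  - by apply/measurable_EFinP/measurable_funX.
  - move=> x _; rewrite lee_fin -real_normK ?num_real// lerXn2r ?nnegrE//.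
    exact: le_trans (fB x).
by rewrite integral_cst//= probability_setT mule1 ltry.
Qed.

Lemma L2_integrable_mul f g : L2 mu f -> L2 mu g ->
  mu.-integrable setT (EFin \o (fun x => f x * g x)).
Proof. by move=> hf hg; apply/Lfun1_integrable; exact: Lfun2_mul_Lfun1. Qed.

Lemma L2_measurable f : L2 mu f -> measurable_fun setT f.
Proof. by move=> /L2P[]. Qed.

Lemma L2innerC f g : L2inner mu f g = L2inner mu g f.
Proof. by rewrite /L2inner; apply: eq_Rintegral => x _; rewrite mulrC. Qed.

Lemma L2inner_linear c f h g : L2 mu f -> L2 mu h -> L2 mu g ->
  L2inner mu (fun x => c * f x + h x) g = c * L2inner mu f g + L2inner mu h g.
Proof.
move=> hf hh hg; rewrite /L2inner.
rewrite -RintegralZl//; last exact: L2_integrable_mul.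
rewrite -RintegralD//.
- by apply: eq_Rintegral => x _; ring.
- have := L2_integrable_mul (L2Z c hf) hg.
  by apply: eq_integrable => // x _; rewrite /= mulrA.
- exact: L2_integrable_mul.
Qed.

Lemma L2_sum (c : nat -> R) (phi : nat -> T -> R) n : (forall k, L2 mu (phi k)) ->
  L2 mu (fun x => \sum_(k < n) c k * phi k x).
Proof.
move=> hphi; elim: n => [|n IH].
  have -> : (fun x => \sum_(k < 0) c k * phi k x) = (fun _ => 0).
    by apply/funext => x; rewrite big_ord0.
  exact: L2_cst.
have -> : (fun x => \sum_(k < n.+1) c k * phi k x) =
    (fun x => (\sum_(k < n) c k * phi k x) + c n * phi n x).
  by apply/funext => x; rewrite big_ord_recr.
by apply: L2D => //; exact: L2Z.
Qed.

Lemma L2inner_sum (c : nat -> R) (phi : nat -> T -> R) n g :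
  (forall k, L2 mu (phi k)) -> L2 mu g ->
  L2inner mu (fun x => \sum_(k < n) c k * phi k x) g = \sum_(k < n) c k * L2inner mu (phi k) g.
Proof.
move=> hphi hg; elim: n => [|n IH].
  rewrite big_ord0 /L2inner.
  under eq_Rintegral do rewrite big_ord0 mul0r.
  by rewrite Rintegral_cst// mul0r.
rewrite big_ord_recr/= -IH addrC -L2inner_linear//; last exact: L2_sum.
by congr (L2inner mu _ g); apply/funext => x; rewrite big_ord_recr/= addrC.
Qed.

Lemma L2innerZ c f g : L2 mu f -> L2 mu g ->
  L2inner mu (fun x => c * f x) g = c * L2inner mu f g.
Proof.
move=> hf hg; rewrite /L2inner -RintegralZl//; last exact: L2_integrable_mul.
by apply: eq_Rintegral => x _; rewrite mulrA.
Qed.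

Lemma L2inner_sqr f : L2 mu f -> (L2inner mu f f)%:E = (\int[mu]_x (f x ^+ 2)%:E)%E.
Proof.
move=> hf; rewrite /L2inner /Rintegral fineK;
  last exact: (integrable_fin_num _ (L2_integrable_mul hf hf)).
by apply: eq_integral => x _; rewrite expr2.
Qed.

Lemma L2inner_ge0 f : 0 <= L2inner mu f f.
Proof. by apply: Rintegral_ge0 => x _; rewrite -expr2 sqr_ge0. Qed.

End L2Space.

Section Bessel.
Context {R : realType} {F : pMetricType R} {M : nat}.
Variables (psi : 'I_M -> F -> F) (a : F -> F -> R) (r : 'I_M -> R).
Hypothesis hpsi : pcf_self_similar psi.
Hypothesis har : regular_harmonic_structure psi a r.
Variables (mu : probability (borel F) R) (b : set F).
Variables (lam : nat -> R) (phi : nat -> F -> R).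
Hypothesis hphi : laplacian_eigenbasis psi a r mu b lam phi.

Notation Dom := (form_domain psi a r).
Notation Ediag := (energy_diag psi a r).

Lemma eigen_L2 k : L2 mu (phi k).
Proof. by case: hphi => -[]. Qed.

Lemma eigen_orthonormal k l : L2inner mu (phi k) (phi l) = (k == l)%:R.
Proof. by case: hphi => -[]. Qed.

Lemma eigen_ge0 k : 0 <= lam k.
Proof. by case: hphi => _ l0 hl _; apply: le_trans l0 (hl _ _ _). Qed.

Lemma eigen_domain k : form_domain_bc psi a r b (phi k).
Proof. by case: hphi => _ _ _ /(_ k)[]. Qed.

Lemma continuous_borel_measurable (f : F -> R) : continuous f ->
  measurable_fun (setT : set (borel F)) f.
Proof.
move=> cf; apply: (measurability _ (RGenOpens.measurableE R)).
move=> _ [_ [u [v ->]] <-]; rewrite setTI; apply: sub_sigma_algebra.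
by move/continuousP : cf; apply; exact: interval_open.
Qed.

Lemma form_domain_L2 f : Dom f -> L2 mu f.
Proof.
move=> Df; have [C C0 hC] := cell_oscillation hpsi har.
apply: (@L2_bounded _ _ _ mu _ (`|f point| + (1 + C * Ediag f))).
  by apply: continuous_borel_measurable; exact: Df.1.
move=> x; have := hC f [::] x point Df; rewrite /= /rw big_nil mulr1 => h.
rewrite -{1}(subrK (f point) (f x)) addrC (le_trans (ler_normD _ _))// lerD2l.
have := ler_norm (f x - f point); have := normr_ge0 (f x - f point).
move: h; rewrite -real_normK ?num_real//; set t := `|_| => h t0 _.
by nra.
Qed.

Lemma eigen_energy k g : form_domain_bc psi a r b g ->
  energy psi a r (phi k) g = lam k * L2inner mu (phi k) g.
Proof.
move=> Dg; case: hphi => _ _ _ /(_ k)[_ hL /(_ g Dg) ->].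
have gL2 := form_domain_L2 Dg.1.
have -> : (fun x : F => - (lam k * phi k x)) = (fun x : F => - lam k * phi k x).
  by apply/funext => x; rewrite mulNr.
by rewrite L2innerZ ?mulNr ?opprK//; exact: eigen_L2.
Qed.

Definition combination (c : nat -> R) (n : nat) : F -> R :=
  fun x => \sum_(k < n) c k * phi k x.

Lemma combination_domain c n : form_domain_bc psi a r b (combination c n).
Proof.
elim: n => [|n [IH1 IH2]].
  have -> : combination c 0 = (fun _ => 0) by apply/funext => x; rewrite /combination big_ord0.
  by split => //; exact: form_domain_cst.
have -> : combination c n.+1 = (fun x => c n * phi n x) \+ combination c n.
  by apply/funext => x; rewrite /combination big_ord_recr/= addrC.
have [D1 D2] := eigen_domain n.
split; first by apply: (form_domainD hpsi har) => //; exact: (form_domainZ hpsi har).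
by move=> x hx /=; rewrite D2// IH2// mulr0 addr0.
Qed.

Lemma combination_energy_sum c n g : Dom g ->
  energy psi a r (combination c n) g = \sum_(k < n) c k * energy psi a r (phi k) g.
Proof.
move=> Dg; elim: n => [|n IH].
  have -> : combination c 0 = (fun x => -1 * phi 0%N x + phi 0%N x).
    by apply/funext => x; rewrite /combination big_ord0; ring.
  have D0 := (eigen_domain 0).1.
  by rewrite (energy_linear hpsi har)// big_ord0; ring.
have -> : combination c n.+1 = (fun x => c n * phi n x + combination c n x).
  by apply/funext => x; rewrite /combination big_ord_recr/= addrC.
rewrite (energy_linear hpsi har) ?IH ?big_ord_recr/= 1?addrC//.
- exact: (eigen_domain n).1.
- exact: (combination_domain c n).1.
Qed.

Lemma eigen_inner_combination c n k : (k < n)%N ->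
  L2inner mu (phi k) (combination c n) = c k.
Proof.
move=> kn; rewrite L2innerC L2inner_sum; [|exact: eigen_L2|exact: eigen_L2].
rewrite (bigD1 (Ordinal kn))//= eigen_orthonormal eqxx mulr1 big1 ?addr0// => i ik.
rewrite eigen_orthonormal (_ : (i == k :> nat) = false) ?mulr0//.
by apply: contraNF ik => /eqP ik; apply/eqP/val_inj.
Qed.

Lemma combination_norm c n :
  L2inner mu (combination c n) (combination c n) = \sum_(k < n) c k ^+ 2.
Proof.
rewrite {1}/combination L2inner_sum;
  [|exact: eigen_L2|exact: (form_domain_L2 (combination_domain c n).1)].
by apply: eq_bigr => k _; rewrite eigen_inner_combination.
Qed.

Lemma combination_energy c n : Ediag (combination c n) = \sum_(k < n) lam k * c k ^+ 2.
Proof.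
have D := combination_domain c n.
rewrite -(energy_diagE hpsi har D.1) {1}combination_energy_sum ?D.1//; last exact: D.1.
apply: eq_bigr => k _; rewrite eigen_energy// eigen_inner_combination//.
by rewrite expr2 mulrCA.
Qed.

(* The functions phi_k / sqrt (A + lam k) are orthonormal for the form
   E + A <.,.>; this is Bessel's inequality for the bounded functional
   alpha f(x) + beta f(y). *)
Lemma bessel (al be K A : R) (x y : F) n : 0 < A -> 0 <= K ->
  (forall f, Dom f -> (al * f x + be * f y) ^+ 2 <= K * (Ediag f + A * L2inner mu f f)) ->
  \sum_(k < n) (al * phi k x + be * phi k y) ^+ 2 / (A + lam k) <= K.
Proof.
move=> A0 K0 hK; set S := \sum_(k < n) _.
have Al k : 0 < A + lam k by rewrite ltr_wpDr// eigen_ge0.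
pose c k := (al * phi k x + be * phi k y) / (A + lam k).
have S0 : 0 <= S by apply: sumr_ge0 => k _; rewrite divr_ge0 ?sqr_ge0// ltW.
have := hK _ (combination_domain c n).1.
have -> : al * combination c n x + be * combination c n y = S.
  rewrite /combination !mulr_sumr -big_split; apply: eq_bigr => k _ /=.
  by rewrite /c expr2; ring.
rewrite combination_energy combination_norm.
have -> : \sum_(k < n) lam k * c k ^+ 2 + A * \sum_(k < n) c k ^+ 2 = S.
  rewrite mulr_sumr -big_split; apply: eq_bigr => k _ /=.
  by rewrite /c; field; rewrite gt_eqF.
have [->|Sn0] := eqVneq S 0.
  by [].
by rewrite expr2 ler_pM2r// lt_def Sn0.
Qed.

Lemma resistance_bessel x y n :
  \sum_(k < n) (phi k x - phi k y) ^+ 2 / (1 + lam k) <= resistance psi a r x y.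
Proof.
have := @bessel 1 (-1) (resistance psi a r x y) 1 x y n ltr01 (resistance_ge0 hpsi har x y) _.
under eq_bigr do rewrite mul1r mulN1r.
apply => f Df; rewrite !mul1r mulN1r.
apply: le_trans (resistance_bound hpsi har x y Df) _.
by rewrite ler_wpM2l ?(resistance_ge0 hpsi har)// lerDl L2inner_ge0.
Qed.

Lemma scale_word : exists2 rm : R, 0 < rm & forall x rho, 0 < rho <= 1 ->
  exists w y, [/\ psiw psi w y = x, rm * rho <= rw r w & rw r w <= rho].
Proof.
have [q /andP[q0 q1] hq] := uniform_lt1 (r_lt1 har).
have [rm' /andP[rm0 rm1] hrm] := @uniform_lt1 _ _ (fun i => 1 - r i)
  (fun i => ltac:(by rewrite gtrBl; exact: (r_gt0 har))).
exists (1 - rm'); first by rewrite subr_gt0.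
have [J [nx hJ]] := decompose hpsi.
move=> x rho /andP[rho0 rho1]; pose w n := mkseq (address J nx x) n.
have rwle v : rw r v <= q ^+ size v.
  elim: v => [|i v IH]; first by rewrite /rw big_nil.
  by rewrite rw_cons exprS ler_pM ?(ltW (r_gt0 har _)) ?(ltW (rw_gt0 har _)).
have ex : exists n, rw r (w n) <= rho.
  have [N HN] := geometric_small 1 q0 q1 rho0; exists N.
  by apply: le_trans (rwle _) _; rewrite size_mkseq; have := HN N (leqnn _);
    rewrite mulr1 => /ltW.
case: (ex_minnP ex) => n hn nmin; exists (w n), (iter n nx x).
rewrite psiw_address//; split => //.
case: n hn nmin => [|n] hn nmin.
  rewrite /rw big_nil -[leRHS]mulr1 ler_pM//; first by rewrite subr_ge0 ltW.
    exact: ltW.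
  by rewrite gerBl ltW.
have : rho < rw r (w n) by rewrite ltNge; apply/negP => /nmin; rewrite ltnn.
rewrite /w mkseqS -cats1 /rw big_cat big_seq1 -/(rw r (mkseq _ n)) mulrC => hrho.
rewrite ler_pM ?(ltW rho0) ?(ltW hrho)//; first by rewrite subr_ge0 ltW.
by have := hrm (address J nx x n); lra.
Qed.

Lemma hausdorff_exponent_gt0 dH : hausdorff_exponent r dH -> 0 < dH.
Proof.
move=> hd; rewrite ltNge; apply/negP => d0.
have M2 := pcf_card hpsi.
have : M%:R <= 1 :> R.
  have -> : M%:R = \sum_(i < M) 1 :> R by rewrite sumr_const card_ord.
  rewrite -[leRHS]hd; apply: ler_sum => i _.
  rewrite -[leLHS](powRr0 (r i)); apply: ger_powR => //.
  by rewrite (r_gt0 har) ltW// (r_lt1 har).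
by rewrite lern1 leqNgt M2.
Qed.

(* f(x) is compared with the mean of f over a cell w containing x with rw(w) of
   order h^(2 delta): the oscillation of f^2 on the cell is at most rw(w) E(f, f), and
   mu(w)^-1 is of order h^(2 delta - 2) because (1 + dH) delta = 1. *)
Lemma value_bound dH : hausdorff_exponent r dH -> self_similar_measure psi r dH mu ->
  exists2 C : R, 0 < C & forall f x h, Dom f -> 0 < h <= 1 ->
    f x ^+ 2 <= C * h `^ (2 * (1 - spectral_dimension dH / 2)) *
      (Ediag f + h ^- 2 * L2inner mu f f).
Proof.
move=> hd hmu; have dH0 := hausdorff_exponent_gt0 hd.
set dl := 1 - _.
have dlE : dl = (dH + 1)^-1.
  by rewrite /dl /spectral_dimension; field; rewrite gt_eqF// ltr_wpDl// ltW.
have dl0 : 0 < dl by rewrite dlE invr_gt0 ltr_wpDl// ltW.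
have [C0 C00 hC0] := cell_oscillation hpsi har.
have [rm rm0 hrm] := scale_word.
exists (2 * C0 + 2 * rm `^ (- dH)); first by rewrite ltr_wpDr ?mulr_gt0// mulr_ge0// powR_ge0.
move=> f x h Df /andP[h0 h1].
set rho := h `^ (2 * dl).
have rho0 : 0 < rho by exact: powR_gt0.
have rho1 : rho <= 1.
  rewrite /rho -[leRHS](powRr0 h); apply: ger_powR; first by rewrite h0.
  by rewrite mulr_ge0// ltW.
have [w [y [wy rw1 rw2]]] := hrm x rho ltac:(by rewrite rho0).
have rw0 := rw_gt0 har w.
have E0 := energy_diag_ge0 hpsi har Df.
set N := L2inner mu f f; have N0 : 0 <= N by exact: L2inner_ge0.
set m := rw r w `^ dH; have m0 : 0 < m by exact: powR_gt0.
have mc : measurable (cell psi w : set (borel F)).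
  rewrite -[cell psi w]setCK; apply: measurableC; apply: sub_sigma_algebra.
  by apply: closed_openC; exact: (cell_closed hpsi).
have fL2 := form_domain_L2 Df.
have mf := L2_measurable fL2.
pose A := 2 * C0 * rw r w * Ediag f.
have A0 : 0 <= A by rewrite !mulr_ge0// ltW.
have key : f x ^+ 2 * m <= A * m + 2 * N.
  rewrite -lee_fin EFinD [(A * m)%:E]EFinM [(2 * N)%:E]EFinM [(f x ^+ 2 * m)%:E]EFinM -hmu
    L2inner_sqr//.
  have -> : ((f x ^+ 2)%:E * mu (cell psi w) = \int[mu]_(z in cell psi w) (f x ^+ 2)%:E)%E.
    by rewrite integral_cst.
  apply: (@le_trans _ _ (\int[mu]_(z in cell psi w) (A%:E + 2%:E * (f z ^+ 2)%:E))%E).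
    apply: ge0_le_integral => //.
    - by move=> z _; rewrite lee_fin sqr_ge0.
    - apply: emeasurable_funD => //; apply: emeasurable_funM => //.
      by apply/measurable_EFinP; apply: measurable_funTS; exact: measurable_funX.
    - move=> z [t _ tz]; rewrite -EFinM -EFinD lee_fin.
      have := hC0 f w y t Df; rewrite wy tz => hxz.
      have : 0 <= ((f x - f z) - f z) ^+ 2 by exact: sqr_ge0.
      by rewrite /A; nra.
  rewrite ge0_integralD//; last 2 first.
  - by move=> z _; rewrite mule_ge0// lee_fin sqr_ge0.
  - apply: emeasurable_funM => //.
    by apply/measurable_EFinP; apply: measurable_funTS; exact: measurable_funX.
  rewrite integral_cst// leeD2l// ge0_integralZl_EFin//; last 2 first.
  - by move=> z _; rewrite lee_fin sqr_ge0.
  - by apply/measurable_EFinP; apply: measurable_funTS; exact: measurable_funX.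
  rewrite lee_wpmul2l//; apply: ge0_subset_integral => //.
  - by apply/measurable_EFinP; exact: measurable_funX.
  - by move=> z _; rewrite lee_fin sqr_ge0.
have hm : m^-1 <= rm `^ (- dH) * (rho * h ^- 2).
  have -> : rho * h ^- 2 = rho `^ (- dH).
    rewrite -powR_invn ?(ltW h0)// /rho -powRD; last by apply/implyP => _; rewrite gt_eqF.
    rewrite -powRrM; congr (_ `^ _); rewrite dlE; field.
    by rewrite gt_eqF// ltr_wpDl// ltW.
  rewrite -powRM ?(ltW rm0) ?(ltW rho0)// powRN lef_pV2 ?posrE// ?powR_gt0 ?mulr_gt0//.
  by apply: ge0_ler_powR; rewrite ?nnegrE ?(ltW dH0) ?(ltW rw0) ?mulr_ge0 ?(ltW rm0) ?(ltW rho0).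
have : f x ^+ 2 <= A + 2 * N * m^-1.
  by rewrite -(ler_pM2r m0) [leRHS]mulrDl divfK ?gt_eqF.
move/le_trans; apply.
have e1 : A <= 2 * C0 * rho * Ediag f.
  by rewrite /A ler_wpM2r// ler_pM2l// mulr_gt0.
have e2 : 2 * N * m^-1 <= 2 * rm `^ (- dH) * (rho * h ^- 2) * N.
  have -> : 2 * rm `^ (- dH) * (rho * h ^- 2) * N =
    2 * N * (rm `^ (- dH) * (rho * h ^- 2)) by ring.
  by rewrite ler_wpM2l// mulr_ge0.
have p0 : 0 <= rm `^ (- dH) by exact: powR_ge0.
have h2 : 0 <= h ^- 2 by rewrite invr_ge0 exprn_ge0// ltW.
have e3 : 0 <= 2 * C0 * (rho * h ^- 2) * N by rewrite !mulr_ge0// ltW.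
have e4 : 0 <= 2 * rm `^ (- dH) * rho * Ediag f by rewrite !mulr_ge0// ltW.
have -> : (2 * C0 + 2 * rm `^ (- dH)) * rho * (Ediag f + h ^- 2 * N) =
  2 * C0 * rho * Ediag f + 2 * rm `^ (- dH) * (rho * h ^- 2) * N +
  2 * C0 * (rho * h ^- 2) * N + 2 * rm `^ (- dH) * rho * Ediag f by ring.
by lra.
Qed.

Lemma resolvent_bound dH : hausdorff_exponent r dH -> self_similar_measure psi r dH mu ->
  exists2 C : R, 0 < C & forall x h n, 0 < h <= 1 ->
    \sum_(k < n) phi k x ^+ 2 / (h ^- 2 + lam k) <=
    C * h `^ (2 * (1 - spectral_dimension dH / 2)).
Proof.
move=> hd hmu; have [C C0 hC] := value_bound hd hmu; exists C => // x h n h01.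
have h0 : 0 < h by case/andP : h01.
have := @bessel 1 0 (C * h `^ (2 * (1 - spectral_dimension dH / 2))) (h ^- 2) x x n.
under eq_bigr do rewrite mul1r mul0r addr0.
apply; first by rewrite invr_gt0 exprn_gt0.
  by rewrite mulr_ge0 ?powR_ge0// ltW.
by move=> f Df; rewrite mul1r mul0r addr0; exact: hC.
Qed.

End Bessel.

(** * Gaussian tails of the increments *)

Section Oscillator.
Context {R : realType}.
Variables (beta lam : R) (v : R -> R).
Hypothesis beta0 : 0 <= beta.
Hypothesis hv : damped_oscillator beta lam v.

Lemma within_ge0_itv (f : R -> R) (a b : R) : 0 <= a ->
  {within [set t : R | 0 <= t], continuous f} -> {within `[a, b], continuous f}.
Proof.
move=> a0; apply: continuous_subspaceW => t /=; rewrite in_itv/= => /andP[h _].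
exact: le_trans h.
Qed.

Lemma oscillator_energy : exists v' : R -> R,
  [/\ {within [set t : R | 0 <= t], continuous v},
      forall t : R, 0 < t -> is_derive t (1 : R) v (v' t) &
      forall t, 0 <= t -> v' t ^+ 2 + lam * v t ^+ 2 <= 1].
Proof.
have [v' [cv cv' [v0 v'0] dv dv']] := hv.
exists v'; split => // t; rewrite le_eqVlt => /predU1P[<-|t0].
  by rewrite v0 v'0 expr0n mulr0 addr0 expr1n.
pose e (t : R) := v' t ^+ 2 + lam * v t ^+ 2.
pose de (t : R) := - (4 * beta * v' t ^+ 2).
have de_ x : x \in `]0, t[ -> is_derive x (1 : R) e (de x).
  rewrite in_itv/= => /andP[x0 _].
  have h1 := dv x x0; have h2 := dv' x x0.
  have h3 : is_derive x (1 : R) e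
     (v' x *: (- (2 * beta * v' x) - lam * v x) + v' x *: (- (2 * beta * v' x) - lam * v x) +
      (lam *: (v x *: v' x + v x *: v' x))).
    rewrite /e; under eq_fun do rewrite !expr2.
    apply: is_deriveD; exact: is_deriveZ.
  apply: is_derive_eq h3 _; rewrite /de /GRing.scale/=; ring.
have ce : {within `[0, t], continuous e}.
  have c1 := @within_ge0_itv v 0 t (lexx 0) cv; have c2 := @within_ge0_itv v' 0 t (lexx 0) cv'.
  move=> x; apply: cvgD; first by apply: cvgM; exact: c2.
  by apply: cvgM; [exact: cvg_cst|apply: cvgM; exact: c1].
have [c _ ec] := MVT t0 de_ ce.
have : e t <= e 0.
  rewrite -subr_le0 ec subr0 mulNr oppr_le0 mulr_ge0 ?(ltW t0)//.
  by rewrite mulr_ge0 ?sqr_ge0// mulr_ge0.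
by rewrite /e v0 v'0 expr0n mulr0 addr0 expr1n.
Qed.

Lemma oscillator_bounded t : 0 <= t -> lam * v t ^+ 2 <= 1.
Proof.
by move=> t0; have [v' [_ _ /(_ t t0)]] := oscillator_energy; have := sqr_ge0 (v' t); lra.
Qed.

Lemma oscillator_lipschitz s t : 0 <= lam -> 0 <= s -> 0 <= t -> `|v t - v s| <= `|t - s|.
Proof.
move=> lam0; wlog st : s t / s < t.
  move=> H s0 t0; case: (ltgtP s t) => [st|ts|->]; first exact: H.
    by rewrite distrC (distrC t); exact: H.
  by rewrite !subrr.
move=> s0 t0; have [v' [cv dv ev]] := oscillator_energy.
have dv1 x : x \in `]s, t[ -> is_derive x (1 : R) v (v' x).
  by rewrite in_itv/= => /andP[sx _]; apply: dv; exact: le_lt_trans sx.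
have [c] := MVT st dv1 (@within_ge0_itv v s t s0 cv).
rewrite in_itv/= => /andP[sc _] ->; rewrite normrM ler_piMl//.
have := ev c (le_trans s0 (ltW sc)).
have : 0 <= lam * v c ^+ 2 by rewrite mulr_ge0// sqr_ge0.
rewrite -(@ler_pXn2r _ 2) ?nnegrE// real_normK ?num_real// expr1n; lra.
Qed.

Lemma oscillator_continuous : {within [set t : R | 0 <= t], continuous v}.
Proof. by case: hv => v' []. Qed.

Lemma oscillator0 : v 0 = 0.
Proof. by case: hv => v' [_ _ []]. Qed.

End Oscillator.

Section HasIntegral.
Context {d} {T : measurableType d} {R : realType}.
Variables (mu : {measure set T -> \bar R}) (D : set T).
Hypothesis mD : measurable D.

Definition has_integral (f : T -> R) (v : R) : Prop :=
  mu.-integrable D (EFin \o f) /\ (\int[mu]_(x in D) (f x)%:E = v%:E)%E.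

Lemma has_integralZ c f v : has_integral f v -> has_integral (fun w => c * f w) (c * v).
Proof.
move=> [If Ef]; split; first by have := integrableZl mD c If; apply: eq_integrable.
under eq_integral do rewrite EFinM.
by rewrite integralZl// Ef.
Qed.

Lemma has_integralD f g v v' : has_integral f v -> has_integral g v' ->
  has_integral (fun w => f w + g w) (v + v').
Proof.
move=> [If Ef] [Ig Eg]; split; first by have := integrableD mD If Ig; apply: eq_integrable.
under eq_integral do rewrite EFinD.
by rewrite integralD// Ef Eg.
Qed.

Lemma has_integral0 : has_integral (fun=> 0) 0.
Proof. by split; [exact: integrable0|rewrite integral0]. Qed.

Lemma has_integral_sum (I : eqType) (s : seq I) (f : I -> T -> R) (v : I -> R) :
  (forall i, i \in s -> has_integral (f i) (v i)) ->
  has_integral (fun w => \sum_(i <- s) f i w) (\sum_(i <- s) v i).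
Proof.
elim: s => [|i s IH] h.
  by rewrite big_nil; under eq_fun do rewrite big_nil; exact: has_integral0.
rewrite big_cons; under eq_fun do rewrite big_cons.
apply: has_integralD; first by apply: h; rewrite mem_head.
by apply: IH => j js; apply: h; rewrite inE js orbT.
Qed.

Lemma has_integralB f g v v' : has_integral f v -> has_integral g v' ->
  has_integral (fun w => f w - g w) (v - v').
Proof.
move=> hf hg; have := has_integralD hf (has_integralZ (-1) hg).
by rewrite mulN1r; under eq_fun do rewrite mulN1r.
Qed.

Lemma has_integral_eq f g v v' : f =1 g -> v = v' -> has_integral f v -> has_integral g v'.
Proof. by move=> /funext -> ->. Qed.

End HasIntegral.

Section StepIntegrals.
Context {d} {Omega : measurableType d} {R : realType}.
Variable P : probability Omega R.
Context {d'} {T : measurableType d'}.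
Variables (mu : probability T R) (W : R -> (T -> R) -> Omega -> R).
Hypothesis hW : cylindrical_wiener P mu W.
Variable phi : nat -> T -> R.
Hypothesis phiL2 : forall k, L2 mu (phi k).
Hypothesis phi_orth : forall k l, L2inner mu (phi k) (phi l) = (k == l)%:R.

Lemma wiener_measurable t f : 0 <= t -> L2 mu f -> measurable_fun setT (W t f).
Proof.
move=> t0 hf; have [mX _] := wiener_gaussian hW (fun _ : 'I_1 => 1) (fun _ => t0) (fun _ => hf).
move: mX; congr measurable_fun; apply/funext => w.
by rewrite big_ord1 mul1r.
Qed.

Lemma wiener_mean s t k l : 0 <= s -> 0 <= t ->
  has_integral P setT (fun w => W s (phi k) w * W t (phi l) w) (Num.min s t * (k == l)%:R).
Proof.
move=> s0 t0.
have sq u j : 0 <= u -> P.-integrable setT (EFin \o (fun w => W u (phi j) w ^+ 2)).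
  move=> u0; apply/integrableP; split.
    by apply/measurable_EFinP/measurable_funX; exact: wiener_measurable.
  under eq_integral do rewrite /= ger0_norm ?sqr_ge0//.
  have := wiener_covariance hW u0 u0 (phiL2 j) (phiL2 j).
  rewrite unlock /=; under eq_integral do rewrite -expr2.
  by move=> ->; rewrite ltry.
split; last first.
  by have := wiener_covariance hW s0 t0 (phiL2 k) (phiL2 l); rewrite unlock phi_orth.
have := integrableD measurableT (sq s k s0) (sq t l t0).
apply: le_integrable => //.
  by apply/measurable_EFinP/measurable_funM; exact: wiener_measurable.
move=> w _ /=; rewrite lee_fin (ger0_norm (addr_ge0 (sqr_ge0 _) (sqr_ge0 _))).
set x := W s _ w; set y := W t _ w.
have h1 := sqr_ge0 (x + y); have h2 := sqr_ge0 (x - y).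
have h3 := sqr_ge0 x; have h4 := sqr_ge0 y.
by rewrite ler_norml; apply/andP; split; nra.
Qed.

(* Length of the intersection of ]a.1, a.2] and ]b.1, b.2], in the form given by the
   covariance min(s, t) of a Brownian motion. *)
Definition overlap (a b : R * R) : R :=
  Num.min a.2 b.2 - Num.min a.2 b.1 - (Num.min a.1 b.2 - Num.min a.1 b.1).

Definition step_ok (T0 : R) (p : seq (R * R * R)) : Prop :=
  forall q, q \in p -> 0 <= q.1.2 <= q.2 /\ q.2 <= T0.

Definition step_inner (p q : seq (R * R * R)) : R :=
  \sum_(a <- p) \sum_(b <- q) a.1.1 * b.1.1 * overlap (a.1.2, a.2) (b.1.2, b.2).

Let B k := fun s => W s (phi k).

Lemma step_mean T0 p q k l : step_ok T0 p -> step_ok T0 q ->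
  has_integral P setT (fun w => step_integral (B k) p w * step_integral (B l) q w)
    ((k == l)%:R * step_inner p q).
Proof.
move=> hp hq.
apply: (@has_integral_eq _ _ _ _ _ (fun w => \sum_(a <- p) \sum_(b <- q)
   a.1.1 * b.1.1 * ((B k a.2 w * B l b.2 w - B k a.2 w * B l b.1.2 w) -
     (B k a.1.2 w * B l b.2 w - B k a.1.2 w * B l b.1.2 w))) _
   (\sum_(a <- p) \sum_(b <- q) a.1.1 * b.1.1 *
     ((k == l)%:R * overlap (a.1.2, a.2) (b.1.2, b.2)))).
- move=> w; rewrite /step_integral mulr_suml; apply: eq_bigr => a _.
  by rewrite mulr_sumr; apply: eq_bigr => b _; ring.
- rewrite /step_inner mulr_sumr; apply: eq_bigr => a _; rewrite mulr_sumr.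
  by apply: eq_bigr => b _; ring.
apply: has_integral_sum => // a /hp[/andP[a0 a1] _];
  apply: has_integral_sum => // b /hq[/andP[b0 b1] _].
apply: has_integralZ => //; rewrite /overlap /= mulrBr !mulrBr ![(k == l)%:R * _]mulrC.
have a2 := le_trans a0 a1; have b2 := le_trans b0 b1.
by apply: has_integralB => //; apply: has_integralB => //; exact: wiener_mean.
Qed.

Lemma step_sum_second_moment T0 n (p : nat -> seq (R * R * R)) :
  (forall k, step_ok T0 (p k)) ->
  ('E_P[(fun w => (\sum_(k < n) step_integral (B k) (p k) w) ^+ 2)%R] =
   (\sum_(k < n) step_inner (p k) (p k))%:E)%E.
Proof.
move=> hp; rewrite unlock /=.
have [_] : has_integral P setT (fun w => \sum_(k < n) \sum_(l < n)
    step_integral (B k) (p k) w * step_integral (B l) (p l) w)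
   (\sum_(k < n) \sum_(l < n) (k == l :> nat)%:R * step_inner (p k) (p l)).
  by apply: has_integral_sum => // k _; apply: has_integral_sum => // l _; exact: step_mean.
have -> : \sum_(k < n) \sum_(l < n) (k == l :> nat)%:R * step_inner (p k) (p l) =
    \sum_(k < n) step_inner (p k) (p k).
  apply: eq_bigr => k _; rewrite (bigD1 k)//= eqxx mul1r big1 ?addr0// => l lk.
  by rewrite (_ : (k == l :> nat) = false) ?mul0r//; apply/negbTE; rewrite eq_sym.
move=> <-; apply: eq_integral => w _; congr (_%:E).
by rewrite expr2 mulr_suml; apply: eq_bigr => k _; rewrite mulr_sumr.
Qed.

Lemma step_sum_gaussian T0 n (p : nat -> seq (R * R * R)) :
  (forall k, step_ok T0 (p k)) ->
  centred_gaussian P (fun w => \sum_(k < n) step_integral (B k) (p k) w).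
Proof.
move=> hp.
pose L : seq (R * R * nat) := flatten [seq flatten
  [seq [:: (q.1.1, q.2, k); (- q.1.1, q.1.2, k)] | q <- p k] | k <- iota 0 n].
have Lge0 : forall x, x \in L -> 0 <= x.1.2.
  move=> x /flattenP[s1 /mapP[k _ ->]] /flattenP[s2 /mapP[q qp ->]].
  have [/andP[q0 q1] _] := hp k q qp.
  by rewrite !inE => /orP[/eqP ->|/eqP ->]//=; exact: le_trans q1.
have := wiener_gaussian hW (n := size L) (fun i => (nth (0, 0, 0%N) L i).1.1)
  (t := fun i => (nth (0, 0, 0%N) L i).1.2) (f := fun i => phi (nth (0, 0, 0%N) L i).2)
  (fun i => Lge0 _ (mem_nth _ (ltn_ord i))) (fun i => phiL2 _).
congr (centred_gaussian P); apply/funext => w.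
rewrite -(big_mkord xpredT (fun i => (nth (0, 0, 0%N) L i).1.1 *
   W (nth (0, 0, 0%N) L i).1.2 (phi (nth (0, 0, 0%N) L i).2) w)).
rewrite -(big_nth (0, 0, 0%N) xpredT (fun x => x.1.1 * W x.1.2 (phi x.2) w)).
rewrite /L big_flatten big_map (_ : iota 0 n = index_iota 0 n) ?big_mkord;
  last by rewrite /index_iota subn0.
apply: eq_bigr => k _; rewrite big_flatten big_map /step_integral.
by apply: eq_bigr => q _; rewrite !big_cons big_nil /= addr0 /B; ring.
Qed.

End StepIntegrals.

Section StepApproximation.
Context {R : realType}.
Notation leb := (@lebesgue_measure R).

Lemma step_integrand_measurable (p : seq (R * R * R)) :
  measurable_fun setT (step_integrand p).
Proof.
rewrite /step_integrand; elim: p => [|q p IH].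
  by under eq_fun do rewrite big_nil; exact: measurable_cst.
under eq_fun do rewrite big_cons.
by apply: measurable_funD => //; apply: measurable_funM => //; exact: measurable_indic.
Qed.

Lemma step_integrand_cat p q (x : R) :
  step_integrand (p ++ q) x = step_integrand p x + step_integrand q x.
Proof. by rewrite /step_integrand big_cat. Qed.

Definition step_scale (c : R) (p : seq (R * R * R)) :=
  [seq (c * q.1.1, q.1.2, q.2) | q <- p].

Lemma step_integrand_scale c p (x : R) :
  step_integrand (step_scale c p) x = c * step_integrand p x.
Proof. by rewrite /step_integrand big_map mulr_sumr; apply: eq_bigr => q _; rewrite mulrA. Qed.

Lemma step_ok_cat (T0 : R) p q : step_ok T0 p -> step_ok T0 q -> step_ok T0 (p ++ q).
Proof. by move=> hp hq x; rewrite mem_cat => /orP[]; [exact: hp|exact: hq]. Qed.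

Lemma step_ok_scale (T0 : R) c p : step_ok T0 p -> step_ok T0 (step_scale c p).
Proof. by move=> hp x /mapP[q qp ->]; have := hp q qp. Qed.

Lemma step_ok_le (T0 T1 : R) p : T0 <= T1 -> step_ok T0 p -> step_ok T1 p.
Proof. by move=> T01 hp x /hp[h1 h2]; split => //; exact: le_trans T01. Qed.

Lemma step_integrand_out (t x : R) p : step_ok t p -> t < x -> step_integrand p x = 0.
Proof.
move=> hp tx; rewrite /step_integrand big_seq big1// => q /hp[_ qt].
rewrite indicE memNset ?mulr0//= in_itv/= => /andP[_ h].
by have := le_trans h qt; rewrite leNgt tx.
Qed.

Lemma overlap_integral (T0 : R) (a b : R * R) :
  0 <= a.1 <= a.2 -> a.2 <= T0 -> 0 <= b.1 <= b.2 -> b.2 <= T0 ->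
  leb.-integrable `[0, T0] (EFin \o (fun x => \1_(`]a.1, a.2]) x * \1_(`]b.1, b.2]) x)) /\
  (\int[leb]_(x in `[0%R, T0]) (\1_(`]a.1, a.2]) x * \1_(`]b.1, b.2]) x)%:E =
   (overlap a b)%:E)%E.
Proof.
case: a b => [a1 a2] [b1 b2] /= /andP[a0 a12] aT /andP[b0 b12] bT.
pose I := `]Num.max a1 b1, Num.min a2 b2].
have e x : \1_(`]a1, a2]) x * \1_(`]b1, b2]) x = \1_([set` I]) x :> R.
  rewrite !indicE -natrM mulnb; congr (_%:R); congr nat_of_bool.
  apply/idP/idP; rewrite !inE /= !in_itv/=.
    by move=> /andP[/set_mem/= + /set_mem/=];
      rewrite !in_itv/= gt_max le_min => /andP[-> ->] /andP[-> ->].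
  by rewrite gt_max le_min => /andP[/andP[h1 h2] /andP[h3 h4]]; apply/andP; split;
    apply/mem_set; rewrite /= in_itv/= ?h1 ?h2 ?h3 ?h4.
have sub : [set` I] `<=` `[0, T0].
  move=> x /=; rewrite !in_itv/= gt_max le_min => /andP[/andP[h1 h2] /andP[h3 h4]].
  by rewrite (le_trans a0 (ltW h1)) (le_trans h3).
have mI : measurable [set` I] by [].
split.
  rewrite (_ : (fun x => _) = \1_[set` I]); last by apply/funext => x; exact: e.
  by apply: (integrableS measurableT) => //; exact: integrable_indic_itv.
under eq_integral do rewrite e.
rewrite integral_indic// setIidl//; transitivity (lebesgue_measure [set` I]); first by [].
rewrite lebesgue_measure_itv/= lte_fin /overlap/= -EFinB.
by case: ifP; move/idP; rewrite ?(negP, =^~ leNgt) => h; congr (_%:E); move: h;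
  rewrite /Num.min /Num.max; do !case: ifP; move=> *; lra.
Qed.

Lemma step_inner_integral (T0 : R) p : step_ok T0 p ->
  (\int[leb]_(x in `[0%R, T0]) ((step_integrand p x) ^+ 2)%:E = (step_inner p p)%:E)%E.
Proof.
move=> hp.
have [] // : has_integral leb `[0, T0] (fun x => (step_integrand p x) ^+ 2) (step_inner p p).
have -> : (fun x : R => (step_integrand p x) ^+ 2) = (fun x : R => \sum_(a <- p) \sum_(b <- p)
  a.1.1 * b.1.1 * (\1_(`]a.1.2, a.2]) x * \1_(`]b.1.2, b.2]) x)).
  apply/funext => x; rewrite expr2 /step_integrand mulr_suml; apply: eq_bigr => a _.
  by rewrite mulr_sumr; apply: eq_bigr => b _; ring.
apply: has_integral_sum => // a /hp[a0 aT]; apply: has_integral_sum => // b /hp[b0 bT].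
by apply: has_integralZ => //; exact: overlap_integral (a.1.2, a.2) (b.1.2, b.2) a0 aT b0 bT.
Qed.

Lemma integral_supported (t T0 : R) (f : R -> \bar R) : t <= T0 ->
  (forall x, t < x -> f x = 0%E) ->
  (\int[leb]_(x in `[0%R, T0]) f x = \int[leb]_(x in `[0%R, t]) f x)%E.
Proof.
move=> tT f0; rewrite integral_mkcond [RHS]integral_mkcond.
apply: eq_integral => x _; rewrite /patch.
case: (boolP (x \in `[0, t]%classic)) => [xt|nxt].
  rewrite mem_set//=; move: xt; rewrite inE /= !in_itv/= => /andP[-> h].
  exact: le_trans tT.
case: ifPn => // xT; apply: f0; move: xT; rewrite inE /= in_itv/= => /andP[x0 _].
rewrite ltNge; apply/negP => xt; move/negP : nxt; apply.
by rewrite inE /= in_itv/= x0 xt.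
Qed.

Lemma step_inner_bound (t s T0 c c' Bd : R) (h g : R -> R) p q :
  t <= T0 -> s <= T0 -> 0 <= T0 ->
  step_ok t p -> step_ok s q ->
  measurable_fun setT h -> measurable_fun setT g ->
  (forall x, t < x -> h x = 0) -> (forall x, s < x -> g x = 0) ->
  (forall x, 0 <= x -> (c * h x + c' * g x) ^+ 2 <= Bd) ->
  ((step_inner (step_scale c p ++ step_scale c' q) (step_scale c p ++ step_scale c' q))%:E <=
    (3 * c ^+ 2)%:E * \int[leb]_(x in `[0%R, t]) ((h x - step_integrand p x) ^+ 2)%:E +
    (3 * c' ^+ 2)%:E * \int[leb]_(x in `[0%R, s]) ((g x - step_integrand q x) ^+ 2)%:E +
    (3 * T0 * Bd)%:E)%E.
Proof.
move=> tT sT T00 hp hq mh mg h0 g0 hB.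
set z := step_scale c p ++ step_scale c' q.
have mp := step_integrand_measurable p; have mq := step_integrand_measurable q.
rewrite -(@step_inner_integral T0); last first.
  by apply: step_ok_cat; apply: step_ok_scale; [exact: step_ok_le hp|exact: step_ok_le hq].
rewrite -(integral_supported tT) => [|x tx]; last first.
  by rewrite h0// (step_integrand_out hp tx) subrr expr0n.
rewrite -(integral_supported sT) => [|x sx]; last first.
  by rewrite g0// (step_integrand_out hq sx) subrr expr0n.
have mD : measurable (`[0, T0]%classic : set R) by [].
have m1 : measurable_fun (`[0,
  T0]%classic : set R) (fun x => ((h x - step_integrand p x) ^+ 2)%:E).
  by apply/measurable_EFinP; apply: measurable_funTS; apply: measurable_funX;
    exact: measurable_funB.
have m2 : measurable_fun (`[0,
  T0]%classic : set R) (fun x => ((g x - step_integrand q x) ^+ 2)%:E).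
  by apply/measurable_EFinP; apply: measurable_funTS; apply: measurable_funX;
    exact: measurable_funB.
have Bd0 : 0 <= Bd by apply: le_trans (hB 0 (lexx 0)); exact: sqr_ge0.
have c0 : 0 <= 3 * c ^+ 2 by rewrite mulr_ge0// sqr_ge0.
have c0' : 0 <= 3 * c' ^+ 2 by rewrite mulr_ge0// sqr_ge0.
have eB : ((3 * T0 * Bd)%:E = \int[leb]_(x in `[0%R, T0]) (3 * Bd)%:E)%E.
  have l0 : lebesgue_measure ([set` `[0, T0]] : set R) = T0%:E.
    rewrite lebesgue_measure_itv/= lte_fin; case: ltP => [T1|T1]; first by rewrite -EFinB subr0.
    by rewrite (_ : T0 = 0)//; apply/eqP; rewrite eq_le T1.
  rewrite integral_cst// [X in (_ * X)%E](_ : _ = T0%:E); last exact: l0.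
  by rewrite -EFinM; congr (_%:E); ring.
rewrite eB -!ge0_integralZl_EFin//; try by move=> x _; rewrite lee_fin sqr_ge0.
rewrite -ge0_integralD//; first last.
- by apply: emeasurable_funM.
- by move=> x _; rewrite mule_ge0// lee_fin sqr_ge0.
- by apply: emeasurable_funM.
- by move=> x _; rewrite mule_ge0// lee_fin sqr_ge0.
rewrite -ge0_integralD//; first last.
- by move=> x _; rewrite lee_fin mulr_ge0.
- by apply: emeasurable_funD; apply: emeasurable_funM.
- by move=> x _; rewrite adde_ge0// mule_ge0// lee_fin sqr_ge0.
apply: ge0_le_integral => //.
- by move=> x _; rewrite lee_fin sqr_ge0.
- by apply/measurable_EFinP; apply: measurable_funTS; apply: measurable_funX;
  exact: step_integrand_measurable.
- by apply: emeasurable_funD => //; apply: emeasurable_funD; apply: emeasurable_funM.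
move=> x; rewrite /= in_itv/= => /andP[x0 _].
rewrite -!EFinM -!EFinD lee_fin step_integrand_cat !step_integrand_scale.
have := hB x x0; set P := step_integrand p x; set Q := step_integrand q x => hb.
set A := c * (h x - P); set B := c' * (g x - Q); set E := c * h x + c' * g x in hb.
have -> : c * P + c' * Q = E - A - B by rewrite /A /B /E; ring.
have -> : 3 * c ^+ 2 * (h x - P) ^+ 2 = 3 * A ^+ 2 by rewrite /A; ring.
have -> : 3 * c' ^+ 2 * (g x - Q) ^+ 2 = 3 * B ^+ 2 by rewrite /B; ring.
have h1 := sqr_ge0 (E + A); have h2 := sqr_ge0 (E + B); have h3 := sqr_ge0 (A - B).
by nra.
Qed.

End StepApproximation.

Section FieldTails.
Context {d} {Omega : measurableType d} {R : realType} {F : pMetricType R}.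
Variables (P : probability Omega R) (mu : probability (borel F) R).
Variables (W : R -> (F -> R) -> Omega -> R).
Variables (lam : nat -> R) (phi : nat -> F -> R) (V : R -> R -> R).
Variables (Y : nat -> R -> Omega -> R) (u : R -> F -> Omega -> R).
Hypothesis hW : cylindrical_wiener P mu W.
Hypothesis phiL2 : forall k, L2 mu (phi k).
Hypothesis phi_orth : forall k l, L2inner mu (phi k) (phi l) = (k == l)%:R.
Hypothesis cV : forall k, {within [set t : R | 0 <= t], continuous (V (lam k))}.
Hypothesis hY : stochastic_convolution P W lam phi V Y.
Hypothesis hu : random_field_solution P phi Y u.

Definition kernel (k : nat) (t r : R) : R := if 0 <= r <= t then V (lam k) (t - r) else 0.

Lemma kernel_measurable k t : measurable_fun setT (kernel k t).
Proof.
have -> : kernel k t = (fun r => V (lam k) (t - r)) \_ `[0, t].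
  apply/funext => r; rewrite /kernel /patch mem_setE in_itv/=.
  by case: ifP.
have mD : measurable ([set` `[0, t]] : set R) by [].
apply/(measurable_restrictT _ mD).
have mI : measurable [set x : R | 0 <= x].
  by rewrite (_ : [set x : R | 0 <= x] = [set` `[0, +oo[])//; apply/seteqP; split => x /=;
    rewrite in_itv/= andbT.
have := @measurable_comp _ _ _ R R R [set x : R | 0 <=
  x] (V (lam k)) [set` `[0, t]] (fun r => t - r) mI; apply.
- by move=> _ /= [x + <-]; rewrite /= in_itv/= subr_ge0 => /andP[].
- exact: (subspace_continuous_measurable_fun mI (@cV k)).
- by apply: measurable_funB.
Qed.

Lemma kernel_out k t r : t < r -> kernel k t r = 0.
Proof. by move=> tr; rewrite /kernel leNgt [r <= t]leNgt tr andbF. Qed.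

Let B k := fun s => W s (phi k).

Lemma step_integral_measurable T0 k p : step_ok T0 p ->
  measurable_fun setT (step_integral (B k) p).
Proof.
move=> hp; rewrite /step_integral.
have : forall q, q \in p -> 0 <= q.1.2 <= q.2 by move=> q /hp[].
elim: p {hp} => [|q p IH] hp.
  by under eq_fun do rewrite big_nil; exact: measurable_cst.
under eq_fun do rewrite big_cons.
apply: measurable_funD; last by apply: IH => x xp; apply: hp; rewrite inE xp orbT.
have /andP[q0 q1] : 0 <= q.1.2 <= q.2 by apply: hp; rewrite mem_head.
apply: measurable_funM => //; apply: measurable_funB; apply: (wiener_measurable hW) => //.
exact: le_trans q1.
Qed.

Lemma step_integral_cat_scale k c c' p q w :
  step_integral (B k) (step_scale c p ++ step_scale c' q) w =
  c * step_integral (B k) p w + c' * step_integral (B k) q w.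
Proof.
rewrite /step_integral big_cat/= !big_map !mulr_sumr.
by congr (_ + _); apply: eq_bigr => x _; rewrite mulrA.
Qed.

Lemma convolution_sum_tail (t s T0 : R) (c c' Bd : nat -> R) n (V0 l : R) m :
  0 <= t <= T0 -> 0 <= s <= T0 -> 0 < l ->
  (forall k r, 0 <= r -> (c k * kernel k t r + c' k * kernel k s r) ^+ 2 <= Bd k) ->
  3 * T0 * \sum_(k < n) Bd k < V0 ->
  (P [set w | (2 * l < `|\sum_(k < n) (c k * Y k t w + c' k * Y k s w)|)%R] <=
    (gauss_const m * (8 * V0 / l ^+ 2) ^+ m)%:E)%E.
Proof.
move=> /andP[t0 tT] /andP[s0 sT] l0 hB hV0.
have T00 : 0 <= T0 by exact: le_trans tT.
have /choice[p hp] : forall k, exists p : nat -> seq (R * R * R),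
  [/\ forall j, step_ok t (p j),
     (fun j => \int[lebesgue_measure]_(r in `[0%R,
       t]) ((kernel k t r - step_integrand (p j) r) ^+ 2)%R%:E)%E @ \oo --> 0%E &
     L2_limit P (fun j => step_integral (B k) (p j)) (Y k t)].
  move=> k; have [_ [p [h1 h2 h3]]] := hY k t0; exists p; split => //.
  apply: cvg_trans h2; apply: near_eq_cvg; apply: nearW => j.
  apply: eq_integral => r; rewrite inE /= in_itv/= => hr.
  by rewrite /kernel hr.
have /choice[q hq] : forall k, exists p : nat -> seq (R * R * R),
  [/\ forall j, step_ok s (p j),
     (fun j => \int[lebesgue_measure]_(r in `[0%R,
       s]) ((kernel k s r - step_integrand (p j) r) ^+ 2)%R%:E)%E @ \oo --> 0%E &
     L2_limit P (fun j => step_integral (B k) (p j)) (Y k s)].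
  move=> k; have [_ [p' [h1 h2 h3]]] := hY k s0; exists p'; split => //.
  apply: cvg_trans h2; apply: near_eq_cvg; apply: nearW => j.
  apply: eq_integral => r; rewrite inE /= in_itv/= => hr.
  by rewrite /kernel hr.
pose z j k := step_scale (c k) (p k j) ++ step_scale (c' k) (q k j).
have okz j k : step_ok T0 (z j k).
  apply: step_ok_cat; apply: step_ok_scale; [apply: step_ok_le tT _|apply: step_ok_le sT _].
    by have [] := hp k.
  by have [] := hq k.
have bound1 k e : 0 < e -> exists N, forall j, (N <= j)%N ->
    step_inner (z j k) (z j k) <= 3 * T0 * Bd k + e.
  move=> e0; pose C := 3 * c k ^+ 2 + 3 * c' k ^+ 2 + 1.
  have h1 : 0 <= c k ^+ 2 by exact: sqr_ge0.
  have h2 : 0 <= c' k ^+ 2 by exact: sqr_ge0.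
  have C0 : 0 < C by rewrite /C; lra.
  have eC : 0 < e / C by rewrite divr_gt0.
  have [hp1 hp2 _] := hp k; have [hq1 hq2 _] := hq k.
  have [N1 HN1] := cvge0_near_le hp2 eC; have [N2 HN2] := cvge0_near_le hq2 eC.
  exists (maxn N1 N2) => j; rewrite geq_max => /andP[j1 j2].
  rewrite -lee_fin.
  apply: le_trans (step_inner_bound tT sT T00 (hp1 j) (hq1 j) (kernel_measurable k t)
    (kernel_measurable k s) (@kernel_out k t) (@kernel_out k s) (hB k)) _.
  apply: (@le_trans _ _ ((3 * c k ^+ 2)%:E * (e / C)%:E + (3 * c' k ^+ 2)%:E * (e / C)%:E +
    (3 * T0 * Bd k)%:E)%E).
    apply: leeD => //; apply: leeD; apply: lee_wpmul2l; do ?[by rewrite lee_fin mulr_ge0].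
      exact: HN1.
    exact: HN2.
  have h3 : 3 * c k ^+ 2 * (e / C) + 3 * c' k ^+ 2 * (e / C) <= e.
    by rewrite -mulrDl mulrA ler_pdivrMr// mulrC ler_pM2l// /C; lra.
  by rewrite -!EFinM -!EFinD lee_fin; lra.
have bound : forall n V0, 3 * T0 * \sum_(k < n) Bd k < V0 ->
    exists N, forall j, (N <= j)%N -> \sum_(k < n) step_inner (z j k) (z j k) <= V0.
  elim=> [|n' IH] V1.
    by rewrite big_ord0 mulr0 => hV; exists 0%N => j _; rewrite big_ord0 ltW.
  rewrite big_ord_recr/= mulrDr => hV.
  pose e := (V1 - (3 * T0 * \sum_(k < n') Bd k + 3 * T0 * Bd n')) / 2.
  have e0 : 0 < e by rewrite /e divr_gt0// subr_gt0.
  have [N1 H1] := IH (3 * T0 * \sum_(k < n') Bd k + e) ltac:(by rewrite ltrDl).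
  have [N2 H2] := bound1 n' e e0.
  exists (maxn N1 N2) => j; rewrite geq_max => /andP[j1 j2]; rewrite big_ord_recr/=.
  have := H1 j j1; have := H2 j j2; rewrite /e; lra.
pose Z j w := \sum_(k < n) step_integral (B k) (z j k) w.
have cvgZ : cvg_in_prob P Z (fun w => \sum_(k < n) (c k * Y k t w + c' k * Y k s w)).
  have -> : Z = (fun j w => \sum_(k < n) (c k * step_integral (B k) (p k j) w +
    c' k * step_integral (B k) (q k j) w)).
    by apply/funext => j; apply/funext => w; apply: eq_bigr => k _;
      exact: step_integral_cat_scale.
  apply: (@cvg_in_prob_sum _ _ _ P _ _ (fun (k : 'I_n) j w => c k * step_integral (B k) (p k j)
    w + c' k * step_integral (B k) (q k j) w) (fun (k : 'I_n) w => c k * Y k t w +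
    c' k * Y k s w)) => k.
  have [hp1 _ hp3] := hp k; have [hq1 _ hq3] := hq k.
  have [mt _] := hY k t0; have [ms _] := hY k s0.
  apply: cvg_in_probD; apply: cvg_in_probZ; apply: L2_limit_in_prob => // j.
    exact: step_integral_measurable (hp1 j).
  exact: step_integral_measurable (hq1 j).
apply: (tail_cvg_in_prob cvgZ l0) => e e0.
have [N HN] := bound n V0 hV0; exists N => j Nj.
have := step_sum_second_moment hW phiL2 phi_orth n (okz j).
have := step_sum_gaussian hW phiL2 n (okz j) => gZ eZ.
apply: (le_trans (centred_gaussian_tail m (v := V0) gZ l0 _)).
  by rewrite [X in (X <= _)%E]eZ lee_fin; exact: HN.
by rewrite lee_fin lerDl ltW.
Qed.

Lemma partial_sum_in_prob t x : 0 <= t ->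
  cvg_in_prob P (fun n w => partial_sum phi Y t n w x) (u t x).
Proof.
move=> t0; have [mu_ lu] := hu x t0; apply: L2_limit_in_prob => // n.
rewrite /partial_sum; apply: measurable_sum => k.
by apply: measurable_funM => //; have [] := hY k t0.
Qed.

Lemma field_tail (t s T0 : R) (x y : F) (Bd : nat -> R) (V0 l : R) m :
  0 <= t <= T0 -> 0 <= s <= T0 -> 0 < l ->
  (forall k r, 0 <= r -> (phi k x * kernel k t r - phi k y * kernel k s r) ^+ 2 <= Bd k) ->
  (forall n, 3 * T0 * \sum_(k < n) Bd k <= V0) ->
  (P [set w | (l < `|u t x w - u s y w|)%R] <=
    (gauss_const m * (128 * V0 / l ^+ 2) ^+ m)%:E)%E.
Proof.
move=> tT sT l0 hB hV.
have [t0 s0] : 0 <= t /\ 0 <= s by case/andP: tT; case/andP: sT.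
have l4 : 0 < l / 4 by rewrite divr_gt0.
have cv := cvg_in_probD (partial_sum_in_prob x t0) (cvg_in_probZ (-1) (partial_sum_in_prob y s0)).
apply/lee_addgt0Pr => e e0.
have [v v0 hv] : exists2 v : R, 0 < v & gauss_const m * (8 * (V0 + v) / (l / 4) ^+ 2) ^+ m <=
    gauss_const m * (128 * V0 / l ^+ 2) ^+ m + e.
  pose f (v : R) := gauss_const m * (8 * (V0 + v) / (l / 4) ^+ 2) ^+ m.
  have f0 : f 0 = gauss_const m * (128 * V0 / l ^+ 2) ^+ m.
    by rewrite /f; congr (_ * _ ^+ _); field; rewrite gt_eqF.
  have fc : {for 0, continuous f}.
    apply: continuousM; first exact: cst_continuous.
    apply: (continuous_comp (g := fun z : R => z ^+ m)); last exact: exprn_continuous.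
    apply: continuousM; last exact: cst_continuous.
    apply: continuousM; first exact: cst_continuous.
    by apply: continuousD; [exact: cst_continuous|exact: cvg_id].
  move/cvgrPdist_lt : fc => /(_ e e0) [v /= v0 hv].
  exists (v / 2); first by rewrite divr_gt0.
  have h : `|f 0 - f (v / 2)| < e.
    by apply: hv; rewrite /ball_/= sub0r normrN gtr0_norm ?divr_gt0// ltr_pdivrMr// ltr_pMr//
      ltr1n.
  rewrite -f0 -/(f (v / 2)).
  by have := ler_norm (- (f 0 - f (v / 2))); rewrite normrN; lra.
apply: (@le_trans _ _ (gauss_const m * (8 * (V0 + v) / (l / 4) ^+ 2) ^+ m)%:E); last first.
  by rewrite -EFinD lee_fin.
have -> : [set w | l < `|u t x w - u s y w|] =
  [set w | 2 * (2 * (l / 4)) < `|u t x w + (-1) * u s y w|].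
  by apply/funext => w /=; rewrite mulN1r (_ : 2 * (2 * (l / 4)) = l)//; field.
apply: (tail_cvg_in_prob cv); first by rewrite mulr_gt0.
move=> e' e'0; exists 0%N => n _.
have := @convolution_sum_tail t s T0 (fun k => phi k x) (fun k => - phi k y) Bd n (V0 +
  v) (l / 4) m tT sT l4.
move=> H; apply: le_trans (le_trans _ (H _ _)) _.
- have e2 w : partial_sum phi Y t n w x + -1 * partial_sum phi Y s n w y =
      \sum_(k < n) (phi k x * Y k t w + - phi k y * Y k s w).
    by rewrite /partial_sum mulr_sumr -big_split; apply: eq_bigr => k _ /=; ring.
  by under eq_set do rewrite e2.
- by move=> k r r0; rewrite mulNr; exact: hB.
- by apply: le_lt_trans (hV n) _; rewrite ltrDl.
- by rewrite lee_fin lerDl ltW.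
Qed.

Variables (dl Cr : R) (Rst : F -> F -> R).
Hypothesis lam0 : forall k, 0 <= lam k.
Hypothesis V0 : forall k, V (lam k) 0 = 0.
Hypothesis Vbounded : forall k t, 0 <= t -> lam k * V (lam k) t ^+ 2 <= 1.
Hypothesis Vlip : forall k s t, 0 <= s -> 0 <= t -> `|V (lam k) t - V (lam k) s| <= `|t - s|.
Hypothesis hRst : forall x y n, \sum_(k < n) (phi k x - phi k y) ^+ 2 / (1 + lam k) <= Rst x y.
Hypothesis dl0 : 0 < dl.
Hypothesis Cr0 : 0 < Cr.
Hypothesis hres : forall x h n, 0 < h <= 1 ->
  \sum_(k < n) phi k x ^+ 2 / (h ^- 2 + lam k) <= Cr * h `^ (2 * dl).

Lemma spatial_tail T0 : 0 <= T0 -> exists2 A : R, 0 <= A & forall t x y l m,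
  0 <= t <= T0 -> 0 < l ->
  (P [set w | (l < `|u t x w - u t y w|)%R] <=
    (gauss_const m * (A * Rst x y / l ^+ 2) ^+ m)%:E)%E.
Proof.
move=> T00; exists (128 * (3 * T0 * (1 + T0 ^+ 2))).
  by rewrite !mulr_ge0// addr_ge0// sqr_ge0.
move=> t x y l m tT l0; rewrite -[128 * _ * _]mulrA.
apply: (@field_tail t t T0 x y (fun k => (1 + T0 ^+ 2) * ((phi k x - phi k y) ^+ 2 / (1 +
  lam k)))) => //.
  move=> k r r0; rewrite -mulrBl exprMn.
  have L0 : 0 < 1 + lam k by rewrite ltr_wpDr.
  rewrite [leRHS]mulrCA ler_wpM2l ?sqr_ge0// ler_pdivlMr// /kernel r0/=.
  case: ifP => rt; last by rewrite expr0n mul0r addr_ge0// sqr_ge0.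
  have tr0 : 0 <= t - r by rewrite subr_ge0.
  have := Vbounded k tr0; have := Vlip k (lexx 0) tr0; rewrite V0 !subr0 (ger0_norm tr0).
  set v := V _ _ => h1 h2.
  have : v ^+ 2 <= T0 ^+ 2.
    rewrite -real_normK ?num_real// lerXn2r ?nnegrE//; apply: le_trans h1 _.
    by case/andP: tT => _ tT; lra.
  by lra.
move=> n; rewrite -mulr_sumr -!mulrA ler_wpM2l// ler_wpM2l// ler_wpM2l ?addr_ge0 ?sqr_ge0//.
Qed.

(* With h of order |t - s|, the kernels at t and s differ by at most |t - s| and their
   difference squared is at most 4 / lam_k; both bounds together give O(1 / (h^-2 + lam_k)). *)
Lemma temporal_tail T0 : 0 <= T0 -> exists2 A : R, 0 <= A & forall t s x l m,
  0 <= t <= T0 -> 0 <= s <= T0 -> 0 < l ->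
  (P [set w | (l < `|u t x w - u s x w|)%R] <=
    (gauss_const m * (A * `|t - s| `^ (2 * dl) / l ^+ 2) ^+ m)%:E)%E.
Proof.
move=> T00; pose T1 := T0 + 1; have T10 : 0 < T1 by rewrite ltr_wpDl.
exists (128 * (3 * T0 * ((T1 ^+ 2 + 4) * Cr))).
  by rewrite !mulr_ge0 ?(ltW Cr0)// addr_ge0// sqr_ge0.
move=> t s x l m tT sT l0; rewrite -[128 * _ * _]mulrA.
have [ts|ts] := eqVneq t s.
  rewrite ts subrr normr0 powR0 ?mulf_neq0 ?gt_eqF// !mulr0.
  apply: le_trans (_ : (0%:E <= _)%E).
    rewrite (_ : [set w | _] = set0) ?measure0//.
    by apply/seteqP; split => w //=; rewrite subrr normr0 ltNge (ltW l0).
  by rewrite lee_fin mulr_ge0 ?gauss_const_ge0// exprn_ge0// mul0r.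
have tsn : 0 < `|t - s| by rewrite normr_gt0 subr_eq0.
pose h := `|t - s| / T1.
have h0 : 0 < h by rewrite divr_gt0.
have tsT1 : `|t - s| <= T1.
  case/andP: tT => ? ?; case/andP: sT => ? ?; rewrite /T1 ler_norml; apply/andP; split; lra.
have h1 : h <= 1 by rewrite ler_pdivrMr// mul1r.
have hle : h <= `|t - s| by rewrite ler_pdivrMr// ler_pMr// /T1 lerDr.
apply: (@field_tail t s T0 x x (fun k => (T1 ^+ 2 + 4) * (phi k x ^+ 2 / (h ^- 2 +
  lam k)))) => //.
  move=> k r r0; rewrite -mulrBr exprMn.
  have h2 : 0 < h ^- 2 by rewrite invr_gt0 exprn_gt0.
  have L0 : 0 < h ^- 2 + lam k by rewrite ltr_wpDr.
  rewrite [leRHS]mulrCA ler_wpM2l ?sqr_ge0// ler_pdivlMr// /kernel r0/=.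
  set D := _ - _.
  have [hD1 hD2] : `|D| <= `|t - s| /\ lam k * D ^+ 2 <= 4.
    rewrite /D; case: ifPn => rt; case: ifPn => rs.
    - have tr0 : 0 <= t - r by rewrite subr_ge0.
      have sr0 : 0 <= s - r by rewrite subr_ge0.
      split; first by apply: le_trans (Vlip k sr0 tr0) _;
        rewrite (_ : t - r - (s - r) = t - s)//; ring.
      have := Vbounded k tr0; have := Vbounded k sr0; set a1 := V _ _; set a2 := V _ _ => q1 q2.
      have : lam k * (a2 - a1) ^+ 2 <= lam k * (2 * a2 ^+ 2 + 2 * a1 ^+ 2).
        by rewrite ler_wpM2l//; have := sqr_ge0 (a2 + a1); lra.
      by lra.
    - have tr0 : 0 <= t - r by rewrite subr_ge0.
      rewrite subr0; split; last by apply: le_trans (Vbounded k tr0) _; rewrite ler1n.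
      have := Vlip k (lexx 0) tr0; rewrite V0 !subr0 => /le_trans; apply.
      move: rs; rewrite -ltNge => sr; rewrite !ger0_norm//; lra.
    - have sr0 : 0 <= s - r by rewrite subr_ge0.
      rewrite sub0r normrN sqrrN; split; last by apply: le_trans (Vbounded k sr0) _;
        rewrite ler1n.
      have := Vlip k (lexx 0) sr0; rewrite V0 !subr0 => /le_trans; apply.
      move: rt; rewrite -ltNge => tr; rewrite (ger0_norm sr0) distrC ger0_norm; lra.
    - by rewrite subrr normr0 expr0n mulr0.
  have : h ^- 2 * D ^+ 2 <= T1 ^+ 2.
    rewrite -[D ^+ 2]real_normK ?num_real// mulrC ler_pdivrMr ?exprn_gt0//.
    have hh : 0 <= T1 * h by rewrite mulr_ge0 ?(ltW T10) ?(ltW h0).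
    rewrite -exprMn lerXn2r ?nnegrE//.
    by apply: le_trans hD1 _; rewrite /h mulrC divfK// gt_eqF.
  by lra.
move=> n; rewrite -mulr_sumr -!mulrA ler_wpM2l// ler_wpM2l// ler_wpM2l ?addr_ge0 ?sqr_ge0//.
apply: (le_trans (hres x n _)); first by rewrite h0.
rewrite ler_pM2l//; apply: ge0_ler_powR; rewrite ?nnegrE ?(ltW h0)//.
by rewrite mulr_ge0// ltW.
Qed.

End FieldTails.

(** * Random variables with values in the space of square-integrable functions *)

Section L2RandomVariables.
Context {d} {T : measurableType d} {R : realType}.
Variable mu : probability T R.
Context {d'} {Omega : measurableType d'}.

Lemma L2dist_sqr (f g : T -> R) :
  (L2dist mu f g `^ 2 = \int[mu]_x ((f x - g x) ^+ 2)%:E)%E.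
Proof. exact: Lnorm2_sqr. Qed.

Lemma L2distC (f g : T -> R) : L2dist mu f g = L2dist mu g f.
Proof.
rewrite /L2dist -Lnorm_abse -[RHS]Lnorm_abse; apply: eq_Lnorm => x /=.
by rewrite distrC.
Qed.

Lemma L2dist_triangle (f g h : T -> R) : L2 mu f -> L2 mu g -> L2 mu h ->
  (L2dist mu f h <= L2dist mu f g + L2dist mu g h)%E.
Proof.
move=> /L2_measurable mf /L2_measurable mg /L2_measurable mh; rewrite /L2dist.
have -> : EFin \o (f \- h)%R = EFin \o ((f \- g) \+ (g \- h))%R.
  by apply/funext => x /=; congr (_%:E); ring.
by apply: minkowski_EFin; rewrite ?ler1n//; exact: measurable_funB.
Qed.

Lemma L2dist_ge0 (f g : T -> R) : (0 <= L2dist mu f g)%E.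
Proof. exact: Lnorm_ge0. Qed.

Lemma L2dist_ltP (f g : T -> R) (e : R) : 0 < e ->
  (L2dist mu f g < e%:E)%E = (\int[mu]_x ((f x - g x) ^+ 2)%:E < (e ^+ 2)%:E)%E.
Proof.
move=> e0; rewrite -L2dist_sqr -powR_mulrn ?(ltW e0)// -poweR_EFin.
have := L2dist_ge0 f g; case: (L2dist mu f g) => [q| |] //=.
rewrite !lte_fin !lee_fin => q0; rewrite !powR_mulrn ?(ltW e0)//.
  by rewrite ltr_pXn2r// nnegrE// ltW.
by rewrite pnatr_eq0.
Qed.

Definition measurable_balls (X : Omega -> T -> R) : Prop :=
  forall g (e : R), L2 mu g -> 0 < e -> measurable [set w | (L2dist mu (X w) g < e%:E)%E].

Lemma joint_measurable_balls (Z : Omega * T -> R) : measurable_fun setT Z ->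
  measurable_balls (fun w x => Z (w, x)).
Proof.
move=> mZ g e /L2_measurable mg e0.
pose f (p : Omega * T) := ((Z p - g p.2) ^+ 2)%:E : \bar R.
have mf : measurable_fun setT f.
  apply/measurable_EFinP; apply: measurable_funX; apply: measurable_funB => //.
  exact: (measurableT_comp mg measurable_snd).
have f0 p : (0 <= f p)%E by rewrite lee_fin sqr_ge0.
have mF := measurable_fun_fubini_tonelli_F (m2 := mu) f mf f0.
have := emeasurable_fun_infty_o measurableT mF (e ^+ 2)%:E.
rewrite setTI; congr measurable; apply/seteqP; split => w /=; by rewrite L2dist_ltP.
Qed.

Variable phi : nat -> T -> R.
Hypothesis hphi : L2_orthonormal_basis mu phi.

Let phiL2 k : L2 mu (phi k). Proof. by case: hphi. Qed.

Lemma orthonormal_sum_norm (c : nat -> R) n :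
  (\int[mu]_x ((\sum_(k < n) c k * phi k x) ^+ 2)%:E = (\sum_(k < n) c k ^+ 2)%:E)%E.
Proof.
have hL := L2_sum c n phiL2; rewrite -L2inner_sqr//; congr (_%:E).
rewrite L2inner_sum//; apply: eq_bigr => k _; rewrite L2innerC L2inner_sum//.
rewrite (bigD1 k)//= big1 => [|i ik].
  by case: hphi => _ -> _; rewrite eqxx mulr1 addr0 expr2.
case: hphi => _ -> _; rewrite (_ : (i == k :> nat) = false) ?mulr0//.
by apply/negbTE.
Qed.

Definition rational_combination (q : seq rat) : T -> R :=
  fun x => \sum_(k < size q) ratr (nth 0 q k) * phi k x.

Lemma rational_combination_L2 q : L2 mu (rational_combination q).
Proof. exact: (L2_sum (fun k => ratr (nth 0 q k))). Qed.

Lemma rational_combination_dense f (e : R) : L2 mu f -> 0 < e ->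
  exists q, (L2dist mu f (rational_combination q) < e%:E)%E.
Proof.
move=> hf e0; have e2 : 0 < e / 2 by rewrite divr_gt0.
have [_ _ /(_ f hf) hcv] := hphi.
have [N HN] := cvge0_near_le hcv (divr_gt0 e2 (ltr0Sn R 1)).
set c := fun k => L2inner mu f (phi k).
pose S x := \sum_(k < N) c k * phi k x.
have SL2 : L2 mu S by exact: L2_sum.
have h1 : (L2dist mu f S <= (e / 2 / 2)%:E)%E by exact: HN.
pose dl := e / 2 / N.+1%:R.
have dl0 : 0 < dl by rewrite divr_gt0.
have /choice[q hq] : forall k, exists q : rat, `|c k - ratr q| < dl.
  move=> k; have [q] := @rat_in_itvoo R (c k - dl) (c k + dl) ltac:(lra).
  rewrite in_itv/= => /andP[q1 q2]; exists q; rewrite ltr_norml; lra.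
exists (mkseq q N).
apply: (@le_lt_trans _ _ (L2dist mu f S + L2dist mu S (rational_combination (mkseq q N)))%E).
  by apply: L2dist_triangle => //; exact: rational_combination_L2.
have h2 : (L2dist mu S (rational_combination (mkseq q N)) < (e / 2)%:E)%E.
  rewrite L2dist_ltP//.
  have -> : (fun x => ((S x - rational_combination (mkseq q N) x) ^+ 2)%:E) =
      (fun x => ((\sum_(k < N) (c k - ratr (q k)) * phi k x) ^+ 2)%:E).
    apply/funext => x; congr ((_ ^+ 2)%:E).
    rewrite /rational_combination size_mkseq /S -sumrB; apply: eq_bigr => k _.
    by rewrite nth_mkseq// mulrBl.
  rewrite (orthonormal_sum_norm (fun k => c k - ratr (q k))) lte_fin.
  apply: (@le_lt_trans _ _ (\sum_(k < N) dl ^+ 2)).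
    apply: ler_sum => k _; rewrite -real_normK ?num_real// lerXn2r ?nnegrE ?(ltW dl0)//.
    exact/ltW/hq.
  rewrite sumr_const card_ord -[_ *+ N]mulr_natl.
  have -> : e / 2 = N.+1%:R * dl by rewrite /dl mulrCA divff ?mulr1 ?pnatr_eq0.
  move: dl0; move: {hq} dl => z z0.
  rewrite [X in _ < X]exprMn ltr_pM2r ?exprn_gt0// -natrX ltr_nat.
  by rewrite expnS expn1; nia.
have := lee_ltD _ h1 h2; rewrite -EFinD => /(_ _)h3.
apply: lt_le_trans (h3 _) _; first by rewrite ge0_fin_numE ?L2dist_ge0// (le_lt_trans h1) ?ltry.
by rewrite lee_fin; lra.
Qed.

Lemma L2_random_variableP (X : Omega -> T -> R) :
  (forall w, L2 mu (X w)) -> measurable_balls X -> L2_random_variable mu X.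
Proof.
move=> XL2 mX; split => // O hO.
pose good (p : seq rat * nat) := forall g, L2 mu g ->
   (L2dist mu g (rational_combination p.1) < (p.2.+1%:R^-1)%:E)%E -> O g.
pose A (p : seq rat * nat) := if `[< good p >] then
   [set w | (L2dist mu (X w) (rational_combination p.1) < (p.2.+1%:R^-1)%:E)%E] else set0.
have -> : X @^-1` O = \bigcup_p A p.
  apply/seteqP; split => w.
    move=> /= Ow; have [e e0 he] := hO _ (XL2 w) Ow.
    pose n := Num.truncn (2 / e).
    have n0 : (0 : R) < n.+1%:R^-1 by rewrite invr_gt0.
    have [q hq] := rational_combination_dense (XL2 w) n0.
    exists (q, n) => //; rewrite /A; case: asboolP => //= ng; exfalso; apply: ng => g gL2 hg.
    apply: he => //; apply: le_lt_trans (L2dist_triangle gL2 (rational_combination_L2 q) (XL2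
      w)) _.
    rewrite [X in (_ + X)%E]L2distC.
    apply: lt_le_trans (lteD hg hq) _; rewrite -EFinD lee_fin.
    have : 2 / e < n.+1%:R by exact: truncnS_gt.
    rewrite ltr_pdivrMr// -ltr_pdivrMl// => h.
    by rewrite /=; move: h; set t := _^-1; lra.
  by move=> [p _]; rewrite /A; case: asboolP => // gp /= hw; exact: gp.
apply: countable_bigcupT_measurable => // p; rewrite /A; case: ifP => // _.
by apply: mX; [exact: rational_combination_L2|rewrite invr_gt0].
Qed.

Lemma random_variable_balls (X : Omega -> T -> R) : L2_random_variable mu X -> measurable_balls X.
Proof.
move=> [XL2 mX] g e gL2 e0.
apply: (mX [set f | (L2dist mu f g < e%:E)%E]) => f fL2 /= fg.
have [q qE] : exists q : R, L2dist mu f g = q%:E.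
  have := L2dist_ge0 f g; move: fg; case: (L2dist mu f g) => //= q _ _; by exists q.
rewrite qE lte_fin in fg.
exists (e - q); first by rewrite subr_gt0.
move=> h hL2 hf; apply: le_lt_trans (L2dist_triangle hL2 fL2 gL2) _.
rewrite qE; have := L2dist_ge0 h f; move: hf; case: (L2dist mu h f) => //= z.
by rewrite lte_fin => ? _; rewrite -EFinD lte_fin; lra.
Qed.

Lemma measurable_L2dist (X Y : Omega -> T -> R) :
  (forall w, L2 mu (X w)) -> (forall w, L2 mu (Y w)) ->
  measurable_balls X -> measurable_balls Y ->
  measurable_fun setT (fun w => L2dist mu (X w) (Y w)).
Proof.
move=> XL2 YL2 mX mY; apply: (measurability _ (ErealGenInftyO.measurableE R)).
move=> _ [_ [e ->] <-]; rewrite setTI.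
pose A (p : seq rat * (rat * rat)) := if (0 < ratr p.2.1 :> R) && (0 < ratr p.2.2 :> R) &&
     (ratr p.2.1 + ratr p.2.2 <= e :> R) then
   [set w | (L2dist mu (X w) (rational_combination p.1) < (ratr p.2.1)%:E)%E] `&`
   [set w | (L2dist mu (Y w) (rational_combination p.1) < (ratr p.2.2)%:E)%E] else set0.
have -> : (fun w => L2dist mu (X w) (Y w)) @^-1` `]-oo, e%:E[%classic = \bigcup_p A p.
  apply/seteqP; split => w.
    rewrite /= in_itv/= => h.
    have [z zE] : exists z : R, L2dist mu (X w) (Y w) = z%:E.
      have := L2dist_ge0 (X w) (Y w); move: h; case: (L2dist mu _ _) => //= z _ _; by exists z.
    have z0 : 0 <= z by rewrite -lee_fin -zE L2dist_ge0.
    rewrite zE lte_fin in h.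
    pose k := (e - z) / 4; have k0 : 0 < k by rewrite divr_gt0// subr_gt0.
    have [r1] := @rat_in_itvoo R k (2 * k) ltac:(lra).
    have [r2] := @rat_in_itvoo R (z + k) (z + 2 * k) ltac:(lra).
    rewrite !in_itv/= => /andP[r2a r2b] /andP[r1a r1b].
    have [q hq] := rational_combination_dense (XL2 w) k0.
    exists (q, (r1, r2)) => //; rewrite /A /=.
    have -> : (0 < ratr r1 :> R) && (0 < ratr r2 :> R) && (ratr r1 + ratr r2 <= e :> R).
      by apply/andP; split; [apply/andP; split|]; rewrite /k in r1a r1b r2a r2b k0; lra.
    split; first by apply: lt_le_trans hq _; rewrite lee_fin ltW.
    apply: le_lt_trans (L2dist_triangle (YL2 w) (XL2 w) (rational_combination_L2 q)) _.
    rewrite L2distC zE; have := L2dist_ge0 (X w) (rational_combination q).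
    move: hq; case: (L2dist mu (X w) _) => //= y.
    by rewrite -EFinD !lte_fin => ? _; lra.
  move=> [[q [r1 r2]] _]; rewrite /A/=; case: ifP => // /andP[_ r12] [/= h1 h2].
  rewrite in_itv/=; apply: le_lt_trans (L2dist_triangle (XL2 w) (rational_combination_L2 q) (YL2
    w)) _.
  rewrite [X in (_ + X)%E]L2distC; apply: lt_le_trans (lteD h1 h2) _.
  by rewrite -EFinD lee_fin.
apply: countable_bigcupT_measurable => // p; rewrite /A; case: ifP => // /andP[/andP[p1 p2] _].
by apply: measurableI; [apply: mX|apply: mY] => //; exact: rational_combination_L2.
Qed.

End L2RandomVariables.

Section VersionFromProbability.
Context {d} {T : measurableType d} {R : realType}.
Variable mu : probability T R.
Context {d'} {Omega : measurableType d'}.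
Variable P : probability Omega R.

Lemma markov_ereal (f : Omega -> \bar R) (e : R) : measurable_fun setT f ->
  (forall w, (0 <= f w)%E) -> 0 < e ->
  (e%:E * P [set w | (e%:E <= f w)%E] <= \int[P]_w f w)%E.
Proof.
move=> mf f0 e0.
have mA : measurable [set w | (e%:E <= f w)%E].
  by have := emeasurable_fun_c_infty measurableT mf e%:E; rewrite setTI.
rewrite -[X in (_ * P X)%E]setIT -integral_indic// -ge0_integralZl_EFin//; last 2 first.
- exact/measurable_EFinP/measurable_indic.
- exact: ltW.
apply: ge0_le_integral => //.
- by move=> w _; rewrite mule_ge0// lee_fin ltW.
- by apply: emeasurable_funM => //; exact/measurable_EFinP/measurable_indic.
- move=> w _; rewrite indicE; case: (boolP (w \in _)) => [|_].
    by rewrite inE /= mule1.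
  by rewrite mule0.
Qed.

Variables (Z : Omega * T -> R) (S : nat -> Omega * T -> R) (U : Omega -> T -> R).
Variable phi : nat -> T -> R.
Hypothesis hphi : L2_orthonormal_basis mu phi.
Hypothesis mZ : measurable_fun setT Z.
Hypothesis mS : forall n, measurable_fun setT (S n).
Hypothesis SL2 : forall n w, L2 mu (fun x => S n (w, x)).
Hypothesis hU : L2_random_variable mu U.
Hypothesis hUS : (fun n => \int[P]_w (L2dist mu (U w) (fun x => S n (w,
  x)) `^ 2))%E @ \oo --> 0%E.
Hypothesis hZS : forall x, cvg_in_prob P (fun n w => S n (w, x)) (fun w => Z (w, x)).

Let A (e : R) n := [set p : Omega * T | e < `|Z p - S n p|].

Let mA e n : measurable (A e n).
Proof. by apply: measurable_gt_norm; exact: measurable_funB. Qed.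

Let excess e n (w : Omega) := mu (xsection (A e n) w).

Let measurable_excess e n : measurable_fun setT (excess e n).
Proof. exact: (measurable_fun_xsection mu (mA e n)). Qed.

Let excess_cvg e : 0 < e -> (fun n => \int[P]_w excess e n w)%E @ \oo --> 0%E.
Proof.
move=> e0.
have -> : (fun n => \int[P]_w excess e n w)%E = (fun n => \int[mu]_x P (ysection (A e n) x))%E.
  apply/funext => n; have := indic_fubini_tonelli P mu (mA e n).
  by rewrite indic_fubini_tonelli_FE// indic_fubini_tonelli_GE.
rewrite -(integral0 mu setT).
apply: (@dominated_cvg _ _ _ mu setT measurableT _ _ (cst 1%E)) => //.
- by move=> n; exact: (measurable_fun_ysection P (mA e n)).
- move=> x _; apply/fine_cvgP; split.
    apply: nearW => n; apply: fin_num_measure; exact: measurable_ysection.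
  apply/cvgrPdist_le => /= h h0; have [_ _ /(_ e h e0 h0)[N HN]] := hZS x.
  exists N => // n /= Nn; have := HN n Nn.
  have -> : [set w | e < `|Z (w, x) - S n (w, x)|] = ysection (A e n) x.
    by rewrite ysectionE.
  have : P (ysection (A e n) x) \is a fin_num by apply: fin_num_measure;
    exact: measurable_ysection.
  move=> pf; rewrite -{1}(fineK pf) lee_fin sub0r normrN ger0_norm//.
  exact: fine_ge0.
- by exact: (finite_measure_integrable_cst mu 1).
- move=> n x _; rewrite gee0_abs// probability_le1//; exact: measurable_ysection.
Qed.

Let dist n (w : Omega) := L2dist mu (U w) (fun x => S n (w, x)).

Let measurable_dist n : measurable_fun setT (dist n).
Proof.
apply: (measurable_L2dist hphi) => //; first by case: hU.
  exact: random_variable_balls hU.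
exact: (@joint_measurable_balls _ _ _ _ _ _ (S n)).
Qed.

Let close (e k : R) : 0 < e -> 0 < k ->
  {ae P, forall w, (mu [set x | (2 * e < `|Z (w, x) - U w x|)%R] <= (2 * k ^+ 2)%:E)%E}.
Proof.
move=> e0 k0; have k20 : 0 < k ^+ 2 by rewrite exprn_gt0.
have ek0 : 0 < e * k by rewrite mulr_gt0.
have ek20 : 0 < (e * k) ^+ 2 by rewrite exprn_gt0.
pose B n := [set w | ((k ^+ 2)%:E <= excess e n w)%E] `|`
  [set w | (((e * k) ^+ 2)%:E <= dist n w `^ 2)%E].
have mdist2 n : measurable_fun setT (fun w => dist n w `^ 2)%E.
  exact: (measurableT_comp (measurable_poweR _) (measurable_dist n)).
have m1 n : measurable [set w | ((k ^+ 2)%:E <= excess e n w)%E].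
  by have := emeasurable_fun_c_infty measurableT (measurable_excess e n) (k ^+ 2)%:E;
    rewrite setTI.
have m2 n : measurable [set w | (((e * k) ^+ 2)%:E <= dist n w `^ 2)%E].
  by have := emeasurable_fun_c_infty measurableT (mdist2 n) ((e * k) ^+ 2)%:E; rewrite setTI.
have mB n : measurable (B n) by exact: measurableU.
exists (\bigcap_n B n); split.
- exact: bigcapT_measurable.
- apply/eqP; rewrite eq_le measure_ge0 andbT; apply/lee_addgt0Pr => h h0; rewrite add0e.
  have h1 : 0 < h / 2 * k ^+ 2 by rewrite mulr_gt0// divr_gt0.
  have h2 : 0 < h / 2 * (e * k) ^+ 2 by rewrite mulr_gt0// divr_gt0.
  have [N1 HN1] := cvge0_near_le (excess_cvg e0) h1.
  have [N2 HN2] := cvge0_near_le hUS h2.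
  pose n := maxn N1 N2.
  apply: (@le_trans _ _ (P (B n))).
    by apply: le_measure; rewrite ?inE//; [exact: bigcapT_measurable|exact: bigcap_inf].
  apply: (le_trans (measureU2 _ (m1 n) (m2 n))).
  rewrite [h]splitr EFinD; apply: leeD.
    have := le_trans (markov_ereal (measurable_excess e n) (fun w => measure_ge0 mu _) k20) (HN1
      n (leq_maxl _ _)).
    by rewrite [(h / 2 * _)%:E]EFinM [leRHS]muleC lee_pmul2l// lte_fin.
  have := le_trans (markov_ereal (mdist2 n) (fun w => poweR_ge0 _ _) ek20) (HN2 n (leq_maxr _ _)).
  by rewrite [(h / 2 * _)%:E]EFinM [leRHS]muleC lee_pmul2l// lte_fin.
move=> w /= hw n _ /=; apply: contrapT => hB; apply: hw.
have /not_orP[/negP + /negP] := hB; rewrite -!ltNge => hB1 hB2.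
have mU := L2_measurable (hU.1 w).
have mZw : measurable_fun setT (fun x => Z (w,
  x)) by exact: (measurableT_comp mZ (measurable_pair1 w)).
have mSw : measurable_fun setT (fun x => S n (w,
  x)) by exact: (measurableT_comp (mS n) (measurable_pair1 w)).
have mZS : measurable_fun setT (fun x => Z (w, x) - S n (w, x)) by exact: measurable_funB.
have mSU : measurable_fun setT (fun x => S n (w, x) - U w x) by exact: measurable_funB.
have := prob_norm_sum_gt mu e e mZS mSU.
have -> : [set x | e + e < `|Z (w, x) - S n (w, x) + (S n (w, x) - U w x)|] =
   [set x | 2 * e < `|Z (w, x) - U w x|].
  by apply/funext => x /=; rewrite subrKA mulr_natl mulr2n.
move/le_trans; apply; rewrite mulr_natl mulr2n EFinD; apply: leeD.
  move/ltW : hB1; rewrite /excess; congr (mu _ <= _)%E.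
  by rewrite xsectionE.
apply: (le_trans (second_moment_tail_le (v := (e * k) ^+ 2) mSU e0 _)).
  move/ltW : hB2; rewrite /dist L2distC L2dist_sqr unlock; exact.
by rewrite exprMn mulrC mulKf ?lexx// gt_eqF// exprn_gt0.
Qed.

Lemma version_of_limits : {ae P, forall w, {ae mu, forall x, Z (w, x) = U w x}}.
Proof.
have H (i j : nat) : {ae P, forall w, (mu [set x | (2 * i.+1%:R^-1 < `|Z (w, x) - U w x|)%R] <=
    (2 * (j.+1%:R^-1) ^+ 2)%:E)%E} by apply: close; rewrite invr_gt0.
have := ae_foralln (fun i => ae_foralln (H i)).
apply: filterS => w Hw.
have mU := L2_measurable (hU.1 w).
have mZw : measurable_fun setT (fun x => Z (w,
  x)) by exact: (measurableT_comp mZ (measurable_pair1 w)).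
have mZU : measurable_fun setT (fun x => Z (w, x) - U w x) by exact: measurable_funB.
have H0 i : {ae mu, forall x, `|Z (w, x) - U w x| <= 2 * i.+1%:R^-1}.
  exists [set x | 2 * i.+1%:R^-1 < `|Z (w, x) - U w x|]; split.
  - exact: measurable_gt_norm.
  - apply/eqP; rewrite eq_le measure_ge0 andbT; apply/lee_addgt0Pr => h h0; rewrite add0e.
    pose j := Num.truncn (2 / h); apply: le_trans (Hw i j) _; rewrite lee_fin.
    have : 2 / h < j.+1%:R by exact: truncnS_gt.
    rewrite ltr_pdivrMr// -ltr_pdivrMl// mulrC => h1.
    have h2 : j.+1%:R^-1 <= 1 :> R by rewrite invf_le1// ler1n.
    have h3 : 0 < j.+1%:R^-1 :> R by rewrite invr_gt0.
    by move: h1 h2 h3; set z := _^-1 => h1 h2 h3; nra.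
  - by move=> x /= /negP; rewrite -ltNge.
have := ae_foralln H0.
apply: filterS => x Hx; apply/eqP; rewrite -subr_eq0 -normr_le0.
apply/ler_addgt0Pr => h h0; rewrite add0r.
pose j := Num.truncn (2 / h); apply: le_trans (Hx j) _.
have : 2 / h < j.+1%:R by exact: truncnS_gt.
by rewrite ltr_pdivrMr// -ltr_pdivrMl// mulrC => /ltW.
Qed.

End VersionFromProbability.

(** * The continuous modification *)

Section Nets.
Context {R : realType}.

Definition dyadic_net (n i : nat) : R := i%:R * 2^-1 ^+ n.
Definition dyadic_proj (n : nat) (t : R) : R := dyadic_net n (Num.truncn (t * 2 ^+ n)).
Definition dyadic_size (T : R) (n : nat) : nat := (Num.truncn (T * 2 ^+ n)).+1.

Lemma dyadic_net_ge0 n i : 0 <= dyadic_net n i.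
Proof. by rewrite mulr_ge0// exprn_ge0// invr_ge0. Qed.

Lemma dyadic_nets (T : R) : 0 <= T ->
  nets [set` `[0, T]] eucl (dyadic_size T) dyadic_net dyadic_proj.
Proof.
move=> T0; have p2 n : 0 < 2 ^+ n :> R by rewrite exprn_gt0.
have h2 n : 2^-1 ^+ n = (2 ^+ n)^-1 :> R by rewrite exprVn.
split => [p q|p q|p q t|n i iN|n p|n p].
- exact: normr_ge0.
- exact: distrC.
- apply: le_trans (ler_distD q _ _) _; rewrite ler_peMl ?ler1n// addr_ge0//; exact: normr_ge0.
- rewrite /= in_itv/= dyadic_net_ge0/= /dyadic_net h2 ler_pdivrMr//.
  by rewrite -truncn_ge_nat// mulr_ge0// ltW.
- rewrite /= in_itv/= => /andP[p0 pT]; exists (Num.truncn (p * 2 ^+ n)) => //.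
  by rewrite ltnS le_truncn// ler_pM2r.
- rewrite /= in_itv/= => /andP[p0 pT].
  have := truncn_itv (mulr_ge0 p0 (ltW (p2 n))).
  rewrite /eucl /dyadic_proj /dyadic_net h2; move: (Num.truncn _) => k.
  rewrite -ler_pdivrMr// -ltr_pdivlMr// => /andP[h3 h4].
  rewrite ger0_norm ?subr_ge0// lerBlDl.
  by rewrite (le_trans (ltW h4))// -natr1 mulrDl mul1r.
Qed.

Lemma dyadic_size_le (T : R) n : 0 <= T -> (dyadic_size T n)%:R <= (T + 1) * 2 ^+ n.
Proof.
move=> T0; rewrite /dyadic_size -natr1 mulrDl mul1r lerD//.
  by rewrite truncn_le mulr_ge0// exprn_ge0.
by rewrite exprn_ege1// ler1n.
Qed.

Lemma product_nets (S1 S2 : Type) (D1 : set S1) (D2 : set S2) d1 d2 N1 N2 net1 net2 proj1 proj2 :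
  @nets R S1 D1 d1 N1 net1 proj1 -> @nets R S2 D2 d2 N2 net2 proj2 ->
  nets (D1 `*` D2) (fun p q => Num.max (d1 p.1 q.1) (d2 p.2 q.2))
    (fun n => N1 n * N2 n)%N
    (fun n k => (net1 n (k %/ N2 n)%N, net2 n (k %% N2 n)%N))
    (fun n p => (proj1 n p.1, proj2 n p.2)).
Proof.
move=> h1 h2; split => [p q|p q|p q t|n i iN|n p [p1 p2]|n p [p1 p2]] /=.
- by rewrite le_max (nets_ge0 h1).
- by rewrite (nets_sym h1) (nets_sym h2).
- rewrite ge_max; apply/andP; split.
    apply: le_trans (nets_quasi h1 _ q.1 _) _; rewrite ler_pM2l//.
    by apply: lerD; rewrite le_max lexx.
  apply: le_trans (nets_quasi h2 _ q.2 _) _; rewrite ler_pM2l//.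
  by apply: lerD; rewrite le_max lexx orbT.
- have N20 : (0 < N2 n)%N by move: iN; case: (N2 n) => //; rewrite muln0.
  split; [apply: (nets_in h1)|apply: (nets_in h2)] => /=; last exact: ltn_pmod.
  by rewrite ltn_divLR.
- have [i iN e1] := nets_proj h1 n p1; have [j jN e2] := nets_proj h2 n p2.
  exists (i * N2 n + j)%N.
    apply: (@leq_trans (i * N2 n + N2 n)); first by rewrite -addnS leq_add2l.
    by rewrite addnC -mulSn leq_pmul2r//; apply: leq_trans jN.
  by rewrite e1 e2 divnMDl ?(leq_trans _ jN)// divn_small// addn0 modnMDl modn_small.
- by rewrite ge_max (nets_close h1) ?(nets_close h2).
Qed.

End Nets.

Section CellNets.
Context {R : realType} {F : pMetricType R} {M : nat}.
Variables (psi : 'I_M -> F -> F) (a : F -> F -> R) (r : 'I_M -> R).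
Hypothesis hpsi : pcf_self_similar psi.
Hypothesis har : regular_harmonic_structure psi a r.

Let words (L : nat) : seq (seq 'I_M) := [seq val w | w <- enum {: L.-tuple 'I_M}].

Let size_words L : size (words L) = (M ^ L)%N.
Proof. by rewrite size_map -cardE card_tuple card_ord. Qed.

Definition cell_index (L : nat) (x : F) : nat :=
  find (fun w => `[< cell psi w x >]) (words L).

Definition cell_point (L i : nat) : F := psiw psi (nth [::] (words L) i) point.

Let has_word L x : has (fun w => `[< cell psi w x >]) (words L).
Proof.
have [J [nx hJ]] := decompose hpsi.
apply/hasP; exists (mkseq (address J nx x) L).
  apply/mapP; exists (Tuple (introT eqP (size_mkseq (address J nx x) L))) => //.
  by rewrite mem_enum.
by apply/asboolP; exists (iter L nx x) => //; exact: psiw_address.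
Qed.

Lemma cell_index_lt L x : (cell_index L x < M ^ L)%N.
Proof. by rewrite -size_words -has_find. Qed.

Lemma cell_point_close L x : exists w y, [/\ size w = L, x = psiw psi w y &
  cell_point L (cell_index L x) = psiw psi w point].
Proof.
have := nth_find [::] (has_word L x); rewrite -/(cell_index L x) => /asboolP[y _ yx].
exists (nth [::] (words L) (cell_index L x)), y; split => //.
have := cell_index_lt L x; rewrite -size_words => /(mem_nth [::]) /mapP[w _ ->].
exact: size_tuple.
Qed.

Lemma measurable_cell_index L i :
  measurable ([set x | cell_index L x = i] : set (borel F)).
Proof.
have mcell w : measurable (cell psi w : set (borel F)).
  rewrite -[X in measurable X]setCK; apply: measurableC; apply: sub_sigma_algebra.
  by apply: closed_openC; exact: cell_closed.
have mle k : measurable ([set x | (cell_index L x <= k)%N] : set (borel F)).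
  have -> : [set x | (cell_index L x <= k)%N] =
      \big[setU/set0]_(w <- take k.+1 (words L)) cell psi w.
    rewrite -bigcup_seq; apply/seteqP; split => x /=.
      have := has_word L x; move=> hx hk.
      exists (nth [::] (words L) (cell_index L x)); last first.
        by have /asboolP := nth_find [::] hx.
      rewrite -(nth_take (n0 := k.+1)) ?ltnS//; apply: mem_nth.
      by rewrite size_take_min leq_min ltnS hk size_words cell_index_lt.
    move=> [w + wx]; rewrite /cell_index => /(nthP [::])[j].
    rewrite size_take_min leq_min ltnS => /andP[jk jw].
    rewrite nth_take ?ltnS// => jE; apply: leq_trans jk; rewrite leqNgt;
      apply/negP => /(before_find [::]).
    by rewrite jE => /asboolP.
  by apply: bigsetU_measurable => w _.
case: i => [|i].
  by have := mle 0; congr measurable; apply/seteqP; split => x /=; rewrite leqn0 => /eqP.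
have := measurableD (mle i.+1) (mle i); congr measurable.
apply/seteqP; split => x /=; last by move=> ->; rewrite ltnn.
by move=> [h1 /negP]; rewrite -ltnNge => h2; apply/eqP; rewrite eqn_leq h1.
Qed.

Let Rst := resistance psi a r.

Lemma cell_nets : exists L : nat -> nat,
  nets [set: F] Rst (fun n => M ^ L n)%N (fun n => cell_point (L n))
    (fun n x => cell_point (L n) (cell_index (L n) x)) /\
  exists C K : R, [/\ 0 <= K & forall n, (M ^ L n)%:R <= C * K ^+ n].
Proof.
have [C C0 hC] := resistance_cell hpsi har.
have [q /andP[q0 q1] hq] := uniform_lt1 (r_lt1 har).
have rwq w : rw r w <= q ^+ size w.
  elim: w => [|i w IH]; first by rewrite /rw big_nil.
  by rewrite rw_cons exprS ler_pM// ?ltW ?(rw_gt0 har)// ?(r_gt0 har).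
have [L0 hL0] := geometric_small (c := q) C q0 q1 ltr01.
have [c hc] := geometric_small (c := q) 1 q0 q1 (e := 2^-1) ltac:(by rewrite invr_gt0).
have {}hc : q ^+ c <= 2^-1 by have := hc c (leqnn _); rewrite mulr1 => /ltW.
exists (fun n => L0 + c * n)%N; split.
  split => [x y|x y|x y z|n i iN|n x _|n x _].
  - exact: resistance_ge0.
  - exact: resistance_sym.
  - exact: resistance_quasi.
  - by [].
  - by exists (cell_index (L0 + c * n) x) => //; exact: cell_index_lt.
  - have [w [y [sw -> ->]]] := cell_point_close (L0 + c * n) x.
    apply: le_trans (hC w y point) _.
    apply: (@le_trans _ _ (C * q ^+ size w)); first by rewrite ler_pM2l.
    rewrite sw exprD mulrCA mulrC -mulrA exprM.
    have h1 : q ^+ L0 * C <= 1 by apply: ltW; apply: hL0.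
    rewrite mulrCA -[leRHS]mulr1; apply: ler_pM => //.
    - by rewrite exprn_ge0// exprn_ge0// ltW.
    - by rewrite mulr_ge0// ?exprn_ge0// ltW.
    - by apply: lerXn2r => //; rewrite nnegrE ?invr_ge0// exprn_ge0// ltW.
    - by rewrite mulrC.
exists (M ^ L0)%:R, (M ^ c)%:R; split => // n.
by rewrite -natrX -natrM ler_nat expnD expnM.
Qed.

End CellNets.

Lemma powR_le_scale (R : realType) (x rho K e1 e2 : R) : 0 <= x -> x <= rho -> x <= K ->
  0 < e2 <= e1 ->
  x `^ e1 <= K `^ (e1 - e2) * rho `^ e2.
Proof.
move=> x0 xr xK /andP[e20 e21].
have [->|xn0] := eqVneq x 0.
  by rewrite powR0 ?gt_eqF ?(lt_le_trans e20)// mulr_ge0// powR_ge0.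
have -> : x `^ e1 = x `^ (e1 - e2) * x `^ e2.
  by rewrite -powRD ?subrK// xn0 implybT.
have K0 : 0 <= K := le_trans x0 xK; have r0 : 0 <= rho := le_trans x0 xr.
apply: ler_pM; rewrite ?powR_ge0//.
  by apply: ge0_ler_powR; rewrite ?nnegrE ?subr_ge0.
by apply: ge0_ler_powR; rewrite ?nnegrE// ltW.
Qed.

Lemma gaussian_tail_scale (R : realType) (G A B x y l : R) m : 0 <= G -> 0 <= A -> 0 <= x ->
  x <= B * y ^+ 2 ->
  G * (A * x / l ^+ 2) ^+ m <= G * (A * B) ^+ m * ((y / l) ^+ 2) ^+ m.
Proof.
move=> G0 A0 x0 xy; rewrite -[leRHS]mulrA -exprMn ler_wpM2l//; apply: lerXn2r; rewrite ?nnegrE.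
- by rewrite divr_ge0 ?sqr_ge0// mulr_ge0.
- rewrite -mulrA mulr_ge0// expr_div_n mulrA divr_ge0 ?sqr_ge0//.
  exact: le_trans xy.
have h : x / l ^+ 2 <= B * y ^+ 2 / l ^+ 2 by rewrite ler_wpM2r// invr_ge0 sqr_ge0.
have -> : A * x / l ^+ 2 = A * (x / l ^+ 2) by rewrite mulrA.
have -> : A * B * (y / l) ^+ 2 = A * (B * y ^+ 2 / l ^+ 2) by rewrite expr_div_n !mulrA.
exact: ler_wpM2l.
Qed.

Section Modification.
Context {d} {Omega : measurableType d} {R : realType}.
Variable P : probability Omega R.

Lemma cvg_in_prob_ae (X : nat -> Omega -> R) (Y Y' : Omega -> R) : measurable_fun setT Y' ->
  {ae P, forall w, Y' w = Y w} -> cvg_in_prob P X Y -> cvg_in_prob P X Y'.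
Proof.
move=> mY' [A [mA A0 hA]] [mX mY hXY]; split => // e h e0 h0.
have [N HN] := hXY e h e0 h0; exists N => n Nn; apply: le_trans (HN n Nn).
have m1 : measurable [set w | e < `|Y w - X n w|].
  by apply: measurable_gt_norm; exact: measurable_funB.
have m2 : measurable [set w | e < `|Y' w - X n w|].
  by apply: measurable_gt_norm; exact: measurable_funB.
apply: (@le_trans _ _ (P ([set w | (e < `|Y w - X n w|)%R] `|` A))).
  apply: le_measure; rewrite ?inE//; first exact: measurableU.
  move=> w /= hw; have [E|E] := pselect (Y' w = Y w); first by left; rewrite -E.
  by right; exact: hA.
apply: (le_trans (measureU2 _ m1 mA)); rewrite -[leRHS]adde0; apply: leeD => //.
by rewrite le_eqVlt; apply/orP; left; apply/eqP; exact: A0.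
Qed.

Section HolderModification.
Context {S : Type}.
Variables (D : set S) (dist : S -> S -> R).
Variables (N : nat -> nat) (net : nat -> nat -> S) (proj : nat -> S -> S).
Hypothesis hnets : nets D dist N net proj.

Lemma chain_lim_eq (x y : S -> R) (A g : R) : 0 < g -> 0 < A ->
  (forall n i, (i < N n)%N -> x (net n i) = y (net n i)) ->
  (forall p q, D p -> D q -> `|y p - y q| <= A * dist p q `^ g) ->
  forall p, D p -> chain_lim proj x p = y p.
Proof.
move=> g0 A0 xy hy p Dp; apply/cvg_lim => //.
have xyp n : x (proj n p) = y (proj n p).
  by have [i iN ->] := nets_proj hnets n Dp; exact: xy.
under eq_fun do rewrite xyp.
apply/cvgrPdist_le => /= e e0.
have [q0 q1] := andP (half_powR_lt1 g0).
have [m hm] := geometric_small (c := 2^-1 `^ g) A q0 q1 e0.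
exists m => // n /= mn; apply: le_trans (ltW (hm n mn)).
have Dpn : D (proj n p) by have [i iN ->] := nets_proj hnets n Dp; exact: (nets_in hnets).
apply: le_trans (hy _ _ Dp Dpn) _; rewrite mulrC ler_pM2r// -half_powRX.
apply: ge0_ler_powR; rewrite ?nnegrE ?(nets_ge0 hnets) ?exprn_ge0 ?invr_ge0 ?(ltW g0)//.
exact: (nets_close hnets).
Qed.

Variables (X Xt : S -> Omega -> R) (eta C K : R).
Hypothesis eta0 : 0 < eta.
Hypothesis K0 : 0 <= K.
Hypothesis hN : forall n, (N n)%:R <= C * K ^+ n.
Hypothesis mX : forall p, D p -> measurable_fun setT (X p).
Hypothesis tailX : forall m, exists2 c : R, 0 <= c &
  forall p q l, D p -> D q -> 0 < l ->
  (P [set w | (l < `|X p w - X q w|)%R] <= (c * ((dist p q `^ eta / l) ^+ 2) ^+ m)%:E)%E.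
Hypothesis XtX : forall p, D p -> {ae P, forall w, Xt p w = X p w}.

Lemma holder_modification (g : R) : 0 < g ->
  (forall w, exists2 A : R, 0 < A & forall p q, D p -> D q ->
    `|Xt p w - Xt q w| <= A * dist p q `^ g) ->
  {ae P, forall w, ess_holder D dist eucl eta (Xt^~ w)}.
Proof.
move=> g0 hXt.
have H1 : {ae P, forall w, forall n i, (i < N n)%N -> X (net n i) w = Xt (net n i) w}.
  apply: ae_foralln => n; apply: ae_foralln => i.
  case: (ltnP i (N n)) => iN; last by apply: aeW.
  by apply: filterS (XtX (nets_in hnets iN)) => w ->.
have H2 := chaining_holder hnets eta0 K0 hN mX tailX.
apply: filterS2 H1 H2 => w h1 [_ h2] e he; have [A A0 hA] := h2 e he; exists A => // p q Dp Dq.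
have [B B0 hB] := hXt w.
have E := chain_lim_eq (x := X^~ w) (y := Xt^~ w) g0 B0 h1 hB.
by have := hA p q Dp Dq; rewrite !E.
Qed.

End HolderModification.
End Modification.

Section FieldModification.
Context {d} {Omega : measurableType d} {R : realType} {F : pMetricType R}.
Variables (P : probability Omega R) (u : R -> F -> Omega -> R).
Variables (Rst : F -> F -> R) (NF : nat -> nat) (netF : nat -> nat -> F).
Variables (idx : nat -> F -> nat) (CF KF Bd dl : R).
Let projF n x := netF n (idx n x).
Hypothesis hF : nets [set: F] Rst NF netF projF.
Hypothesis idx_lt : forall n x, (idx n x < NF n)%N.
Hypothesis KF0 : 0 <= KF.
Hypothesis hNF : forall n, (NF n)%:R <= CF * KF ^+ n.
Hypothesis midx : forall n i, measurable ([set x | idx n x = i] : set (borel F)).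
Hypothesis Rxx : forall x, Rst x x = 0.
Hypothesis Rst_bound : forall x y, Rst x y <= Bd.
Hypothesis u_measurable : forall t x, 0 <= t -> measurable_fun setT (u t x).
Hypothesis dl0 : 0 < dl.
Hypothesis spatial : forall T0, 0 <= T0 -> exists2 A : R, 0 <= A & forall t x y l m,
  0 <= t <= T0 -> 0 < l ->
  (P [set w | (l < `|u t x w - u t y w|)%R] <=
    (gauss_const m * (A * Rst x y / l ^+ 2) ^+ m)%:E)%E.
Hypothesis temporal : forall T0, 0 <= T0 -> exists2 A : R, 0 <= A & forall t s x l m,
  0 <= t <= T0 -> 0 <= s <= T0 -> 0 < l ->
  (P [set w | (l < `|u t x w - u s x w|)%R] <=
    (gauss_const m * (A * `|t - s| `^ (2 * dl) / l ^+ 2) ^+ m)%:E)%E.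

Let eta := Num.min (1 / 2) dl.
Let dist (p q : R * F) := Num.max (eucl p.1 q.1) (Rst p.2 q.2).

Let R0 x y : 0 <= Rst x y. Proof. exact: (nets_ge0 hF). Qed.

Let eta0 : 0 < eta. Proof. by rewrite /eta lt_min dl0 andbT divr_gt0. Qed.

Lemma joint_tail T0 m : 0 <= T0 -> exists2 c : R, 0 <= c &
  forall p q l, (`[0, T0] `*` [set: F]) p -> (`[0, T0] `*` [set: F]) q -> 0 < l ->
  (P [set w | (l < `|u p.1 p.2 w - u q.1 q.2 w|)%R] <=
    (c * ((dist p q `^ eta / l) ^+ 2) ^+ m)%:E)%E.
Proof.
move=> T00; have [A A0 hA] := spatial T00; have [A' A'0 hA'] := temporal T00.
pose B1 := Bd `^ (1 - eta * 2); pose B2 := T0 `^ (2 * dl - eta * 2).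
have G0 := gauss_const_ge0 m : 0 <= gauss_const m :> R.
exists (gauss_const m * (4 * A * B1) ^+ m + gauss_const m * (4 * A' * B2) ^+ m).
  by rewrite addr_ge0// mulr_ge0// exprn_ge0// !mulr_ge0// powR_ge0.
move=> [t x] [s y] l [/= + _] [/= + _] l0; rewrite !in_itv/= => tT sT.
have l20 : 0 < l / 2 by rewrite divr_gt0.
have t0 : 0 <= t by case/andP: tT.
have s0 : 0 <= s by case/andP: sT.
have -> : [set w | l < `|u t x w - u s y w|] =
    [set w | l / 2 + l / 2 < `|(u t x w - u t y w) + (u t y w - u s y w)|].
  by apply/funext => w /=; rewrite -splitr subrKA.
have me2 : (dist (t, x) (s, y) `^ eta) ^+ 2 = dist (t, x) (s, y) `^ (eta * 2).
  by rewrite -powR_mulrn ?powR_ge0// -powRrM.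
have q4 a z : a * z / (l / 2) ^+ 2 = 4 * a * z / l ^+ 2 by field; rewrite gt_eqF.
apply: (le_trans (prob_norm_sum_gt P (l / 2) (l / 2) _ _));
  try (by apply: measurable_funB; exact: u_measurable).
rewrite mulrDl EFinD; apply: leeD.
  apply: le_trans (hA t x y (l / 2) m tT l20) _; rewrite lee_fin q4.
  apply: gaussian_tail_scale; rewrite ?mulr_ge0// me2 -[leLHS]powRr1//.
  apply: powR_le_scale => //; first by rewrite /dist le_max lexx orbT.
  by rewrite mulr_gt0//= -ler_pdivlMr// /eta ge_min lexx.
apply: le_trans (hA' t s y (l / 2) m tT sT l20) _; rewrite lee_fin q4.
apply: gaussian_tail_scale; rewrite ?mulr_ge0// ?powR_ge0// me2.
apply: powR_le_scale => //.
- by rewrite /dist le_max lexx.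
- by rewrite ler_norml; lra.
- by rewrite mulr_gt0//= mulrC ler_pM2l// /eta ge_min lexx orbT.
Qed.

Lemma spatial_chaining_tail t m : 0 <= t -> exists2 c : R, 0 <= c &
  forall x y l, [set: F] x -> [set: F] y -> 0 < l ->
  (P [set w | (l < `|u t x w - u t y w|)%R] <=
    (c * ((Rst x y `^ (1 / 2) / l) ^+ 2) ^+ m)%:E)%E.
Proof.
move=> t0; have [A A0 hA] := spatial t0.
have G0 := gauss_const_ge0 m : 0 <= gauss_const m :> R.
exists (gauss_const m * (A * 1) ^+ m); first by rewrite mulr_ge0// exprn_ge0// mulr_ge0.
move=> x y l _ _ l0; apply: le_trans (hA t x y l m _ l0) _; first by rewrite t0/=.
rewrite lee_fin; apply: gaussian_tail_scale => //.
by rewrite mul1r -powR_mulrn ?powR_ge0// -powRrM divfK ?powRr1// pnatr_eq0.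
Qed.

Lemma temporal_chaining_tail T0 x m : 0 <= T0 -> exists2 c : R, 0 <= c &
  forall t s l, `[0, T0]%classic t -> `[0, T0]%classic s -> 0 < l ->
  (P [set w | (l < `|u t x w - u s x w|)%R] <=
    (c * ((eucl t s `^ dl / l) ^+ 2) ^+ m)%:E)%E.
Proof.
move=> T00; have [A A0 hA] := temporal T00.
have G0 := gauss_const_ge0 m : 0 <= gauss_const m :> R.
exists (gauss_const m * (A * 1) ^+ m); first by rewrite mulr_ge0// exprn_ge0// mulr_ge0.
move=> t s l; rewrite /= !in_itv/= => tT sT l0; apply: le_trans (hA t s x l m tT sT l0) _.
rewrite lee_fin; apply: gaussian_tail_scale => //.
by rewrite mul1r -powR_mulrn ?powR_ge0// -powRrM mulrC.
Qed.

Let proj n (p : R * F) := (dyadic_proj n p.1, projF n p.2).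

Lemma field_nets T0 : 0 <= T0 -> nets (`[0, T0] `*` [set: F]) dist
  (fun n => dyadic_size T0 n * NF n)%N
  (fun n k => (dyadic_net n (k %/ NF n)%N, netF n (k %% NF n)%N)) proj.
Proof. by move=> T00; exact: product_nets (dyadic_nets T00) hF. Qed.

Lemma field_nets_size T0 n : 0 <= T0 ->
  (dyadic_size T0 n * NF n)%:R <= ((T0 + 1) * CF) * (2 * KF) ^+ n.
Proof.
move=> T00; rewrite natrM exprMn mulrACA; apply: ler_pM => //.
exact: dyadic_size_le.
Qed.

Lemma field_modification : exists ut : R -> F -> Omega -> R,
  [/\ forall t x, 0 <= t -> {ae P, forall w, ut t x w = u t x w},
      forall t, 0 <= t -> measurable_fun setT (fun p : Omega * borel F => ut t p.2 p.1) &
      forall w T0 g, 0 <= T0 -> 0 < g < eta -> exists2 A : R, 0 < A &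
        forall p q, (`[0, T0] `*` [set: F]) p -> (`[0, T0] `*` [set: F]) q ->
        `|ut p.1 p.2 w - ut q.1 q.2 w| <= A * dist p q `^ g].
Proof.
have nneg (k : nat) : 0 <= k%:R :> R by [].
have um (k : nat) p : (`[0, k%:R] `*` [set: F]) p -> measurable_fun setT (u p.1 p.2).
  by move=> [/= + _]; rewrite in_itv/= => /andP[p0 _]; exact: u_measurable.
have K20 : 0 <= 2 * KF by rewrite mulr_ge0.
have good := ae_foralln (fun k : nat => chaining_holder (X := fun p => u p.1 p.2)
  (field_nets (nneg k)) eta0 K20 (fun n => field_nets_size n (nneg k)) (@um k)
  (fun m => joint_tail m (nneg k))).
have [N [mN N0 hN]] := good.
pose f n t x w := \1_(~` N) w * u (dyadic_proj n t) (projF n x) w.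
have hgood w : ~ N w -> forall k : nat, (forall p, (`[0, k%:R] `*` [set: F]) p ->
    cvgn (fun n => u (dyadic_proj n p.1) (projF n p.2) w)) /\
    forall g, 0 < g < eta -> exists2 A : R, 0 < A & forall p q,
      (`[0, k%:R] `*` [set: F]) p -> (`[0, k%:R] `*` [set: F]) q ->
    `|limn (fun n => u (dyadic_proj n p.1) (projF n p.2) w) -
      limn (fun n => u (dyadic_proj n q.1) (projF n q.2) w)| <= A * dist p q `^ g.
  move=> Nw; apply: contrapT => h; apply: Nw; apply: hN => /= h'; exact: h.
have inK (t : R) : 0 <= t -> exists k : nat, t <= k%:R.
  by move=> t0; exists (Num.truncn t).+1; exact/ltW/truncnS_gt.
pose ut t x w := limn (fun n => f n t x w).
have fcvg t x w : 0 <= t -> f n t x w @[n --> \oo] --> ut t x w.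
  move=> t0; apply/cvg_ex; rewrite /f indicE; case: (boolP (w \in ~` N)) => [|_]; last first.
    by exists 0; under eq_fun do rewrite mul0r; exact: cvg_cst.
  rewrite inE /= => /hgood h; have [k tk] := inK t t0; have [/(_ (t, x)) hc _] := h k.
  have /cvg_ex[l hl] := hc ltac:(by split => //=; rewrite in_itv/= t0).
  by exists l; under eq_fun do rewrite mul1r.
have utE t x w : ~ N w -> ut t x w = limn (fun n => u (dyadic_proj n t) (projF n x) w).
  move=> Nw; rewrite /ut /f; congr (limn _); apply/funext => n.
  by rewrite indicE mem_set// mul1r.
exists ut; split.
- move=> t x t0; have [k tk] := inK t t0.
  have Dt : (`[0, k%:R] `*` [set: F]) (t, x) by split => //=; rewrite in_itv/= t0.
  have h1 := chaining_modification (X := fun p => u p.1 p.2)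
    (field_nets (nneg k)) eta0 (@um k) (fun m => joint_tail m (nneg k)) Dt.
  have h2 : {ae P, forall w, ~ N w}.
    by exists N; split => // w /= /contrapT.
  apply: filterS2 h1 h2 => w h1 Nw; rewrite utE//.
  exact: cvg_lim h1.
- move=> t t0.
  apply: (@measurable_fun_cvg _ _ R setT (fun n (p : Omega * borel F) => f n t p.2 p.1));
    last first.
    by move=> [w x] _; exact: fcvg.
  move=> n.
  have -> : (fun p : Omega * borel F => f n t p.2 p.1) = (fun p : Omega * borel F =>
      \1_(~` N) p.1 * \sum_(i < NF n) \1_[set x | idx n x = i] p.2 *
        u (dyadic_proj n t) (netF n i) p.1).
    apply/funext => -[w x] /=; rewrite /f; congr (_ * _).
    rewrite (bigD1 (Ordinal (idx_lt n x)))//= big1 => [|i ni].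
      by rewrite indicE mem_set//= mul1r addr0.
    rewrite indicE memNset ?mul0r//= => E; move/eqP : ni; apply.
    exact/val_inj.
  have d0 : 0 <= dyadic_proj n t by exact: dyadic_net_ge0.
  apply: measurable_funM.
    by apply: measurableT_comp measurable_fst; apply: measurable_indic; exact: measurableC.
  apply: measurable_sum => i; apply: measurable_funM.
    by apply: measurableT_comp measurable_snd; apply: measurable_indic; exact: midx.
  by apply: measurableT_comp measurable_fst; exact: u_measurable.
- move=> w T0 g T00 geta; have [Nw|Nw] := pselect (N w).
    exists 1 => // p q _ _; rewrite (_ : ut _ _ _ - ut _ _ _ = 0).
      by rewrite normr0 mul1r powR_ge0.
    have z t x : ut t x w = 0.
      apply/cvg_lim => //; rewrite /f indicE memNset ?mul0r; last by move=> /= h; exact: h.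
      by under eq_fun do rewrite mul0r; exact: cvg_cst.
    by rewrite !z subrr.
  have [k tk] := inK T0 T00; have [_ /(_ g geta)[A A0 hA]] := hgood w Nw k; exists A => // p q.
  have sub (z : R * F) : (`[0, T0] `*` [set: F]) z -> (`[0, k%:R] `*` [set: F]) z.
    move=> [/= + _]; rewrite in_itv/= => /andP[z0 zT]; split => //=.
    by rewrite in_itv/= z0 (le_trans zT).
  by move=> /sub Dp /sub Dq; rewrite !utE//; exact: hA.
Qed.

End FieldModification.

Section SquareIntegrablePaths.
Context {d} {Omega : measurableType d} {R : realType} {F : pMetricType R}.
Variables (P : probability Omega R) (mu : probability (borel F) R).
Variables (ut : R -> F -> Omega -> R) (Rst : F -> F -> R) (Bd eta : R).
Hypothesis R0 : forall x y, 0 <= Rst x y.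
Hypothesis Rxx : forall x, Rst x x = 0.
Hypothesis Rst_bound : forall x y, Rst x y <= Bd.
Hypothesis eta0 : 0 < eta.
Hypothesis mut : forall t, 0 <= t ->
  measurable_fun setT (fun p : Omega * borel F => ut t p.2 p.1).
Hypothesis hut : forall w T0 g, 0 <= T0 -> 0 < g < eta -> exists2 A : R, 0 < A &
  forall p q, (`[0, T0] `*` [set: F]) p -> (`[0, T0] `*` [set: F]) q ->
  `|ut p.1 p.2 w - ut q.1 q.2 w| <= A * Num.max (eucl p.1 q.1) (Rst p.2 q.2) `^ g.

Let X t w x := ut t x w.

Let g := eta / 2.
Let g0 : 0 < g. Proof. by rewrite divr_gt0. Qed.
Let geta : 0 < g < eta. Proof. by rewrite g0 /g ltr_pdivrMr// ltr_pMr// ltr1n. Qed.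

Lemma section_measurable t w : 0 <= t -> measurable_fun (setT : set (borel F)) (X t w).
Proof. by move=> t0; exact: (measurableT_comp (mut t0) (measurable_pair1 w)). Qed.

Lemma path_L2 t w : 0 <= t -> L2 mu (X t w).
Proof.
move=> t0; have [A A0 hA] := hut w t0 geta.
apply: (@L2_bounded _ _ _ mu _ (`|X t w point| + A * Bd `^ g)); first exact: section_measurable.
move=> x; have Dt y : (`[0, t] `*` [set: F]) (t, y) by split => //=; rewrite in_itv/= t0 lexx.
rewrite -[X t w x](subrK (X t w point)) addrC; apply: le_trans (ler_normD _ _) _.
rewrite lerD2l; apply: le_trans (hA _ _ (Dt x) (Dt point)) _; rewrite ler_pM2l//=.
have B0 : 0 <= Bd := le_trans (R0 point point) (Rst_bound _ _).
rewrite /eucl subrr normr0 max_r//.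
by apply: ge0_ler_powR; rewrite ?nnegrE// ltW.
Qed.

Lemma path_random_variable phi t : L2_orthonormal_basis mu phi -> 0 <= t ->
  L2_random_variable mu (X t).
Proof.
move=> hphi t0; apply: (L2_random_variableP hphi); first by move=> w; exact: path_L2.
exact: (@joint_measurable_balls _ _ _ mu _ _ (fun p => ut t p.2 p.1) (mut t0)).
Qed.

Lemma path_L2_continuous : L2_continuous_paths P mu X.
Proof.
apply: aeW => w t t0 e e0.
have t10 : 0 <= t + 1 by rewrite addr_ge0.
have [A A0 hA] := hut w t10 geta.
have q0 : 0 < e / 2 / A by rewrite !divr_gt0.
exists (Num.min 1 ((e / 2 / A) `^ g^-1)); first by rewrite lt_min ltr01/= powR_gt0.
move=> s s0; rewrite lt_min => /andP[st1 st2].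
have Ds y : (`[0, t + 1] `*` [set: F]) (s, y).
  split => //=; rewrite in_itv/= s0/=; move: st1; rewrite ltr_norml; lra.
have Dt y : (`[0, t + 1] `*` [set: F]) (t, y) by split => //=; rewrite in_itv/= t0 lerDl ler01.
have hX x : `|X s w x - X t w x| <= e / 2.
  apply: le_trans (hA _ _ (Ds x) (Dt x)) _; rewrite /= Rxx max_l ?normr_ge0//.
  rewrite mulrC -ler_pdivlMr//; have -> : e / 2 / A = ((e / 2 / A) `^ g^-1) `^ g.
    by rewrite -powRrM mulVf ?gt_eqF// powRr1// ltW.
  by apply: ge0_ler_powR; rewrite ?nnegrE ?normr_ge0 ?powR_ge0// ltW.
have ms := section_measurable w s0; have mt := section_measurable w t0.
rewrite (L2dist_ltP mu)//.
apply: (@le_lt_trans _ _ (\int[mu]_(x in setT) (cst ((e / 2) ^+ 2)%:E x))%E).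
  apply: ge0_le_integral => //.
  - by move=> x _; rewrite lee_fin sqr_ge0.
  - by apply/measurable_EFinP; apply: measurable_funX; exact: measurable_funB.
  - move=> x _; rewrite lee_fin -real_normK ?num_real//.
    by apply: lerXn2r; rewrite ?nnegrE// divr_ge0// ltW.
rewrite integral_cst//= [X in (_ * X)%E](_ : _ = 1%E) ?mule1 ?lte_fin;
  last exact: probability_setT.
by apply: ltrXn2r => //; rewrite ?divr_ge0 ?(ltW e0)// ltr_pdivrMr// ltr_pMr// ltr1n.
Qed.

End SquareIntegrablePaths.

Theorem theorem4p5 (R : realType) (F : pMetricType R) (M : nat)
  (psi : 'I_M -> F -> F) (hpsi : pcf_self_similar psi)
  (a : F -> F -> R) (r : 'I_M -> R)
  (har : regular_harmonic_structure psi a r)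
  (dH : R) (hdH : hausdorff_exponent r dH)
  (mu : probability (borel F) R) (hmu : self_similar_measure psi r dH mu)
  (b : set F) (hb : b `<=` F0 psi)
  (lam : nat -> R) (phi : nat -> F -> R)
  (hphi : laplacian_eigenbasis psi a r mu b lam phi)
  (d : measure_display) (Omega : measurableType d) (P : probability Omega R)
  (W : R -> (F -> R) -> Omega -> R) (hW : cylindrical_wiener P mu W)
  (beta : R) (hbeta : 0 <= beta)
  (V : R -> R -> R)
  (hV : forall l, 0 <= l -> damped_oscillator beta l (V l))
  (Y : nat -> R -> Omega -> R) (hY : stochastic_convolution P W lam phi V Y)
  (u : R -> F -> Omega -> R) (hu : random_field_solution P phi Y u)
  (U : R -> Omega -> F -> R) (hU : L2_valued_solution P mu phi Y U) :
  let delta := 1 - spectral_dimension dH / 2 in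
  exists ut : R -> F -> Omega -> R,
    random_field_version P u ut /\
    [/\ forall T, 0 < T ->
          {ae P, forall w, ess_holder (`[0, T] `*` [set: F])
             (Rinfty psi a r) eucl (Num.min (1 / 2) delta)
             (fun p => ut p.1 p.2 w)},
        forall t, 0 <= t ->
          {ae P, forall w, ess_holder [set: F]
             (resistance psi a r) eucl (1 / 2) (fun x => ut t x w)},
        forall x T, 0 < T ->
          {ae P, forall w, ess_holder `[0, T]
             eucl eucl delta (fun t => ut t x w)} &
        let X := fun t w x => ut t x w in
        [/\ L2_valued_process mu X,
            L2_continuous_paths P mu X &
            L2_valued_version P mu U X]].
Proof.
move=> delta.
have [hbasis lam00 lamle hlap] := hphi.
have dH0 := hausdorff_exponent_gt0 hpsi har hdH.
have dl0 : 0 < delta.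
  have -> : delta = (dH + 1)^-1.
    by rewrite /delta /spectral_dimension; field; rewrite gt_eqF// addr_gt0.
  by rewrite invr_gt0 ltr_wpDl// ltW.
have phiL2 := eigen_L2 hphi.
have orth := eigen_orthonormal hphi.
have lam0 := eigen_ge0 hphi.
have cV k := oscillator_continuous (hV _ (lam0 k)).
have V0 k := oscillator0 (hV _ (lam0 k)).
have Vb k t (t0 : 0 <= t) := oscillator_bounded hbeta (hV _ (lam0 k)) t0.
have Vl k s t (s0 : 0 <= s) (t0 : 0 <= t) :=
  oscillator_lipschitz hbeta (hV _ (lam0 k)) (lam0 k) s0 t0.
have hR := resistance_bessel hpsi har hphi.
have [Cr Cr0 hCr] := resolvent_bound hpsi har hphi hdH hmu.
pose Rst := resistance psi a r.
have spatial := spatial_tail hW phiL2 orth cV hY hu lam0 V0 Vb Vl hR.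
have temporal := temporal_tail hW phiL2 orth cV hY hu lam0 V0 Vb Vl dl0 Cr0 hCr.
have [L [hF [CF [KF [KF0 hNF]]]]] := cell_nets hpsi har.
have [Bd Bd0 hBd] := resistance_cell hpsi har.
have Rst_bound x y : Rst x y <= Bd.
  by have := hBd [::] x y; rewrite /rw big_nil mulr1.
have um t x (t0 : 0 <= t) : measurable_fun setT (u t x) := (hu t x t0).1.
have R0 x y : 0 <= Rst x y := resistance_ge0 hpsi har x y.
have Rxx x : Rst x x = 0 := resistance_xx psi a r x.
have [ut [utu mut hut]] := field_modification hF
  (fun n => cell_index_lt hpsi (L n)) KF0 hNF
  (fun n => measurable_cell_index hpsi (L n)) Rst_bound um dl0 spatial temporal.
set eta := Num.min (1 / 2) delta in hut.
have eta0 : 0 < eta by rewrite lt_min dl0 andbT divr_gt0.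
have half_eta : 0 < eta / 2 < eta by rewrite divr_gt0//= ltr_pdivrMr// ltr_pMr// ltr1n.
have half0 : 0 < eta / 2 by case/andP: half_eta.
have mutx t x : 0 <= t -> measurable_fun setT (ut t x).
  by move=> t0; exact: (measurableT_comp (mut t t0) (measurable_pair2 (x : borel F))).
exists ut; split; first by move=> t x t0; split; [exact: mutx|exact: utu].
split.
- move=> T T0; apply: aeW => w g geta; have [A A0 hA] := hut w T g (ltW T0) geta.
  by exists A.
- move=> t t0.
  apply: (holder_modification hF (X := u t) (Xt := ut t) _ KF0 hNF _ _ _ half0) => //.
  + by move=> x _; exact: um.
  + by move=> m; exact: (spatial_chaining_tail hF spatial).
  + by move=> x _; exact: utu.
  + move=> w; have [A A0 hA] := hut w t _ t0 half_eta; exists A => // x y _ _.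
    have Dt z : (`[0, t] `*` [set: F]) (t, z) by split => //=; rewrite in_itv/= t0 lexx.
    by have := hA _ _ (Dt x) (Dt y); rewrite /= /eucl subrr normr0 max_r.
- move=> x T T0; have T0' := ltW T0.
  apply: (holder_modification (dyadic_nets T0') (X := fun t => u t x) (Xt := fun t => ut t x)
    dl0 _ (fun n => dyadic_size_le n T0') _ _ _ half0) => //.
  + by move=> t; rewrite /= in_itv/= => /andP[t0 _]; exact: um.
  + by move=> m; exact: (temporal_chaining_tail temporal).
  + by move=> t; rewrite /= in_itv/= => /andP[t0 _]; exact: utu.
  + move=> w; have [A A0 hA] := hut w T _ T0' half_eta; exists A => // t s Dt Ds.
    have := hA (t, x) (s, x) (conj Dt I) (conj Ds I).
    by rewrite /= resistance_xx max_l// normr_ge0.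
- move=> X; split.
  + by move=> t t0; exact: (path_random_variable R0 Rst_bound eta0 mut hut hbasis t0).
  + exact: (path_L2_continuous P mu Rxx eta0 mut hut).
  + move=> t t0; have [hU1 hU2] := hU t t0.
    have mS n : measurable_fun setT (fun p : Omega * borel F => partial_sum phi Y t n p.1 p.2).
      rewrite /partial_sum; apply: measurable_sum => k; apply: measurable_funM.
        by apply: measurableT_comp measurable_fst; have [] := hY k t t0.
      exact: measurableT_comp (L2_measurable (phiL2 k)) measurable_snd.
    apply: (version_of_limits hbasis (mut t t0) mS _ hU1 hU2).
      by move=> n w; exact: (L2_sum (fun k => Y k t w)).
    move=> x; apply: (cvg_in_prob_ae (mutx t x t0) (utu t x t0)).
    exact: (partial_sum_in_prob hY hu).
Qed.
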